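(* Let $n\in\{2,3\}$ and let $a_1<0$, $a_3>0$, and either $a_2<0$ (case DDF) or $a_2>0$ (case DFF). Then there exists a unique radial positive solution $\phi$, with $\phi(x)\to 0$ as $|x|\to\infty$, of $$\Delta\phi+a_1|\phi|\phi+a_2|\phi|^2\phi+a_3|\phi|^3\phi=0\quad\text{on }\mathbb{R}^n.$$
   Context: D (defocusing) means $a_i<0$ and F (focusing) means $a_i>0$, listed for $i=1,2,3$. Solutions are classical ($C^2$); ''radial'' means radially symmetric about the origin. *)

(* Defs.v *)
From mathcomp Require Import all_boot all_order all_algebra.
From mathcomp Require Import all_classical all_reals all_analysis.

Set Implicit Arguments.
Unset Strict Implicit.
Unset Printing Implicit Defensive.

Import Order.TTheory GRing.Theory Num.Theory.
Import numFieldNormedType.Exports.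

Local Open Scope classical_set_scope.
Local Open Scope ring_scope.

(* The library norm `|x| on 'rV[R]_n is the sup norm; it induces the usual
   topology of R^n, but radial symmetry refers to the Euclidean norm. *)
Definition enorm (R : realType) (n : nat) (x : 'rV[R]_n) : R :=
  Num.sqrt (\sum_(i < n) x ord0 i ^+ 2).

Definition radial (R : realType) (n : nat) (f : 'rV[R]_n -> R) : Prop :=
  forall x y, enorm x = enorm y -> f x = f y.

(* The filter "|x| --> +oo" on R^n. *)
Definition enorm_pinfty (R : realType) (n : nat) : set_system 'rV[R]_n :=
  filter_from setT (fun M : R => [set x | M < enorm x]).

Global Instance enorm_pinfty_filter (R : realType) (n : nat) :
  Filter (@enorm_pinfty R n).
Proof.
apply: filter_fromT_filter; first by exists 0.
move=> M N; exists (Num.max M N) => x /=.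
by rewrite gt_max => /andP[].
Qed.

Definition pderive (R : realType) (n : nat) (i : 'I_n) (f : 'rV[R]_n -> R)
    (x : 'rV[R]_n) : R :=
  'D_(delta_mx ord0 i) f x.

(* The library derivative is total, so existence of the partial derivatives
   is required separately. *)
Fixpoint class_C (R : realType) (n k : nat) (f : 'rV[R]_n -> R) : Prop :=
  match k with
  | 0 => continuous f
  | k'.+1 => continuous f /\
      forall i : 'I_n, (forall x, derivable f x (delta_mx ord0 i)) /\
                       class_C k' (pderive i f)
  end.

Definition laplacian (R : realType) (n : nat) (f : 'rV[R]_n -> R)
    (x : 'rV[R]_n) : R :=
  \sum_(i < n) pderive i (pderive i f) x.

(* Main.v *)
Require Import Defs.
From mathcomp Require Import all_boot all_order all_algebra.
From mathcomp Require Import all_classical all_reals all_analysis.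
From mathcomp Require Import ring lra.
Import Order.TTheory GRing.Theory Num.Theory.
Import numFieldNormedType.Exports.

(** Write [n = N.+1].  On positive values the nonlinearity has the form
    [f u = a * u ^+ 2 * (u - th) * (u + b)] with [a, th, b > 0], for both signs
    of the middle coefficient; let [F] be its primitive.  A radial function
    [u (enorm x)] solves the equation if and only if
    [u'' + N / r * u' + f u = 0] and [u' 0 = 0].  So the theorem says that this
    singular ordinary differential equation has exactly one positive solution
    that tends to [0] ([ground_state_exists], [ground_state_unique]).

    Uniqueness follows Pucci and Serrin.  The energy [u' ^+ 2 / 2 + F u]
    is decreasing and, in the limit, nonnegative, which forces [u' < 0].  The
    functional
    [P = r ^+ n * (u' ^+ 2 / 2 + F u) + n * r ^+ N * u' * (F / f) u] has the
    derivative [r ^+ N * u' ^+ 2 * K u] with [K >= 1 / 40] in dimensions [2] and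
    [3] ([pweight_lower]), and it tends to [0] at infinity because the flux
    [- r ^+ N * u'] converges, which forces [r ^+ n * u ^+ 2] to tend to [0]
    ([ground_decay], [pfun_vanishing]); near [0] the equation has no mass
    term, so that the decay is only algebraic.  Given two solutions with
    different initial heights, compare them at equal heights.  The ratio of
    their fluxes is monotone on every stretch on which [f] and the difference
    of the slopes have constant signs.  For a suitable constant [k] the
    combination [Q = P2 - k * P1] is then monotone in a way that contradicts
    its boundary values.  Either the slopes never coincide ([no_contact]), or
    one takes [k] to be the flux ratio where they first coincide ([contact]).

    Existence is by shooting on the initial height [alpha], with the
    nonlinearity truncated to arguments in [[0, M]].  The solutions of the
    initial value problem ([radial_sol_exists]) depend continuously on
    [alpha] ([gronwall_forward]).  The set of heights for which the energy
    becomes negative while [u > 0] and the set of heights for which [u] becomes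
    negative are open and disjoint.  The first contains [th].  For [M]
    large the second contains [M] ([crossing]): the functional [P] grows with
    the height, because the power [4] is subcritical in dimension at most [3],
    and makes the fall too steep to be stopped.  A height in neither set yields
    a decreasing positive solution, whose limit can only be [0]
    ([limit_zero]).

    Finally [phi x = u (enorm x)] is twice continuously differentiable also at
    the origin, because [u' r / r] has a limit there
    ([ground_solution_class_C2]), and conversely the profile of a radial
    solution solves the ordinary differential equation
    ([profile_ground_state]). *)

Set Implicit Arguments.
Unset Strict Implicit.
Unset Printing Implicit Defensive.
Local Open Scope classical_set_scope.
Local Open Scope ring_scope.

(** * Calculus on the line *)

Section ContinuityRules.
Context {R : realType}.
Implicit Types (f g : R -> R) (x : R).

(** An inductive wrapper, so that unification never unfolds the underlying
    convergence of filters. *)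
Variant continuous_at f x : Prop :=
  ContinuousAt of {for x, continuous f}.

Lemma continuous_atP f x : continuous_at f x <-> {for x, continuous f}.
Proof. by split => [[]|/ContinuousAt]. Qed.

Lemma continuous_at_cst x (c : R) : continuous_at (fun=> c) x.
Proof. by apply/continuous_atP; exact: cvg_cst. Qed.

Lemma continuous_at_id x : continuous_at (fun t => t) x.
Proof. by apply/continuous_atP; exact: cvg_id. Qed.

Lemma continuous_atD f g x : continuous_at f x -> continuous_at g x ->
  continuous_at (fun t => f t + g t) x.
Proof. by move=> [cf] [cg]; apply/continuous_atP; exact: continuousD. Qed.

Lemma continuous_atN f x : continuous_at f x -> continuous_at (fun t => - f t) x.
Proof. by move=> [cf]; apply/continuous_atP; exact: continuousN. Qed.

Lemma continuous_atM f g x : continuous_at f x -> continuous_at g x ->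
  continuous_at (fun t => f t * g t) x.
Proof. by move=> [cf] [cg]; apply/continuous_atP; exact: continuousM. Qed.

Lemma continuous_atV f x : f x != 0 -> continuous_at f x ->
  continuous_at (fun t => (f t)^-1) x.
Proof. by move=> f0 [cf]; apply/continuous_atP; exact: continuousV. Qed.

Lemma continuous_atX f n x : continuous_at f x ->
  continuous_at (fun t => f t ^+ n) x.
Proof.
move=> cf; elim: n => [|n IH].
  by rewrite (_ : (fun t => f t ^+ 0) = fun=> 1)//; exact: continuous_at_cst.
rewrite (_ : (fun t => f t ^+ n.+1) = fun t => f t * f t ^+ n).
  exact: continuous_atM.
by apply/funext => t; rewrite exprS.
Qed.

Lemma continuous_at_comp f g x : continuous_at g x -> continuous_at f (g x) ->
  continuous_at (fun t => f (g t)) x.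
Proof. by move=> [cg] [cf]; apply/continuous_atP; exact: continuous_comp. Qed.

Lemma continuous_at_near (f g : R -> R) x : (\near x, f x = g x) ->
  continuous_at f x -> continuous_at g x.
Proof.
move=> fg [cf]; apply/continuous_atP.
change (g @ x --> g x); rewrite -(nbhs_singleton fg).
by apply: cvg_trans cf; exact: near_eq_cvg.
Qed.

Lemma continuous_at_norm x : continuous_at (fun t : R => `|t|) x.
Proof. by apply/continuous_atP; exact: norm_continuous. Qed.

End ContinuityRules.

Section DerivativeRules.
Context {R : realType}.
Implicit Types (f g : R -> R) (x y l m : R).

Lemma derivative_eq f x l m : is_derive x 1 f l -> l = m -> is_derive x 1 f m.
Proof. by move=> + <-. Qed.

Lemma derivative_cst x c : is_derive x 1 (fun=> c : R) 0.
Proof. exact: is_derive_cst. Qed.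

Lemma derivative_id x : is_derive x (1 : R) (fun t : R => t) 1.
Proof. exact: is_derive_id. Qed.

Lemma derivativeD f g x l m : is_derive x 1 f l -> is_derive x 1 g m ->
  is_derive x 1 (fun t => f t + g t) (l + m).
Proof. exact: is_deriveD. Qed.

Lemma derivativeN f x l : is_derive x 1 f l -> is_derive x 1 (fun t => - f t) (- l).
Proof. exact: is_deriveN. Qed.

Lemma derivativeB f g x l m : is_derive x 1 f l -> is_derive x 1 g m ->
  is_derive x 1 (fun t => f t - g t) (l - m).
Proof. exact: is_deriveB. Qed.

Lemma derivativeM f g x l m : is_derive x 1 f l -> is_derive x 1 g m ->
  is_derive x 1 (fun t => f t * g t) (l * g x + f x * m).
Proof.
move=> df dg; apply: (derivative_eq (is_deriveM df dg)).
by rewrite /GRing.scale /= addrC; congr (_ + _); rewrite mulrC.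
Qed.

Lemma derivativeX f n x l : is_derive x 1 f l ->
  is_derive x 1 (fun t => f t ^+ n) (n%:R * f x ^+ n.-1 * l).
Proof. by move=> df; have := is_deriveX n df; rewrite exprfctE. Qed.

Lemma derivativeZ f x l (c : R) : is_derive x 1 f l ->
  is_derive x 1 (fun t => c * f t) (c * l).
Proof. exact: is_deriveZ. Qed.

Lemma derivativeV f x l : f x != 0 -> is_derive x 1 f l ->
  is_derive x 1 (fun t => (f t)^-1) (- l / f x ^+ 2).
Proof.
move=> fx df; apply: (derivative_eq (is_deriveV fx df)).
by rewrite /GRing.scale /=; field.
Qed.

Lemma derivative_div f g x l m : g x != 0 -> is_derive x 1 f l ->
  is_derive x 1 g m ->
  is_derive x 1 (fun t => f t / g t) ((l * g x - f x * m) / g x ^+ 2).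
Proof.
move=> gx df dg; apply: (derivative_eq (derivativeM df (derivativeV gx dg))).
by field.
Qed.

Lemma derivative_comp f g x l m : is_derive x 1 g l -> is_derive (g x) 1 f m ->
  is_derive x 1 (fun t => f (g t)) (m * l).
Proof.
move=> dg df.
have [d1 e1] := dg; have [d2 e2] := df.
apply: DeriveDef.
  by apply/derivable1_diffP/differentiable_comp; apply/derivable1_diffP.
by rewrite -derive1E (derive1_comp d1 d2) !derive1E e1 e2.
Qed.

Lemma derivative_near f g x l : (\near x, f x = g x) ->
  is_derive x 1 f l -> is_derive x 1 g l.
Proof. exact: near_eq_is_derive. Qed.

Lemma derivative_continuous f x l : is_derive x 1 f l -> continuous_at f x.
Proof.
by move=> df; apply/continuous_atP/differentiable_continuous/derivable1_diffP.
Qed.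

Lemma derivative_unique f x l m :
  is_derive x 1 f l -> is_derive x 1 f m -> l = m.
Proof.
move=> df dg.
by rewrite -(@derive_val _ _ _ _ _ _ _ df) (@derive_val _ _ _ _ _ _ _ dg).
Qed.

Lemma derivative_expR (c x : R) :
  is_derive x 1 (fun t => expR (c * t)) (c * expR (c * x)).
Proof.
apply: (derivative_eq (derivative_comp (derivativeZ c (derivative_id x))
  (is_derive_expR (c * x)))).
by rewrite mulr1 mulrC.
Qed.

End DerivativeRules.

Section MeanValue.
Context {R : realType}.
Implicit Types (f df : R -> R) (a b : R).

Lemma mean_value f df a b : a < b ->
  (forall x, a <= x <= b -> continuous_at f x) ->
  (forall x, a < x < b -> is_derive x 1 f (df x)) ->
  exists2 c, a < c < b & f b - f a = df c * (b - a).
Proof.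
move=> ab cf dfx.
have wf : {within `[a, b], continuous f}.
  by apply: continuous_in_subspaceT => x; rewrite inE /= in_itv /= => /cf[].
have dfi x : x \in `]a, b[%R -> is_derive x 1 f (df x).
  by rewrite in_itv /=; exact: dfx.
have [c] := MVT ab dfi wf.
by rewrite in_itv /= => cab E; exists c.
Qed.

Lemma derivative_ge0_le f df a b : a <= b ->
  (forall x, a <= x <= b -> continuous_at f x) ->
  (forall x, a < x < b -> is_derive x 1 f (df x)) ->
  (forall x, a < x < b -> 0 <= df x) -> f a <= f b.
Proof.
rewrite le_eqVlt => /orP[/eqP->//|ab] cf dfx df0.
have [c /df0 c0 E] := mean_value ab cf dfx.
by rewrite -subr_ge0 E mulr_ge0 // subr_ge0 ltW.
Qed.

Lemma derivative_gt0_lt f df a b : a < b ->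
  (forall x, a <= x <= b -> continuous_at f x) ->
  (forall x, a < x < b -> is_derive x 1 f (df x)) ->
  (forall x, a < x < b -> 0 < df x) -> f a < f b.
Proof.
move=> ab cf dfx df0.
have [c /df0 c0 E] := mean_value ab cf dfx.
by rewrite -subr_gt0 E mulr_gt0 // subr_gt0.
Qed.

Lemma derivative_le0_ge f df a b : a <= b ->
  (forall x, a <= x <= b -> continuous_at f x) ->
  (forall x, a < x < b -> is_derive x 1 f (df x)) ->
  (forall x, a < x < b -> df x <= 0) -> f b <= f a.
Proof.
rewrite le_eqVlt => /orP[/eqP->//|ab] cf dfx df0.
have [c /df0 c0 E] := mean_value ab cf dfx.
by rewrite -subr_le0 E mulr_le0_ge0 // subr_ge0 ltW.
Qed.

Lemma derivative_lt0_gt f df a b : a < b ->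
  (forall x, a <= x <= b -> continuous_at f x) ->
  (forall x, a < x < b -> is_derive x 1 f (df x)) ->
  (forall x, a < x < b -> df x < 0) -> f b < f a.
Proof.
move=> ab cf dfx df0.
have [c /df0 c0 E] := mean_value ab cf dfx.
by rewrite -subr_lt0 E nmulr_rlt0 // subr_gt0.
Qed.

Lemma intermediate_value f a b v : a <= b ->
  (forall x, a <= x <= b -> continuous_at f x) ->
  f a <= v <= f b -> exists2 c, a <= c <= b & f c = v.
Proof.
move=> ab cf /andP[av vb].
have wf : {within `[a, b], continuous f}.
  by apply: continuous_in_subspaceT => x; rewrite inE /= in_itv /= => /cf[].
have vab : Num.min (f a) (f b) <= v <= Num.max (f a) (f b).
  by rewrite ge_min av le_max vb orbT.
have [c] := IVT ab wf vab.
by rewrite in_itv /= => cab E; exists c.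
Qed.

Lemma near_lt f x c : continuous_at f x -> f x < c ->
  exists2 d, 0 < d & forall y, `|y - x| < d -> f y < c.
Proof.
move=> [cf] fx; have : \forall y \near x, f y < c.
  exact: (cvgr_lt (f x) cf).
case/nbhs_ballP => d d0 H; exists d => // y yx; apply: H.
by rewrite /ball /= distrC.
Qed.

Lemma near_gt f x c : continuous_at f x -> c < f x ->
  exists2 d, 0 < d & forall y, `|y - x| < d -> c < f y.
Proof.
move=> [cf] fx; have : \forall y \near x, c < f y.
  exact: (cvgr_gt (f x) cf).
case/nbhs_ballP => d d0 H; exists d => // y yx; apply: H.
by rewrite /ball /= distrC.
Qed.

Lemma first_zero f a b : a <= b ->
  (forall x, a <= x <= b -> continuous_at f x) ->
  f a < 0 -> 0 <= f b ->
  exists c, [/\ a < c <= b, f c = 0 & forall t, a <= t < c -> f t < 0].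
Proof.
move=> ab cf fa fb.
pose S := [set t | a <= t <= b /\ 0 <= f t].
have Sb : S b by split; rewrite ?ab ?lexx.
have lbS : lbound S a by move=> t [/andP[]].
have hS : has_inf S by split; [exists b|exists a].
have ac : a <= inf S by apply: lb_le_inf => //; exists b.
have cb : inf S <= b by apply: inf_lbound => //; case: hS.
have below t : a <= t < inf S -> f t < 0.
  move=> /andP[at_ tc]; rewrite ltNge; apply/negP => ft.
  have : inf S <= t.
    apply: inf_lbound; first by case: hS.
    by split => //; rewrite at_ (le_trans (ltW tc)).
  by rewrite leNgt tc.
have fc0 : 0 <= f (inf S).
  rewrite leNgt; apply/negP => fc.
  have [d d0 H] := near_lt (cf (inf S) ltac:(by rewrite ac cb)) fc.
  have [t [tab ft] td] := inf_adherent d0 hS.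
  have ct : inf S <= t by apply: inf_lbound => //; case: hS.
  have : f t < 0 by apply: H; rewrite ger0_norm; lra.
  by rewrite ltNge ft.
have [c /andP[c1 c2] fc] : exists2 c, a <= c <= inf S & f c = 0.
  apply: intermediate_value => //; last by rewrite (ltW fa).
  by move=> x /andP[x1 x2]; apply: cf; rewrite x1 (le_trans x2).
have cE : c = inf S.
  apply/eqP; rewrite eq_le c2 leNgt; apply/negP => lt.
  by move: (below c); rewrite c1 lt fc ltxx => /(_ isT).
exists (inf S); rewrite -cE; split => //; last by rewrite cE.
rewrite cE cb andbT lt_neqAle ac andbT; apply: contraTneq fc0 => <-.
by rewrite -ltNge.
Qed.

Lemma derivative_first_zero f a c l : a < c -> f c = 0 ->
  (forall t, a <= t < c -> f t < 0) -> is_derive c 1 f l -> 0 <= l.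
Proof.
move=> ac fc neg /is_derive1_caratheodory [h [hE /ContinuousAt ch hc]].
rewrite leNgt; apply/negP => l0.
have [d d0 H] := near_lt ch (c := 0) ltac:(by rewrite hc).
pose t := Num.max a (c - d / 2).
have tc : t < c by rewrite gt_max ac; lra.
have at_ : a <= t by rewrite le_max lexx.
have dt : c - d / 2 <= t by rewrite le_max lexx orbT.
have : f t < 0 by apply: neg; rewrite at_.
have ht : h t < 0 by apply: H; rewrite ler0_norm; lra.
have := hE t; rewrite fc subr0 => ->; rewrite ltNge nmulr_rge0 //; lra.
Qed.

Lemma derivative_gt0_right f (c l : R) : f c = 0 -> 0 < l ->
  is_derive c 1 f l -> exists2 d, 0 < d & forall t, c < t < c + d -> 0 < f t.
Proof.
move=> fc l0 /is_derive1_caratheodory [h [hE /ContinuousAt ch hc]].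
have [d d0 H] := near_gt ch (c := 0) ltac:(by rewrite hc).
exists d => // t /andP[ct td]; have := hE t; rewrite fc subr0 => ->.
rewrite mulr_gt0 ?subr_gt0 // H // gtr0_norm; lra.
Qed.

(** By the mean value theorem, a difference quotient at [c] is a value of [k]
    near [c]. *)
Lemma derivative_extend (g k : R -> R) (c : R) :
  (forall y : R, y != c -> is_derive y 1 g (k y)) -> continuous_at g c ->
  continuous_at k c -> is_derive c 1 g (k c).
Proof.
move=> dg cg ck; apply/is_derive1_caratheodory.
have cgy (y : R) : continuous_at g y.
  by have [->//|yc] := eqVneq y c; exact: derivative_continuous (dg _ yc).
exists (fun y : R => if y == c then k c else (g y - g c) / (y - c)).
rewrite eqxx; split => //.
  move=> z; have [->|zc] := eqVneq z c; first by rewrite !subrr mulr0.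
  by rewrite divfK // subr_eq0.
apply/cvgrPdist_lt => e e0; rewrite eqxx; apply/nbhs_ballP.
have [/cvgrPdist_lt /(_ e e0)/nbhs_ballP[d d0 Hd]] := ck.
exists d => // y; rewrite /ball /= => yd.
have [_|yc] := eqVneq y c; first by rewrite subrr normr0.
have [z [z0 ->]] : exists z, `|c - z| < d /\ (g y - g c) / (y - c) = k z.
  move: yc; rewrite neq_lt => /orP[lt|lt].
    have [z /andP[z1 z2] E] := mean_value (f := g) (df := k) lt
      (fun v _ => cgy v) (fun v h => dg v ltac:(by case/andP: h => _ h; rewrite lt_eqF)).
    exists z; split; first by move: yd; rewrite !ger0_norm; lra.
    have yc0 : y - c != 0 by rewrite subr_eq0 lt_eqF.
    apply: (mulIf yc0); rewrite divfK //.
    by rewrite -[LHS]opprB E -mulrN opprB.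
  have [z /andP[z1 z2] E] := mean_value (f := g) (df := k) lt
    (fun v _ => cgy v) (fun v h => dg v ltac:(by case/andP: h => h _; rewrite gt_eqF)).
  exists z; split; first by move: yd; rewrite !ler0_norm; lra.
  have yc0 : y - c != 0 by rewrite subr_eq0 gt_eqF.
  by apply: (mulIf yc0); rewrite divfK.
exact: Hd.
Qed.

End MeanValue.

Section Primitive.
Context {R : realType}.

(** The base point [-1] makes [0] interior, so that one-sided derivatives at
    the origin are avoided. *)
Lemma primitive (g : R -> R) : continuous g ->
  exists2 G : R -> R, G 0 = 0 & forall x : R, -1 < x -> is_derive x 1 G (g x).
Proof.
move=> cg.
pose F x := \int[@lebesgue_measure R]_(t in [set` `[-1, x]]) g t.
have dF (x : R) : -1 < x -> is_derive x 1 F (g x).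
  move=> x1; have [] := @continuous_FTC1_closed R g (-1) x (x + 1).
  - by rewrite ltrDl.
  - apply: continuous_compact_integrable; first exact: segment_compact.
    exact: continuous_subspaceT.
  - exact: x1.
  - exact: cg.
  by move=> d E; apply: DeriveDef; [exact: d|rewrite -derive1E].
exists (fun x => F x - F 0); first by rewrite subrr.
move=> x /dF d; by apply: (derivative_eq (derivativeB d (derivative_cst x (F 0)))); rewrite subr0.
Qed.

End Primitive.

Ltac cont_step := first
  [ assumption | solve [eauto 2]
  | apply continuous_at_cst
  | apply continuous_at_id
  | apply continuous_atD
  | apply continuous_atN
  | apply continuous_atX
  | apply continuous_atM
  | exact (derivative_continuous (derivative_expR _ _)) ].
Ltac cont := repeat cont_step.

Ltac deriv_step := first
  [ eassumption
  | eapply derivative_cst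
  | eapply derivative_id
  | eapply derivative_expR
  | eapply derivativeD
  | eapply derivativeN
  | eapply derivativeX
  | eapply derivativeM ].
Ltac deriv := eapply derivative_eq; [solve [repeat deriv_step] | ].

(** * The radial equation *)

Section RadialEquation.
Context {R : realType}.
Variable N : nat.
Implicit Types (f g u v p q : R -> R) (r t a b : R).

Definition radial_eq g u p : Prop :=
  [/\ forall r, 0 <= r -> continuous_at u r,
      forall r, 0 <= r -> continuous_at p r,
      p 0 = 0,
      forall r, 0 < r -> is_derive r 1 u (p r) &
      forall r, 0 < r -> is_derive r 1 p (- (N%:R * p r / r) - g r)].

Definition radial_sol f u p := radial_eq (fun r => f (u r)) u p.

Lemma flux_derivative g u p r : radial_eq g u p -> 0 < r ->
  is_derive r 1 (fun t => t ^+ N * p t) (- (r ^+ N * g r)).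
Proof.
move=> [_ _ _ _ dp] r0; have dpr := dp _ r0.
deriv; have rn0 : r != 0 by rewrite gt_eqF.
case: N => [|n]; first by rewrite /=; ring.
by rewrite /= exprS; field.
Qed.

Lemma flux_continuous g u p r : radial_eq g u p -> 0 <= r ->
  continuous_at ((fun t => t ^+ N * p t)) r.
Proof. by move=> [_ cp _ _ _] r0; have cpr := cp _ r0; cont. Qed.

(** The energy is dissipated at the rate [N * p r ^+ 2 / r]. *)
Lemma energy_le f F u p a b : radial_sol f u p -> 0 <= a <= b ->
  (forall r, a <= r <= b -> is_derive (u r) 1 F (f (u r))) ->
  p b ^+ 2 / 2 + F (u b) <= p a ^+ 2 / 2 + F (u a).
Proof.
move=> [cu cp _ du dp] /andP[a0 ab] dF.
apply: (@derivative_le0_ge _ (fun r => p r ^+ 2 / 2 + F (u r))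
  (fun r => - (N%:R * p r ^+ 2 / r))) => // [r rab|r /andP[ar rb]|r /andP[ar _]].
- have r0 : 0 <= r by lra.
  have cF := derivative_continuous (dF _ rab).
  have cur := cu _ r0; have cpr := cp _ r0.
  have := continuous_at_comp cur cF => cFu.
  by cont.
- have r0 : 0 < r by lra.
  have dur := du _ r0; have dpr := dp _ r0.
  have dFr := derivative_comp dur (dF r ltac:(lra)).
  deriv; rewrite /=; field; by rewrite gt_eqF.
- rewrite oppr_le0 mulr_ge0 // ?invr_ge0; last lra.
  by rewrite mulr_ge0 // sqr_ge0.
Qed.

Section TwoSolutions.
Variables (f u v p q : R -> R) (L rho : R).
Hypotheses (su : radial_sol f u p) (sv : radial_sol f v q) (L0 : 0 <= L).
Hypothesis lip : forall r, 0 <= r <= rho ->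
  `|f (u r) - f (v r)| <= L * `|u r - v r|.

Let D r := (u r - v r) ^+ 2 + (p r - q r) ^+ 2.

Let D_ge0 r : 0 <= D r. Proof. by rewrite addr_ge0 ?sqr_ge0. Qed.

Let D1 (c r : R) := (2 * (u r - v r) * (p r - q r)
    - 2 * N%:R * (p r - q r) ^+ 2 / r
    - 2 * (p r - q r) * (f (u r) - f (v r)) + c * D r) * expR (c * r).

Let dD (c r : R) : 0 < r ->
  is_derive r 1 (fun t => D t * expR (c * t)) (D1 c r).
Proof.
move=> r0; have [_ _ _ du dp] := su; have [_ _ _ dv dq] := sv.
have dur := du _ r0; have dpr := dp _ r0.
have dvr := dv _ r0; have dqr := dq _ r0.
by rewrite /D1 /D; deriv; rewrite /=; field; rewrite gt_eqF.
Qed.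

Let cD (c r : R) : 0 <= r -> continuous_at ((fun t => D t * expR (c * t))) r.
Proof.
move=> r0; have [cu cp _ _ _] := su; have [cv cq _ _ _] := sv.
have cur := cu _ r0; have cpr := cp _ r0.
have cvr := cv _ r0; have cqr := cq _ r0.
by rewrite /D; cont.
Qed.

Let cross r : 0 <= r <= rho ->
  `|2 * (u r - v r) * (p r - q r) - 2 * (p r - q r) * (f (u r) - f (v r))|
   <= (L + 1) * D r.
Proof.
move=> /lip; rewrite /D.
set d := u r - v r; set e := p r - q r; set h := f _ - f _ => H.
apply: le_trans (ler_normB _ _) _.
rewrite !normrM (ger0_norm (ler0n R 2)).
rewrite -[d ^+ 2]real_normK ?num_real // -[e ^+ 2]real_normK ?num_real //.
have := normr_ge0 d; have := normr_ge0 e; have := normr_ge0 h.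
move: `|d| `|e| `|h| H => x y z H z0 y0 x0.
have : y * z <= y * (L * x) by rewrite ler_wpM2l.
have : 0 <= L * (x - y) ^+ 2 by rewrite mulr_ge0 // sqr_ge0.
have : 0 <= (x - y) ^+ 2 by rewrite sqr_ge0.
by nra.
Qed.

Lemma gronwall_forward r : 0 <= r <= rho -> D r <= D 0 * expR ((L + 1) * r).
Proof.
move=> /andP[r0 rr].
have : D r * expR (- (L + 1) * r) <= D 0 * expR (- (L + 1) * 0).
  apply: (@derivative_le0_ge _ (fun t => D t * expR (- (L + 1) * t))
    (D1 (- (L + 1))) _ _ r0).
  - by move=> x /andP[x0 _]; exact: cD.
  - by move=> x /andP[x0 _]; exact: dD.
  - move=> x /andP[x0 xr]; rewrite /D1 pmulr_lle0 ?expR_gt0 //.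
    have := cross (r := x) ltac:(by rewrite ltW // (le_trans (ltW xr))).
    rewrite ler_norml => /andP[_].
    have : 0 <= 2 * N%:R * (p x - q x) ^+ 2 / x.
      by rewrite mulr_ge0 ?invr_ge0 ?(ltW x0) // mulr_ge0 ?sqr_ge0 // mulr_ge0.
    by move: (2 * N%:R * _ ^+ 2 / _) => z; lra.
rewrite mulr0 expR0 mulr1 mulNr expRN.
by rewrite ler_pdivrMr ?expR_gt0.
Qed.

(** Backwards in time the friction term amplifies differences, but it is
    bounded on [[r, rho]] for every [r > 0]; the value at [0] follows by
    continuity. *)
Lemma gronwall_backward : 0 < rho -> u rho = v rho -> p rho = q rho ->
  u 0 = v 0.
Proof.
move=> rho0 uv pq.
have Drho : D rho = 0 by rewrite /D uv pq !subrr expr0n /= addr0.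
have eqr r : 0 < r <= rho -> u r - v r = 0.
  move=> /andP[r0 rr].
  have : D r * expR ((L + 1 + 2 * N%:R / r) * r)
      <= D rho * expR ((L + 1 + 2 * N%:R / r) * rho).
    apply: (@derivative_ge0_le _
      (fun t => D t * expR ((L + 1 + 2 * N%:R / r) * t))
      (D1 (L + 1 + 2 * N%:R / r)) _ _ rr).
    - by move=> x /andP[rx _]; apply: cD; apply: le_trans rx; exact: ltW.
    - by move=> x /andP[rx _]; apply: dD; exact: lt_trans rx.
    - move=> x /andP[rx xrho]; have x0 := lt_trans r0 rx.
      rewrite /D1 pmulr_lge0 ?expR_gt0 //.
      have := cross (r := x) ltac:(by rewrite (ltW x0) ltW).
      rewrite ler_norml => /andP[+ _].
      have : 2 * N%:R * (p x - q x) ^+ 2 / x <= 2 * N%:R / r * D x.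
        rewrite mulrAC; apply: ler_pM.
        - by rewrite mulr_ge0 ?mulr_ge0 // invr_ge0 ltW.
        - exact: sqr_ge0.
        - apply: ler_wpM2l; first by rewrite mulr_ge0.
          by rewrite lef_pV2 ?posrE // ltW.
        - by rewrite /D lerDr sqr_ge0.
      move: (2 * N%:R * _ ^+ 2 / _) => z.
      by rewrite mulrDl; move: (2 * N%:R / r * D x) => y; lra.
  rewrite Drho mul0r pmulr_lle0 ?expR_gt0 // => Dr.
  have /eqP : D r = 0 by apply/eqP; rewrite eq_le Dr D_ge0.
  rewrite /D paddr_eq0 ?sqr_ge0 // => /andP[].
  by rewrite sqrf_eq0 => /eqP.
have [cu _ _ _ _] := su; have [cv _ _ _ _] := sv.
have cu0 := cu _ (lexx 0); have cv0 := cv _ (lexx 0).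
have cw : continuous_at ((fun r => u r - v r)) 0 by cont.
have small d : 0 < d -> exists2 m, 0 < m <= rho & `|m - 0| < d.
  move=> d0; have m0 : 0 < Num.min (d / 2) rho by rewrite lt_min rho0 divr_gt0.
  exists (Num.min (d / 2) rho); first by rewrite m0 ge_min lexx orbT.
  rewrite subr0 gtr0_norm // gt_min; apply/orP; left; lra.
apply/eqP; rewrite -subr_eq0; apply/eqP.
case: (ltgtP (u 0 - v 0) 0) => // uv0.
- have [d d0 H] := near_lt cw uv0.
  have [m m0 md] := small _ d0.
  by have := H m md; rewrite eqr // ltxx.
- have [d d0 H] := near_gt cw uv0.
  have [m m0 md] := small _ d0.
  by have := H m md; rewrite eqr // ltxx.
Qed.

End TwoSolutions.

End RadialEquation.

Section FluxBounds.
Context {R : realType}.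
Variable N : nat.
Implicit Types (g u p : R -> R) (r t c : R).

Lemma slope_le g u p c r : radial_eq N g u p -> 0 < r ->
  (forall t, 0 < t < r -> c <= g t) -> p r <= - (c * r / N.+1%:R).
Proof.
move=> s r0 H; have [_ _ p0 _ _] := s.
have Nn : N.+1%:R != 0 :> R by rewrite pnatr_eq0.
pose W t := t ^+ N * p t + c / N.+1%:R * t ^+ N.+1.
have : W r <= W 0.
  apply: (derivative_le0_ge (df := fun t => t ^+ N * (c - g t)) (ltW r0)).
  - move=> t /andP[t0 _]; have c1 := flux_continuous s t0.
    by rewrite /W; cont.
  - move=> t /andP[t0 _]; have d1 := flux_derivative s t0.
    by rewrite /W; deriv; rewrite /=; field.
  - move=> t /andP[t0 tr]; rewrite mulr_ge0_le0 ?exprn_ge0 ?(ltW t0) //.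
    by rewrite subr_le0 H // t0.
rewrite /W p0 mulr0 expr0n /= mulr0 addr0 exprS => h.
rewrite -(ler_pM2l (exprn_gt0 N r0)) -subr_ge0 -oppr_le0.
by apply: le_trans h; rewrite le_eqVlt; apply/orP; left; apply/eqP; field.
Qed.

Lemma slope_ge g u p c r : radial_eq N g u p -> 0 < r ->
  (forall t, 0 < t < r -> g t <= c) -> - (c * r / N.+1%:R) <= p r.
Proof.
move=> s r0 H.
have s' : radial_eq N (fun t => - g t) (fun t => - u t) (fun t => - p t).
  have [cu cp p0 du dp] := s; split.
  - by move=> t t0; apply: continuous_atN; exact: cu.
  - by move=> t t0; apply: continuous_atN; exact: cp.
  - by rewrite p0 oppr0.
  - by move=> t t0; apply: derivativeN; exact: du.
  - move=> t t0; apply: (derivative_eq (derivativeN (dp _ t0))).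
    by rewrite mulrN mulNr; ring.
have := slope_le (c := - c) s' r0.
rewrite !mulNr opprK lerNl; apply => t /H; by rewrite lerN2.
Qed.

Lemma escape g u p r0 eta : radial_eq N g u p -> 0 <= r0 -> 0 < eta ->
  (forall r, r0 < r -> p r <= - eta) -> exists2 r, 0 <= r & u r < 0.
Proof.
move=> [cu _ _ du _] r00 eta0 H.
pose r := r0 + (`|u r0| + 1) / eta.
have rr0 : r0 <= r by rewrite lerDl divr_ge0 ?addr_ge0 // ltW.
have : u r + eta * r <= u r0 + eta * r0.
  apply: (derivative_le0_ge (f := fun t => u t + eta * t)
    (df := fun t => p t + eta) rr0).
  - by move=> t /andP[t0 _]; have c1 := cu t ltac:(lra); cont.
  - by move=> t /andP[t0 _]; have d1 := du t ltac:(lra); deriv; rewrite /=; ring.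
  - by move=> t /andP[t0 _]; have := H t t0; lra.
have -> : eta * r = eta * r0 + (`|u r0| + 1) by rewrite /r; field; rewrite gt_eqF.
by move=> h; exists r; [lra|have := ler_norm (u r0); lra].
Qed.

End FluxBounds.

(** * The initial value problem *)

Section InitialValueProblem.
Context {R : realType}.
Implicit Types (f g u v p q : R -> R) (r t a b : R).

Lemma le0_of_geometric (x c : R) : (forall k, x <= c / 2 ^+ k) -> x <= 0.
Proof.
move=> H; rewrite leNgt; apply/negP => x0.
have c0 : 0 <= c by have := H 0%N; rewrite expr0 divr1; apply: le_trans; exact: ltW.
have := archi_boundP (divr_ge0 c0 (ltW x0)); set k := Num.bound _.
rewrite ltr_pdivrMr // => kc.
have := H k; rewrite ler_pdivlMr ?exprn_gt0 // => xc.
have : (k%:R : R) <= 2 ^+ k by rewrite -natrX ler_nat ltnW // ltn_expl.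
rewrite -(ler_pM2r x0) => kx; have := le_trans kx; rewrite mulrC => /(_ _ xc).
by rewrite leNgt kc.
Qed.

Lemma geometric_limit (x : nat -> R) (c : R) :
  (forall k, `|x k.+1 - x k| <= c / 2 ^+ k) ->
  exists l, forall k, `|l - x k| <= 2 * c / 2 ^+ k.
Proof.
move=> H.
pose e k : R := 2 * c / 2 ^+ k.
have eS k : e k = c / 2 ^+ k + e k.+1.
  by rewrite /e exprS; field; rewrite expf_neq0.
have e0 k : 0 <= e k.
  rewrite /e -mulrA mulr_ge0 //.
  exact: le_trans (normr_ge0 _) (H k).
have lo : nondecreasing_seq (fun k => x k - e k).
  apply/nondecreasing_seqP => k; have := H k; rewrite ler_norml => /andP[h _].
  by rewrite [e k]eS; lra.
have hi : nonincreasing_seq (fun k => x k + e k).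
  apply/nonincreasing_seqP => k; have := H k; rewrite ler_norml => /andP[_ h].
  by rewrite [e k]eS; lra.
have lohi j k : x j - e j <= x k + e k.
  have := lo _ _ (leq_maxl j k); have := hi _ _ (leq_maxr j k).
  by have := e0 (maxn j k); rewrite /=; lra.
pose S := range (fun k => x k - e k).
have ubS k : ubound S (x k + e k) by move=> _ [j _ <-].
have hS : has_sup S.
  by split; [exists (x 0%N - e 0%N); exists 0%N|exists (x 0%N + e 0%N); exact: ubS].
exists (sup S) => k; rewrite ler_distl -/(e k); apply/andP; split.
  by apply: sup_upper_bound => //; exists k.
by apply: ge_sup; [case: hS|exact: ubS].
Qed.

Variable N : nat.

Lemma radial_eq_exists g (alpha : R) : continuous g ->
  exists2 u, u 0 = alpha & exists p, radial_eq N g u p.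
Proof.
move=> cg.
have ctg : continuous (fun t => t ^+ N * g t).
  by move=> t; have cgt := (continuous_atP _ _).2 (cg t); apply/continuous_atP; cont.
have [Phi Phi0 dPhi] := primitive ctg.
have normN1 t : -1 < `|t| by have := normr_ge0 t; lra.
pose h t := Phi `|t| / `|t| ^+ N.
have [d d0 gd] : exists2 d, 0 < d & forall y, `|y - 0| < d -> `|g y| < `|g 0| + 1.
  apply: near_lt; last by rewrite ltrDl.
  apply: (continuous_at_comp (f := fun t => `|t|)) (continuous_at_norm _).
  exact: ((continuous_atP _ _).2 (cg 0)).
have hsmall t : `|t| < d -> `|h t| <= (`|g 0| + 1) * `|t|.
  have [->|t0] := eqVneq t 0.
    by move=> _; rewrite /h normr0 Phi0 mul0r normr0 mulr0.
  have s0 : 0 < `|t| by rewrite normr_gt0.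
  rewrite /h; move: `|t| s0 => s s0 sd.
  have cP x : 0 <= x <= s -> continuous_at Phi x.
    by move=> /andP[x0 _]; apply: derivative_continuous (dPhi _ _); lra.
  have dP x : 0 < x < s -> is_derive x 1 Phi (x ^+ N * g x).
    by move=> /andP[x0 _]; apply: dPhi; lra.
  have [c /andP[c0 cs] E] := mean_value s0 cP dP.
  move: E; rewrite Phi0 !subr0 => ->.
  rewrite normrM normfV !normrM (gtr0_norm s0) (gtr0_norm (exprn_gt0 N c0)).
  rewrite (gtr0_norm (exprn_gt0 N s0)) ler_pdivrMr ?exprn_gt0 //.
  have gc : `|g c| <= `|g 0| + 1.
    by apply/ltW/gd; rewrite subr0 gtr0_norm //; lra.
  rewrite (mulrAC (_ + 1)) [(_ + 1) * _]mulrC.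
  rewrite ler_wpM2r ?(ltW s0) //; apply: ler_pM => //.
    by rewrite exprn_ge0 // ltW.
  by rewrite lerXn2r ?nnegrE // ltW.
have ch t : continuous_at h t.
  have [->|t0] := eqVneq t 0.
    apply/continuous_atP/cvgrPdist_lt => e e0.
    have h0 : h 0 = 0 by rewrite /h normr0 Phi0 mul0r.
    rewrite h0; apply/nbhs_ballP.
    have B0 : 0 < `|g 0| + 1 by have := normr_ge0 (g 0); lra.
    exists (Num.min d (e / (`|g 0| + 1))); first by rewrite /= lt_min d0 divr_gt0.
    move=> x; rewrite /ball /= sub0r normrN lt_min => /andP[xd xe].
    rewrite sub0r normrN; apply: le_lt_trans (hsmall _ xd) _.
    by move: xe; rewrite ltr_pdivlMr // mulrC.
  apply: continuous_atM.
    apply: continuous_at_comp; first exact: continuous_at_norm.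
    exact: derivative_continuous (dPhi _ (normN1 t)).
  apply: continuous_atV; first by rewrite expf_neq0 // normr_eq0.
  by apply: continuous_atX; exact: continuous_at_norm.
have dh r : 0 < r -> is_derive r 1 h (g r - N%:R * h r / r).
  move=> r0; have rN : r ^+ N != 0 by rewrite expf_neq0 // gt_eqF.
  have dP := dPhi r ltac:(lra).
  have dq := derivative_div (g := fun t => t ^+ N) rN dP (derivativeX N (derivative_id r)).
  apply: (derivative_near (f := fun t => Phi t / t ^+ N)).
    near=> t; rewrite /h gtr0_norm //; near: t.
    exact: lt_nbhsr.
  apply: (derivative_eq dq); rewrite /h gtr0_norm //.
  have rn0 : r != 0 by rewrite gt_eqF.
  move: rN; case: (N) => [|n]; first by rewrite !expr0 /= => _; field.
  by rewrite /= exprS => _; field; rewrite ?expf_neq0 ?rn0.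
have [H H0 dH] := primitive (fun t => (continuous_atP _ _).1 (ch t)).
exists (fun t => alpha - H t); first by rewrite H0 subr0.
exists (fun t => - h t); split.
- move=> r r0; apply: continuous_atD; first exact: continuous_at_cst.
  by apply: continuous_atN; apply: derivative_continuous (dH _ _); lra.
- by move=> r r0; apply: continuous_atN.
- by rewrite /h normr0 Phi0 mul0r oppr0.
- move=> r r0; have dHr := dH r ltac:(lra).
  by deriv; rewrite sub0r.
- move=> r r0; have dhr := dh r r0.
  by deriv; rewrite mulrN mulNr; ring.
Unshelve. all: by end_near. Qed.

(** Two integrations against the weight each gain a factor [1 / lam]; the
    friction term only helps. *)
Lemma radial_eq_estimate g1 u1 p1 g2 u2 p2 (lam e : R) :
  radial_eq N g1 u1 p1 -> radial_eq N g2 u2 p2 -> u1 0 = u2 0 -> 0 < lam ->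
  (forall r, 0 <= r -> `|g1 r - g2 r| <= e * expR (lam * r)) ->
  forall r, 0 <= r -> `|u1 r - u2 r| <= e / lam ^+ 2 * expR (lam * r).
Proof.
have half g1' u1' p1' g2' u2' p2' : radial_eq N g1' u1' p1' ->
    radial_eq N g2' u2' p2' -> u1' 0 = u2' 0 -> 0 < lam ->
    (forall r, 0 <= r -> `|g1' r - g2' r| <= e * expR (lam * r)) ->
    forall r, 0 <= r -> u1' r - u2' r <= e / lam ^+ 2 * expR (lam * r).
  move=> {g1 u1 p1 g2 u2 p2} + + u0 lam0 Hg.
  move: g1' u1' p1' g2' u2' p2' u0 Hg => g1 u1 p1 g2 u2 p2 u0 Hg s1 s2.
  have e0 : 0 <= e.
    by have := Hg _ (lexx 0); rewrite mulr0 expR0 mulr1; exact: le_trans.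
  have [cu1 cp1 p10 du1 dp1] := s1; have [cu2 cp2 p20 du2 dp2] := s2.
  have lamN : lam != 0 by rewrite gt_eqF.
  have slope r : 0 < r -> p1 r - p2 r <= e / lam * expR (lam * r).
    move=> r0; rewrite -subr_ge0 -(pmulr_rge0 _ (exprn_gt0 N r0)).
    pose W t := t ^+ N * (e / lam * expR (lam * t))
      - (t ^+ N * p1 t - t ^+ N * p2 t).
    have : W 0 <= W r.
      apply: (derivative_ge0_le (df := fun t =>
        N%:R * t ^+ N.-1 * (e / lam * expR (lam * t))
        + t ^+ N * (e * expR (lam * t) + (g1 t - g2 t)))) (ltW r0) _ _ _.
      - move=> x /andP[x0 _].
        have c1 := flux_continuous s1 x0; have c2 := flux_continuous s2 x0.
        by rewrite /W; cont.
      - move=> x /andP[x0 _].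
        have d1 := flux_derivative s1 x0; have d2 := flux_derivative s2 x0.
        by rewrite /W; deriv; rewrite /=; field.
      - move=> x /andP[x0 _]; have x0' := ltW x0.
        rewrite addr_ge0 //.
          rewrite mulr_ge0 //; first by rewrite mulr_ge0 // exprn_ge0.
          by rewrite mulr_ge0 ?expR_ge0 // divr_ge0 // ltW.
        rewrite mulr_ge0 ?exprn_ge0 //.
        by have := Hg _ x0'; rewrite ler_norml => /andP[h _]; lra.
    rewrite /W p10 p20 !mulr0 subrr subr0 expR0 mulr1 => WW.
    have -> : r ^+ N * (e / lam * expR (lam * r) - (p1 r - p2 r)) = W r.
      by rewrite /W; ring.
    rewrite /W; apply: le_trans WW.
    by rewrite mulr_ge0 ?exprn_ge0 // divr_ge0 // ltW.
  move=> r r0; rewrite -subr_ge0.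
  pose W t := e / lam ^+ 2 * expR (lam * t) - (u1 t - u2 t).
  have : W 0 <= W r.
    apply: (derivative_ge0_le (df := fun t =>
      e / lam * expR (lam * t) - (p1 t - p2 t))) r0 _ _ _.
    - move=> x /andP[x0 _]; have c1 := cu1 x x0; have c2 := cu2 x x0.
      by rewrite /W; cont.
    - move=> x /andP[x0 _]; have d1 := du1 x x0; have d2 := du2 x x0.
      by rewrite /W; deriv; rewrite /=; field.
    - by move=> x /andP[x0 _]; rewrite subr_ge0; exact: slope.
  apply: le_trans; rewrite /W u0 mulr0 expR0 subrr subr0 mulr1.
  by rewrite divr_ge0 // exprn_ge0 // ltW.
move=> s1 s2 u0 lam0 Hg r r0; rewrite ler_norml; apply/andP; split; last first.
  exact: half s1 s2 u0 lam0 Hg r r0.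
rewrite lerNl opprB; apply: half s2 s1 (esym u0) lam0 _ r r0.
by move=> t t0; rewrite distrC; exact: Hg.
Qed.

(** Picard iteration: in the norm weighted by [expR (- lam * r)] with
    [lam = 2 L + 1] the solution operator of the linear problem contracts by
    a factor [1 / 2] on the whole half-line, so that the iterates converge
    globally. *)
Lemma radial_sol_exists f (L B alpha : R) : 0 <= L ->
  (forall x y, `|f x - f y| <= L * `|x - y|) -> (forall x, `|f x| <= B) ->
  exists2 u, u 0 = alpha & exists p, radial_sol N f u p.
Proof.
move=> L0 lip bnd.
have B0 : 0 <= B by exact: le_trans (normr_ge0 _) (bnd 0).
pose lam := 2 * L + 1.
have lam0 : 0 < lam by rewrite /lam; lra.
have lam2 : 0 < lam ^+ 2 by rewrite exprn_gt0.
have contract : 2 * L <= lam ^+ 2 by rewrite /lam; nra.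
have contract_le (y z : R) : 0 <= y -> y <= z -> L * y <= lam ^+ 2 / 2 * z.
  move=> y0 yz; apply: (@le_trans _ _ (lam ^+ 2 / 2 * y)).
    by apply: ler_wpM2r => //; lra.
  by apply: ler_wpM2l => //; rewrite divr_ge0 // ltW.
have cf x : continuous_at f x.
  apply/continuous_atP/cvgrPdist_lt => e e0; apply/nbhs_ballP.
  exists (e / (L + 1)); first by rewrite /= divr_gt0 //; lra.
  move=> y; rewrite /ball /= ltr_pdivlMr; last lra.
  by move=> ye; apply: le_lt_trans (lip _ _) _; have := normr_ge0 (x - y); nra.
pose S0 u v := (forall r, 0 <= r -> continuous_at u r) ->
  v 0 = alpha /\ exists p, radial_eq N (fun r => f (u `|r|)) v p.
have /choice[S HS] u : exists v, S0 u v.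
  have [cu|ncu] := pselect (forall r, 0 <= r -> continuous_at u r); last first.
    by exists u => cu; case: ncu.
  have cg : continuous (fun r => f (u `|r|)).
    move=> r; apply/continuous_atP/continuous_at_comp => //.
    apply: continuous_at_comp; first exact: continuous_at_norm.
    exact: cu.
  by have [v v0 Hv] := radial_eq_exists alpha cg; exists v.
pose x k := iter k S (fun=> alpha).
have cx k : forall r, 0 <= r -> continuous_at (x k) r.
  elim: k => [|k IH]; first by move=> r _; exact: continuous_at_cst.
  by have [_ [p [+ _ _ _ _]]] := HS _ IH.
have xe k : exists p, radial_eq N (fun r => f (x k `|r|)) (x k.+1) p.
  by have [_] := HS _ (cx k).
have x0 k : x k 0 = alpha.
  by case: k => // k; have [] := HS _ (cx k).
pose c := B / lam ^+ 2.
have step k : forall r, 0 <= r ->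
    `|x k.+1 r - x k r| <= c / 2 ^+ k * expR (lam * r).
  elim: k => [|k IH] r r0.
    rewrite expr0 divr1 /c.
    have [p s1] := xe 0%N.
    have s0 : radial_eq N (fun=> 0) (x 0%N) (fun=> 0).
      split => //= t _; do ?exact: continuous_at_cst.
        exact: derivative_cst.
      by apply: (derivative_eq (derivative_cst _ _)); rewrite mulr0 mul0r subr0 oppr0.
    apply: (radial_eq_estimate s1 s0) => // t t0.
    rewrite subr0; apply: le_trans (bnd _) _.
    by rewrite ler_peMr // -expR0 ler_expR mulr_ge0 // ltW.
  have [p s1] := xe k.+1; have [q s0] := xe k.
  have -> : c / 2 ^+ k.+1 = lam ^+ 2 / 2 * (c / 2 ^+ k) / lam ^+ 2.
    by rewrite exprS; field; rewrite expf_neq0 // gt_eqF.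
  apply: (radial_eq_estimate s1 s0) => //; first by rewrite !x0.
  move=> t t0; apply: le_trans (lip _ _) _.
  rewrite (ger0_norm t0) -mulrA; apply: contract_le; first exact: normr_ge0.
  exact: IH.
have /choice[w Hw] (t : R) : exists l, forall k,
    `|l - x k `|t| | <= 2 * (c * expR (lam * `|t|)) / 2 ^+ k.
  apply: (geometric_limit (x := fun k => x k `|t|)) => k.
  by rewrite mulrAC; exact: step.
have c0 : 0 <= c by rewrite divr_ge0 // ltW.
have cw t : continuous_at w t.
  apply/continuous_atP/cvgrPdist_lt => e e0.
  pose E := 2 * (c * expR (lam * (`|t| + 1))).
  have E0 : 0 <= E by rewrite /E mulr_ge0 // mulr_ge0 // expR_ge0.
  have [k Ek] : exists k, E / 2 ^+ k < e / 3.
    apply: contrapT => nk.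
    suff : e / 3 <= 0 by lra.
    apply: (le0_of_geometric (c := E)) => k; rewrite leNgt.
    by apply/negP => lt; apply: nk; exists k.
  have : \forall s \near t, `|x k `|t| - x k `|s| | < e / 3.
    have /continuous_atP : continuous_at (fun s => x k `|s|) t.
      by apply: continuous_at_comp; [exact: continuous_at_norm|exact: cx].
    by move/cvgrPdist_lt => /(_ (e / 3)); apply; lra.
  have close s : `|s| <= `|t| + 1 -> `|w s - x k `|s| | < e / 3.
    move=> st; apply: le_lt_trans (Hw s k) _; apply: le_lt_trans Ek.
    rewrite ler_pM2r ?invr_gt0 ?exprn_gt0 // /E ler_pM2l // ler_wpM2l //.
    by rewrite ler_expR ler_pM2l.
  have near1 : \forall s \near t, `|t - s| < 1.
    by apply/nbhs_ballP; exists 1 => //=.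
  apply: filterS2 near1 => s st xs.
  have h1 := close t ltac:(lra).
  have h2 := close s ltac:(have := ler_distD t s 0; rewrite !subr0 distrC; lra).
  rewrite distrC in h2.
  have := ler_distD (x k `|t|) (w t) (w s).
  have := ler_distD (x k `|s|) (x k `|t|) (w s).
  by lra.
have cfw : continuous (fun t => f (w t)).
  by move=> t; apply/continuous_atP/continuous_at_comp.
have [u u0 [p su]] := radial_eq_exists alpha cfw.
exists u => //; exists p.
have uw r : 0 <= r -> u r = w r.
  move=> r0; apply/eqP; rewrite -subr_eq0 -normr_le0.
  apply/(le0_of_geometric (c := 4 * (c * expR (lam * r)))) => k.
  have [q sk] := xe k.
  have h1 : `|u r - x k.+1 r| <=
      lam ^+ 2 / 2 * (2 * c / 2 ^+ k) / lam ^+ 2 * expR (lam * r).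
    apply: (radial_eq_estimate su sk) => //; first by rewrite x0.
    move=> t t0; apply: le_trans (lip _ _) _; rewrite (ger0_norm t0).
    rewrite -mulrA; apply: contract_le; first exact: normr_ge0.
    by have := Hw t k; rewrite (ger0_norm t0) mulrA mulrAC.
  have h2 := Hw r k.+1; rewrite (ger0_norm r0) in h2.
  have E1 : lam ^+ 2 / 2 * (2 * c / 2 ^+ k) / lam ^+ 2 * expR (lam * r)
    = c * expR (lam * r) / 2 ^+ k.
    by field; rewrite expf_neq0 //= gt_eqF.
  have E2 : 2 * (c * expR (lam * r)) / 2 ^+ k.+1 = c * expR (lam * r) / 2 ^+ k.
    by rewrite exprS; field; rewrite expf_neq0.
  rewrite E1 in h1; rewrite E2 distrC in h2.
  have := ler_distD (x k.+1 r) (u r) (w r).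
  have : 0 <= c * expR (lam * r) / 2 ^+ k.
    by rewrite divr_ge0 ?exprn_ge0 // mulr_ge0 ?expR_ge0.
  by rewrite -[4 * _ / _]mulrA; lra.
have [cu cp p0 du dp] := su; split => // r r0.
by rewrite (uw _ (ltW r0)); exact: dp.
Qed.

End InitialValueProblem.

(** * The nonlinearity and the Pucci-Serrin functional *)

Section Nonlinearity.
Context {R : realType}.
Variables a th b : R.
Implicit Types (u v x y : R).

(** The root form of [a1 * u ^+ 2 + a2 * u ^+ 3 + a3 * u ^+ 4], with [a = a3],
    [a2 = a * (b - th)] and [a1 = - a * th * b].  It covers both signs of [a2]
    and exhibits [th] as the only positive zero. *)
Definition nonlin u := a * u ^+ 2 * (u - th) * (u + b).
Definition nonlin' u := a * u * (4 * u ^+ 2 + 3 * (b - th) * u - 2 * th * b).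
Definition potential u :=
  a * u ^+ 3 * (u ^+ 2 / 5 + (b - th) * u / 4 - th * b / 3).
Definition pratio u := potential u / nonlin u.

Lemma nonlin_derivative u : is_derive u 1 nonlin (nonlin' u).
Proof. by rewrite /nonlin /nonlin'; deriv; rewrite /=; ring. Qed.

Lemma potential_derivative u : is_derive u 1 potential (nonlin u).
Proof. by rewrite /potential /nonlin; deriv; rewrite /=; field. Qed.

Lemma nonlin_continuous u : continuous_at nonlin u.
Proof. exact: derivative_continuous (nonlin_derivative u). Qed.

Lemma potential_continuous u : continuous_at potential u.
Proof. exact: derivative_continuous (potential_derivative u). Qed.

Lemma pratio_derivative u : nonlin u != 0 ->
  is_derive u 1 pratio (1 - potential u * nonlin' u / nonlin u ^+ 2).
Proof.
move=> f0; apply: (derivative_eq (derivative_div f0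
  (potential_derivative u) (nonlin_derivative u))).
by field.
Qed.

Lemma nonlin0 : nonlin 0 = 0.
Proof. by rewrite /nonlin expr0n /= mulr0 !mul0r. Qed.

Lemma nonlin_th : nonlin th = 0.
Proof. by rewrite /nonlin subrr mulr0 mul0r. Qed.

Lemma potential0 : potential 0 = 0.
Proof. by rewrite /potential expr0n /= mulr0 !mul0r. Qed.

Hypotheses (a0 : 0 < a) (th0 : 0 < th) (b0 : 0 < b).

Local Ltac plra := pose proof a0; pose proof th0; pose proof b0; lra.
Local Ltac pnra := pose proof a0; pose proof th0; pose proof b0; nra.

Lemma nonlin_gt0 u : th < u -> 0 < nonlin u.
Proof.
move=> thu; have u0 := lt_trans th0 thu.
by rewrite /nonlin !mulr_gt0 ?exprn_gt0 ?subr_gt0 ?addr_gt0.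
Qed.

Lemma nonlin_lt0 u : 0 < u < th -> nonlin u < 0.
Proof.
move=> /andP[u0 uth]; rewrite /nonlin pmulr_llt0 ?addr_gt0 //.
by rewrite pmulr_rlt0 ?subr_lt0 // mulr_gt0 // exprn_gt0.
Qed.

Lemma nonlin_neq0 u : 0 < u -> u != th -> nonlin u != 0.
Proof.
move=> u0; rewrite neq_lt => /orP[uth|thu].
  by rewrite lt_eqF // nonlin_lt0 // u0.
by rewrite gt_eqF // nonlin_gt0.
Qed.

Lemma potential_lt0 u : 0 < u <= th -> potential u < 0.
Proof.
move=> /andP[u0 uth]; rewrite /potential pmulr_rlt0 ?mulr_gt0 ?exprn_gt0 //.
have : u * (u / 5 - th / 4) < 0 by rewrite pmulr_rlt0 //; plra.
have : b * (u / 4 - th / 3) < 0 by rewrite pmulr_rlt0 //; plra.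
by rewrite expr2; plra.
Qed.

Lemma th_lt_of_potential u : 0 < u -> 0 <= potential u -> th < u.
Proof.
move=> u0 F0; rewrite ltNge; apply/negP => uth.
by move: F0; rewrite leNgt potential_lt0 // u0.
Qed.

Lemma potential_ge0 u : 2 * th <= u -> 0 <= potential u.
Proof.
move=> thu; have u0 : 0 < u by plra.
rewrite /potential mulr_ge0 //; first by rewrite mulr_ge0 ?exprn_ge0 // ltW.
have : 0 <= u * (u / 5 - th / 4) by rewrite mulr_ge0 //; plra.
have : 0 <= b * (u / 4 - th / 3) by rewrite mulr_ge0 //; plra.
by rewrite expr2; plra.
Qed.

Lemma nonlin_mono x y : th <= x <= y -> nonlin x <= nonlin y.
Proof.
move=> /andP[thx xy]; rewrite /nonlin.
apply: ler_pM; [|plra| |plra].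
- by rewrite mulr_ge0 ?mulr_ge0 ?exprn_ge0 ?subr_ge0 //; plra.
- apply: ler_pM; [|plra| |plra].
    by rewrite mulr_ge0 ?exprn_ge0 //; plra.
  by rewrite ler_pM2l // lerXn2r ?nnegrE //; plra.
Qed.

Lemma nonlin_quartic_lower u : 2 * th <= u -> a / 2 * u ^+ 4 <= nonlin u.
Proof.
move=> thu; have u0 : 0 < u by plra.
have -> : a / 2 * u ^+ 4 = a * u ^+ 2 * (u / 2) * u by field.
rewrite /nonlin; apply: ler_pM; [|plra| |plra].
  by rewrite mulr_ge0 ?mulr_ge0 ?exprn_ge0 //; plra.
by rewrite ler_pM2l ?mulr_gt0 ?exprn_gt0 //; plra.
Qed.

Lemma nonlin_quartic_upper u : th <= u -> b <= u -> nonlin u <= 2 * a * u ^+ 4.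
Proof.
move=> thu bu; have u0 : 0 < u by plra.
have -> : 2 * a * u ^+ 4 = a * u ^+ 2 * u * (2 * u) by field.
rewrite /nonlin; apply: ler_pM; [|plra| |plra].
  by rewrite mulr_ge0 ?mulr_ge0 ?exprn_ge0 //; plra.
by rewrite ler_pM2l ?mulr_gt0 ?exprn_gt0 //; plra.
Qed.

Lemma nonlin_lower u : 0 <= u -> - (a * th ^+ 3 * (th + b)) <= nonlin u.
Proof.
move=> u0; have [uth|thu] := leP u th; last first.
  apply: (@le_trans _ _ 0); last by rewrite ltW // nonlin_gt0.
  by rewrite oppr_le0 !mulr_ge0 ?exprn_ge0 //; plra.
have -> : nonlin u = - (a * u ^+ 2 * (th - u) * (u + b)) by rewrite /nonlin; ring.
rewrite lerN2; apply: ler_pM; [|plra| |plra].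
  by rewrite mulr_ge0 ?mulr_ge0 ?exprn_ge0 //; plra.
rewrite [th ^+ 3]exprSr mulrA; apply: ler_pM; [|plra| |plra].
  by rewrite mulr_ge0 ?exprn_ge0 //; plra.
by rewrite ler_pM2l // lerXn2r ?nnegrE //; plra.
Qed.

Lemma nonlin_quadratic u : 0 < u <= th / 2 ->
  a * th * b / 2 * u ^+ 2 <= - nonlin u.
Proof.
move=> /andP[u0 uth].
have -> : a * th * b / 2 * u ^+ 2 = a * u ^+ 2 * (th / 2) * b by field.
have -> : - nonlin u = a * u ^+ 2 * (th - u) * (u + b) by rewrite /nonlin; ring.
apply: ler_pM; [|plra| |plra].
  by rewrite mulr_ge0 ?mulr_ge0 ?exprn_ge0 //; plra.
by rewrite ler_pM2l ?mulr_gt0 ?exprn_gt0 //; plra.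
Qed.

Lemma potential_cubic u : 0 < u <= th / 2 ->
  `|potential u| <= a * th * (th + b) * u ^+ 3.
Proof.
move=> /andP[u0 uth].
have -> : a * th * (th + b) * u ^+ 3 = a * u ^+ 3 * (th * (th + b)) by ring.
have u3 : 0 < a * u ^+ 3 by rewrite mulr_gt0 ?exprn_gt0.
rewrite /potential normrM (gtr0_norm u3) ler_pM2l // ler_norml.
have h1 : 0 <= u ^+ 2 <= th ^+ 2.
  by rewrite exprn_ge0 ?lerXn2r ?nnegrE; plra.
have h2 : 0 <= th * u <= th ^+ 2.
  by rewrite expr2 mulr_ge0 ?ler_pM2l //; plra.
have h3 : 0 <= b * u <= th * b.
  by rewrite mulr_ge0 1?mulrC ?ler_pM2r //; plra.
have h4 : 0 <= th * b by rewrite mulr_ge0 //; plra.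
by rewrite mulrDr -expr2 mulrBl; apply/andP; split; plra.
Qed.

Lemma pratio_linear : exists2 c, 0 < c &
  forall u, 0 < u <= th / 2 -> `|pratio u| <= c * u.
Proof.
exists (a * th * (th + b) / (a * th * b / 2)).
  by rewrite divr_gt0 ?mulr_gt0 ?addr_gt0 ?divr_gt0.
move=> u uth; have /andP[u0 uth2] := uth.
have f0 := nonlin_quadratic uth; have F0 := potential_cubic uth.
have c0 : 0 < a * th * b / 2 by rewrite divr_gt0 ?mulr_gt0.
have fu : nonlin u < 0.
  by rewrite nonlin_lt0 // u0 /=; plra.
rewrite /pratio normrM normfV (ltr0_norm fu) ler_pdivrMr ?oppr_gt0 //.
apply: le_trans F0 _.
set A := a * th * (th + b); set B := a * th * b / 2.
have A0 : 0 < A by rewrite /A !mulr_gt0 ?addr_gt0.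
have -> : A * u ^+ 3 = A / B * u * (B * u ^+ 2).
  by field; rewrite /B gt_eqF.
by rewrite ler_pM2l // mulr_gt0 // divr_gt0.
Qed.

Lemma nonlin_lipschitz M : 0 <= M -> exists2 L, 0 <= L &
  forall x y, 0 <= x <= M -> 0 <= y <= M ->
  `|nonlin x - nonlin y| <= L * `|x - y|.
Proof.
move=> M0; exists (a * M * (4 * M ^+ 2 + 3 * (b + th) * M + 2 * th * b)).
  by rewrite !mulr_ge0 ?addr_ge0 ?mulr_ge0 ?exprn_ge0 ?addr_ge0 // ltW.
have bound t : 0 <= t <= M -> `|nonlin' t| <=
    a * M * (4 * M ^+ 2 + 3 * (b + th) * M + 2 * th * b).
  move=> /andP[t0 tM]; rewrite /nonlin' !normrM (gtr0_norm a0) (ger0_norm t0).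
  apply: ler_pM => //; first by rewrite mulr_ge0 // ltW.
    by rewrite ler_pM2l.
  have t2 : 0 <= t ^+ 2 <= M ^+ 2 by rewrite exprn_ge0 // lerXn2r ?nnegrE.
  have h1 : 0 <= b * t <= b * M by rewrite mulr_ge0 ?ler_pM2l // ltW.
  have h2 : 0 <= th * t <= th * M by rewrite mulr_ge0 ?ler_pM2l // ltW.
  have h3 : 0 <= th * b by rewrite mulr_ge0 // ltW.
  by rewrite ler_norml; apply/andP; split; pnra.
have half x y : x < y -> 0 <= x <= M -> 0 <= y <= M ->
    `|nonlin y - nonlin x| <=
    a * M * (4 * M ^+ 2 + 3 * (b + th) * M + 2 * th * b) * `|y - x|.
  move=> xy /andP[x0 _] /andP[_ yM].
  have [c /andP[xc cy] ->] := mean_value xy (fun t _ => nonlin_continuous t)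
    (fun t _ => nonlin_derivative t).
  by rewrite normrM ler_wpM2r // bound //; apply/andP; split; plra.
move=> x y xM yM; case: (ltgtP x y) => [xy|yx|->].
- by rewrite distrC [`|x - y|]distrC half.
- by rewrite half.
- by rewrite !subrr normr0 mulr0.
Qed.

(** The density, with respect to [r ^+ N * p r ^+ 2], of the derivative of the
    functional [pfun] below; the dimension is [N.+1]. *)
Definition pweight (N : nat) u := N.+1%:R * (1 - potential u * nonlin' u / nonlin u ^+ 2)
  - (N.+1%:R - 2) / 2.

(** This is the Pucci-Serrin uniqueness condition, in a uniform version.
    After multiplication by [nonlin u ^+ 2 / (a ^+ 2 * u ^+ 4)] the claim
    concerns a quadratic form in [X = th * b], [y = (b - th) * u] and
    [z = u ^+ 2].  It is positive for [X, z > 0], although for [N = 2] it is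
    indefinite. *)
Lemma pweight_lower N u : (N = 1%N) \/ (N = 2%N) -> 0 < u -> u != th ->
  1 / 40 <= pweight N u.
Proof.
move=> hN u0 uth; have f0 := nonlin_neq0 u0 uth.
have f2 : 0 < nonlin u ^+ 2 by rewrite exprn_even_gt0.
pose X := th * b; pose y := (b - th) * u; pose z := u ^+ 2.
pose A := z / 5 + y / 4 - X / 3; pose B := z + y - X.
pose C := 4 * z + 3 * y - 2 * X.
have fE : nonlin u = a * z * B by rewrite /nonlin /B /z /y /X; ring.
have FE : potential u = a * u * z * A.
  by rewrite /potential /A /z /y /X; field.
have f'E : nonlin' u = a * u * C by rewrite /nonlin' /C /z /y /X; ring.
have X0 : 0 < X by rewrite /X mulr_gt0.
have z0 : 0 < z by rewrite /z exprn_gt0.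
have B0 : B != 0.
  by apply: contraNneq f0 => B0; rewrite fE B0 mulr0.
have B2 : 0 < B ^+ 2 by rewrite exprn_even_gt0.
have wE : pweight N u =
    N.+1%:R * (1 - A * C / B ^+ 2) - (N.+1%:R - 2) / 2.
  rewrite /pweight; congr (_ * (1 - _) - _).
  rewrite fE FE f'E.
  have -> : a * u * z * A * (a * u * C) = a ^+ 2 * z * (u ^+ 2) * (A * C) by ring.
  rewrite -/z.
  by field; rewrite B0 !gt_eqF.
have form : 0 <= 3 * (B ^+ 2 - A * C) - B ^+ 2 / 2 - B ^+ 2 / 40.
  rewrite /A /B /C; have [y0|y0] := leP 0 y.
    have := mulr_ge0 (ltW X0) (ltW z0); have := mulr_ge0 y0 (ltW z0).
    have := sqr_ge0 (y - X); have := sqr_ge0 X; have := sqr_ge0 z.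
    by pnra.
  have y0' : 0 <= - y by plra.
  have := mulr_ge0 (ltW X0) (ltW z0); have := mulr_ge0 y0' (ltW X0).
  have := sqr_ge0 (y + z / 3); have := sqr_ge0 X; have := sqr_ge0 z.
  by pnra.
rewrite wE -subr_ge0 -(pmulr_lge0 _ B2).
case: hN => ->.
- have -> : (2%:R * (1 - A * C / B ^+ 2) - (2%:R - 2) / 2 - 1 / 40) * B ^+ 2 =
    2 / 3 * (3 * (B ^+ 2 - A * C) - B ^+ 2 / 2 - B ^+ 2 / 40)
    + 13 / 40 * B ^+ 2 by field.
  by rewrite addr_ge0 // mulr_ge0 //; plra.
- have -> : (3%:R * (1 - A * C / B ^+ 2) - (3%:R - 2) / 2 - 1 / 40) * B ^+ 2 =
    3 * (B ^+ 2 - A * C) - B ^+ 2 / 2 - B ^+ 2 / 40 by field.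
  exact: form.
Qed.

Section Functional.
Variable N : nat.
Implicit Types (g p : R -> R) (r : R).

(** A Pohozaev functional in which the flux is multiplied by a function of the
    solution.  The choice [F / f] cancels every term of the derivative that
    does not contain [p r ^+ 2]. *)
Definition pfun (u p : R -> R) r :=
  r ^+ N.+1 * (p r ^+ 2 / 2 + potential (u r))
  + N.+1%:R * r ^+ N * p r * pratio (u r).

Lemma pfun_derivative g (u : R -> R) p r : radial_eq N g u p -> 0 < r ->
  g r = nonlin (u r) -> nonlin (u r) != 0 ->
  is_derive r 1 (pfun u p) (r ^+ N * p r ^+ 2 * pweight N (u r)).
Proof.
move=> [_ _ _ du dp] r0 gE f0.
have dur := du _ r0; have dpr := dp _ r0.
have dF := derivative_comp dur (potential_derivative (u r)).
have dG := derivative_comp dur (pratio_derivative f0).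
have rn0 : r != 0 by rewrite gt_eqF.
rewrite /pfun; deriv; rewrite /= gE /pweight /pratio.
case: (N) => [|n]; rewrite /= ?exprS ?expr0 -[_.+2%:R]natr1.
  by field; rewrite f0 rn0.
by rewrite -[n.+1%:R]natr1; field; rewrite f0 rn0.
Qed.

Lemma pfun_continuous g (u : R -> R) p r : radial_eq N g u p -> 0 <= r ->
  nonlin (u r) != 0 -> continuous_at (pfun u p) r.
Proof.
move=> [cu cp _ _ _] r0 f0.
have cur := cu _ r0; have cpr := cp _ r0.
have cF := continuous_at_comp cur (potential_continuous (u r)).
have cG := continuous_at_comp cur
  (derivative_continuous (pratio_derivative f0)).
by rewrite /pfun; cont.
Qed.

End Functional.

End Nonlinearity.

(** * Ground states and their decay *)

Section GroundStates.
Context {R : realType}.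
Variable N : nat.
Implicit Types (f F g u p : R -> R) (r t x y e : R).

Definition vanishing u := forall e, 0 < e ->
  exists2 rho, 0 < rho & forall r, rho <= r -> `|u r| < e.

(** At a zero of the slope the energy is [F (u r)], so that [f (u r) > 0] and
    the slope is decreasing there.  Since the slope is negative for small [r],
    it cannot reach a first zero. *)
Lemma slope_lt0 f F u p : radial_sol N f u p ->
  (forall r, 0 <= r -> 0 < u r) ->
  (forall r, 0 <= r -> 0 <= p r ^+ 2 / 2 + F (u r)) ->
  continuous_at f (u 0) -> (forall v, 0 < v -> 0 <= F v -> 0 < f v) ->
  forall r, 0 < r -> p r < 0.
Proof.
move=> s u0 E0 cf Ff r1 r10; have [cu cp p0 du dp] := s.
have f0 : 0 < f (u 0).
  apply: Ff; first exact: u0.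
  by have := E0 _ (lexx 0); rewrite p0 expr0n /= mul0r add0r.
have [d d0 Hd] := near_gt (continuous_at_comp (cu _ (lexx 0)) cf) f0.
rewrite ltNge; apply/negP => pr1.
pose x := Num.min (d / 2) (r1 / 2).
have x0 : 0 < x by rewrite lt_min !divr_gt0.
have xr1 : x < r1 by rewrite gt_min; apply/orP; right; lra.
have xd : x < d by rewrite gt_min; apply/orP; left; lra.
have px : p x < 0.
  rewrite -(pmulr_rlt0 _ (exprn_gt0 N x0)).
  have : x ^+ N * p x < 0 ^+ N * p 0.
    apply: (@derivative_lt0_gt _ (fun t => t ^+ N * p t)
      (fun t => - (t ^+ N * f (u t))) _ _ x0).
    - by move=> t /andP[t0 _]; exact: flux_continuous s t0.
    - by move=> t /andP[t0 _]; exact: flux_derivative s t0.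
    - move=> t /andP[t0 tx]; rewrite oppr_lt0 mulr_gt0 ?exprn_gt0 // Hd //.
      by rewrite subr0 gtr0_norm //; lra.
  by rewrite p0 mulr0.
have [c [/andP[xc _] pc neg]] : exists c, [/\ x < c <= r1, p c = 0 &
    forall t, x <= t < c -> p t < 0].
  apply: first_zero => //; first exact: ltW.
  by move=> t /andP[xt _]; apply: cp; lra.
have c0 : 0 < c by lra.
have := derivative_first_zero xc pc neg (dp _ c0).
rewrite pc mulr0 mul0r oppr0 sub0r oppr_ge0 leNgt Ff //.
  by apply: u0; exact: ltW.
by have := E0 _ (ltW c0); rewrite pc expr0n /= mul0r add0r.
Qed.

Variables a th b : R.
Hypotheses (a0 : 0 < a) (th0 : 0 < th) (b0 : 0 < b).
Local Ltac plra := pose proof a0; pose proof th0; pose proof b0; lra.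

Local Notation f := (nonlin a th b).
Local Notation F := (potential a th b).
Local Notation P := (pfun a th b N).

Definition ground_state u p :=
  [/\ radial_sol N f u p, forall r, 0 <= r -> 0 < u r & vanishing u].

Section Decay.
Variables u p : R -> R.
Hypothesis gs : ground_state u p.

(** The energy decreases, and its potential part tends to [F 0 = 0]. *)
Lemma ground_energy_ge0 r : 0 <= r -> 0 <= p r ^+ 2 / 2 + F (u r).
Proof.
move=> r0; have [s up uv] := gs.
have [//|E0] := leP 0 (p r ^+ 2 / 2 + F (u r)).
have cF : continuous_at F 0 by exact: potential_continuous.
have [d d0 Hd] := near_gt cF (c := p r ^+ 2 / 2 + F (u r))
  ltac:(by rewrite potential0).
have [rho rho0 Hrho] := uv _ d0.
pose t := Num.max r rho.
have Ht : `|u t - 0| < d by rewrite subr0 Hrho // le_max lexx orbT.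
have rt : 0 <= r <= t by rewrite r0 le_max lexx.
have := energy_le (F := F) s rt (fun x _ => potential_derivative a th b (u x)).
have := Hd _ Ht; have := sqr_ge0 (p t); lra.
Qed.

Lemma ground_slope_lt0 r : 0 < r -> p r < 0.
Proof.
have [s up uv] := gs.
apply: (slope_lt0 (F := F) s up ground_energy_ge0).
  exact: nonlin_continuous.
by move=> v v0 /(th_lt_of_potential a0 th0 b0 v0); exact: nonlin_gt0.
Qed.

Lemma ground_decreasing x y : 0 <= x < y -> u y < u x.
Proof.
move=> /andP[x0 xy]; have [[cu _ _ du _] _ _] := gs.
apply: (@derivative_lt0_gt _ u p _ _ xy) => t /andP[xt _].
- by apply: cu; lra.
- by apply: du; lra.
- by apply: ground_slope_lt0; lra.
Qed.

Lemma ground_nonincreasing x y : 0 <= x <= y -> u y <= u x.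
Proof.
move=> /andP[x0]; rewrite le_eqVlt => /orP[/eqP->//|xy].
by rewrite ltW // ground_decreasing // x0.
Qed.

(** Below [th] the flux [- r ^+ N * p r] is decreasing and positive, hence
    convergent; its increment over [[r / 2, r]] therefore tends to [0], while
    it dominates [r ^+ N.+1 * u r ^+ 2]. *)
Lemma ground_decay e : 0 < e ->
  exists2 rho, 0 < rho & forall r, rho <= r -> r ^+ N.+1 * u r ^+ 2 <= e.
Proof.
move=> e0; have [s up uv] := gs; have [cu cp p0 du dp] := s.
have th2 : 0 < th / 2 by rewrite divr_gt0.
have [r0 r00 Hr0] := uv _ th2.
have small r : r0 <= r -> 0 < u r <= th / 2.
  move=> r0r; have := Hr0 _ r0r; have := up r ltac:(lra) => ur.
  by rewrite gtr0_norm // ur; exact: ltW.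
pose Y r := - (r ^+ N * p r).
have Y0 r : 0 < r -> 0 <= Y r.
  by move=> rp; rewrite /Y oppr_ge0 pmulr_rle0 ?exprn_gt0 // ltW // ground_slope_lt0.
have cY r : 0 <= r -> continuous_at Y r.
  by move=> rp; apply: continuous_atN; exact: flux_continuous s rp.
have dY r : 0 < r -> is_derive r 1 Y (r ^+ N * f (u r)).
  by move=> rp; apply: (derivative_eq (derivativeN (flux_derivative s rp))); rewrite opprK.
pose c := a * th * b / 2.
have c0 : 0 < c by rewrite /c divr_gt0 ?mulr_gt0.
have Ydec x y : r0 <= x <= y -> Y y <= Y x.
  move=> /andP[r0x xy].
  apply: (derivative_le0_ge (df := fun r => r ^+ N * f (u r)) xy) => t /andP[xt _].
  - by apply: cY; lra.
  - by apply: dY; lra.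
  - rewrite pmulr_rle0 ?exprn_gt0 //; last lra.
    have [ut0 ut] := andP (small t ltac:(lra)).
    by rewrite ltW // nonlin_lt0 // ut0; plra.
pose S := [set Y r | r in [set r | r0 <= r]].
have hS : has_inf S.
  split; first by exists (Y r0); exists r0 => /=.
  by exists 0 => _ [r /= r0r <-]; apply: Y0; lra.
pose e' := c * e / 2 ^+ N.+1.
have e'0 : 0 < e' by rewrite divr_gt0 ?mulr_gt0 ?exprn_gt0.
have [_ [r1 /= r01 <-] Yr1] := inf_adherent e'0 hS.
exists (2 * r1); first by lra.
move=> r r1r; have rp : 0 < r by lra.
have inc : Y (r / 2) - Y r <= e'.
  have : inf S <= Y r.
    by apply: inf_lbound; [case: hS|exists r => //=; lra].
  have := Ydec r1 (r / 2) ltac:(apply/andP; split; lra); lra.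
pose W t := Y t + (r / 2) ^+ N * (c * u r ^+ 2) * t.
have : W r <= W (r / 2).
  apply: (derivative_le0_ge (df := fun t =>
    t ^+ N * f (u t) + (r / 2) ^+ N * (c * u r ^+ 2))); first by lra.
  - move=> t /andP[rt _]; have := cY t ltac:(lra) => c1.
    by rewrite /W; cont.
  - move=> t /andP[rt _]; have := dY t ltac:(lra) => d1.
    by rewrite /W; deriv; rewrite /=; ring.
  - move=> t /andP[rt tr].
    have st := small t ltac:(lra).
    have fq := nonlin_quadratic a0 th0 b0 st.
    have uru : u r ^+ 2 <= u t ^+ 2.
      rewrite lerXn2r ?nnegrE ?ltW ?up //; [lra|lra|].
      by apply: ground_decreasing; apply/andP; split; lra.
    have rtN : (r / 2) ^+ N <= t ^+ N.
      by rewrite lerXn2r ?nnegrE //; lra.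
    have cu0 : 0 <= c * u r ^+ 2 by rewrite mulr_ge0 ?sqr_ge0 // ltW.
    have tN : 0 <= t ^+ N by rewrite exprn_ge0 //; lra.
    have h1 := ler_wpM2r cu0 rtN.
    have h2 : t ^+ N * (c * u r ^+ 2) <= t ^+ N * - f (u t).
      rewrite ler_wpM2l //; apply: le_trans fq.
      by rewrite -/c ler_wpM2l // ltW.
    by move: h1 h2; rewrite mulrN; lra.
rewrite /W => WW.
have h : (r / 2) ^+ N.+1 * (c * u r ^+ 2) <= e'.
  have -> : (r / 2) ^+ N.+1 * (c * u r ^+ 2) =
      (r / 2) ^+ N * (c * u r ^+ 2) * (r / 2) by rewrite exprS; ring.
  move: WW inc; move: (_ * (c * _)) => z; lra.
move: h; rewrite /e' expr_div_n ler_pdivlMr ?exprn_gt0 // => h.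
rewrite -(ler_pM2l c0); apply: le_trans h; rewrite le_eqVlt; apply/orP; left.
by apply/eqP; field; rewrite expf_neq0.
Qed.

(** Below [th] the flux decreases in modulus, so that the slope at [r] is the
    smallest one on [[r / 2, r]] in modulus. *)
Lemma ground_slope_bound r1 r : 0 < r1 -> u r1 <= th -> 2 * r1 <= r ->
  r * `|p r| <= 2 * u (r / 2).
Proof.
move=> r10 ur1 r1r; have [s up _] := gs; have [cu cp p0 du dp] := s.
have rp : 0 < r by lra.
rewrite ltr0_norm ?ground_slope_lt0 //.
have ut t : r1 < t -> 0 < u t < th.
  move=> r1t; rewrite up /=; last by lra.
  apply: lt_le_trans ur1; apply: ground_decreasing; apply/andP; split; lra.
pose W t := u t - p r * t.
have : W r <= W (r / 2).
  apply: (derivative_le0_ge (df := fun t => p t - p r)); first by lra.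
  - move=> t /andP[rt _]; have := cu t ltac:(lra) => c1.
    by rewrite /W; cont.
  - move=> t /andP[rt _]; have := du t ltac:(lra) => d1.
    by rewrite /W; deriv; rewrite /=; ring.
  - move=> t /andP[rt tr]; have t0 : 0 < t by lra.
    have : t ^+ N * p t <= r ^+ N * p r.
      apply: (derivative_ge0_le (f := fun t => t ^+ N * p t)
        (df := fun t => - (t ^+ N * f (u t)))); first exact: ltW.
      - by move=> x /andP[tx _]; apply: flux_continuous s _; lra.
      - by move=> x /andP[tx _]; apply: flux_derivative s _; lra.
      - move=> x /andP[tx _]; rewrite oppr_ge0 pmulr_rle0 ?exprn_gt0 //; last lra.
        by rewrite ltW // nonlin_lt0 // ut //; lra.
    have tr' : t ^+ N <= r ^+ N by rewrite lerXn2r ?nnegrE //; lra.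
    have := ground_slope_lt0 rp => pr.
    have : r ^+ N * p r <= t ^+ N * p r by rewrite ler_wnM2r // ltW.
    move=> h1 h2; have := le_trans h2 h1.
    by rewrite ler_pM2l ?exprn_gt0 // subr_le0.
have := up r (ltW rp); rewrite /W; lra.
Qed.

(** Each of the three terms is controlled by [r ^+ N.+1 * u r ^+ 2]; the slope
    enters through [ground_slope_bound], which shifts [r] to [r / 2]. *)
Lemma pfun_vanishing : (0 < N)%N -> vanishing (P u p).
Proof.
move=> N0 e e0; have [s up uv] := gs.
have [cG cG0 HG] := pratio_linear a0 th0 b0.
pose CF := a * th * (th + b).
have CF0 : 0 < CF by rewrite /CF !mulr_gt0 ?addr_gt0.
pose T : R := 2 ^+ N.+1.
have T0 : 0 < T by rewrite exprn_gt0.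
pose K := 2 * T + CF + N.+1%:R * (2 * cG * T) + 1.
have K0 : 0 < K.
  have : 0 < N.+1%:R * (2 * cG * T) by rewrite !mulr_gt0.
  by rewrite /K; lra.
have eK : 0 < e / (2 * K) by rewrite divr_gt0 ?mulr_gt0.
have [r1 r10 H1] := ground_decay eK.
have m0 : 0 < Num.min (th / 2) 1 by rewrite lt_min divr_gt0 //=.
have [r2 r20 H2] := uv _ m0.
pose rho := Num.max (Num.max r1 r2) 1.
have [rho1 rho2 rho3] : [/\ r1 <= rho, r2 <= rho & 1 <= rho].
  by rewrite !le_max !lexx !orbT.
exists (2 * rho); first by lra.
move=> r rr; have rp : 0 < r by lra.
have ur := up r (ltW rp); have us := up (r / 2) ltac:(lra).
have := H2 r ltac:(lra); rewrite gtr0_norm // lt_min => /andP[ur1 ur2].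
have := H2 (r / 2) ltac:(lra); rewrite gtr0_norm // lt_min => /andP[us1 us2].
have urs : u r <= u (r / 2) by rewrite ground_nonincreasing //; apply/andP; split; lra.
have dr := H1 r ltac:(lra).
have ds := H1 (r / 2) ltac:(lra).
have slope : r * `|p r| <= 2 * u (r / 2).
  apply: (ground_slope_bound (r1 := r2)) => //; last by lra.
  have := H2 r2 (lexx _); rewrite gtr0_norm; last by apply: up; exact: ltW.
  by rewrite lt_min => /andP[]; plra.
set del := e / (2 * K) in dr ds.
have ds' : r ^+ N.-1 * u (r / 2) ^+ 2 <= T * del.
  apply: (@le_trans _ _ (T * ((r / 2) ^+ N.+1 * u (r / 2) ^+ 2))); last first.
    by rewrite ler_wpM2l // ltW.
  rewrite mulrA ler_wpM2r ?sqr_ge0 // -exprMn_comm; last exact: mulrC.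
  have -> : 2 * (r / 2) = r by field.
  by rewrite ler_weXn2l //; [lra|rewrite (leq_trans (leq_pred N))].
have T1 : `|r ^+ N.+1 * (p r ^+ 2 / 2)| <= 2 * T * del.
  rewrite ger0_norm; last first.
    by rewrite mulr_ge0 ?exprn_ge0 ?divr_ge0 ?sqr_ge0 // ltW.
  have -> : r ^+ N.+1 * (p r ^+ 2 / 2) = r ^+ N.-1 * (r * `|p r|) ^+ 2 / 2.
    rewrite exprMn_comm; last exact: mulrC.
    rewrite real_normK ?num_real //.
    by rewrite -[in LHS](prednK N0) !exprS; ring.
  have : r ^+ N.-1 * (r * `|p r|) ^+ 2 <= r ^+ N.-1 * (2 * u (r / 2)) ^+ 2.
    rewrite ler_wpM2l ?exprn_ge0 ?(ltW rp) // lerXn2r ?nnegrE //.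
      by rewrite mulr_ge0 // ltW.
    by rewrite mulr_ge0 // ltW.
  have -> : r ^+ N.-1 * (2 * u (r / 2)) ^+ 2 = 4 * (r ^+ N.-1 * u (r / 2) ^+ 2) by ring.
  by lra.
have T2 : `|r ^+ N.+1 * F (u r)| <= CF * del.
  rewrite normrM (gtr0_norm (exprn_gt0 _ rp)).
  have := potential_cubic a0 th0 b0 (u := u r) ltac:(by rewrite ur ltW).
  rewrite -/CF => h.
  apply: (@le_trans _ _ (r ^+ N.+1 * (CF * u r ^+ 2))).
    rewrite ler_wpM2l ?exprn_ge0 ?(ltW rp) //; apply: le_trans h _.
    rewrite ler_wpM2l ?(ltW CF0) // exprS ler_piMl ?sqr_ge0 //; lra.
  by rewrite mulrCA ler_wpM2l // ltW.
have T3 : `|N.+1%:R * r ^+ N * p r * pratio a th b (u r)|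
    <= N.+1%:R * (2 * cG * T) * del.
  rewrite -!mulrA normrM normr_nat ler_wpM2l //.
  have h := HG (u r) ltac:(by rewrite ur ltW).
  have -> : r ^+ N * (p r * pratio a th b (u r)) =
      r ^+ N.-1 * ((r * p r) * pratio a th b (u r)).
    by rewrite -[in LHS](prednK N0) exprS; ring.
  rewrite normrM (gtr0_norm (exprn_gt0 _ rp)) normrM [`|r * _|]normrM (gtr0_norm rp).
  apply: (@le_trans _ _ (r ^+ N.-1 * (2 * u (r / 2) * (cG * u (r / 2))))).
    rewrite ler_wpM2l ?exprn_ge0 ?(ltW rp) //; apply: ler_pM => //.
      by rewrite mulr_ge0 // ltW.
    by apply: le_trans h _; rewrite ler_wpM2l // ltW.
  have -> : r ^+ N.-1 * (2 * u (r / 2) * (cG * u (r / 2))) =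
      2 * (cG * (r ^+ N.-1 * u (r / 2) ^+ 2)) by ring.
  by rewrite ler_wpM2l // ler_wpM2l // ltW.
have KE : K * del = e / 2 by rewrite /del; field; rewrite gt_eqF.
have del0 : 0 < del by [].
have : (2 * T + CF + N.+1%:R * (2 * cG * T)) * del <= e / 2.
  by rewrite -KE /K ler_wpM2r ?(ltW del0) // lerDl.
rewrite /pfun mulrDr.
have := ler_normD (r ^+ N.+1 * (p r ^+ 2 / 2) + r ^+ N.+1 * F (u r))
  (N.+1%:R * r ^+ N * p r * pratio a th b (u r)).
have := ler_normD (r ^+ N.+1 * (p r ^+ 2 / 2)) (r ^+ N.+1 * F (u r)).
rewrite mulrDl mulrDl.
move: T1 T2 T3; lra.
Qed.

End Decay.

End GroundStates.

(** * Uniqueness of the radial ground state *)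

Section Uniqueness.
Context {R : realType}.
Variable N : nat.
Implicit Types (u v p q : R -> R) (r t s x y e k : R).

Variables a th b : R.
Hypotheses (a0 : 0 < a) (th0 : 0 < th) (b0 : 0 < b).
Hypothesis hN : N = 1%N \/ N = 2%N.

Local Notation f := (nonlin a th b).
Local Notation F := (potential a th b).
Local Notation P := (pfun a th b N).
Local Notation ground := (ground_state N a th b).

Let N0 : (0 < N)%N. Proof. by case: hN => ->. Qed.

Lemma ground_range u p r : ground u p -> 0 <= r -> 0 <= u r <= u 0.
Proof.
move=> gs r0; have [_ up _] := gs; rewrite ltW ?up //=.
by apply: (ground_nonincreasing a0 th0 b0 gs); rewrite lexx.
Qed.

Lemma ground_th_lt u p : ground u p -> th < u 0.
Proof.
move=> gs; have [[_ _ p0 _ _] up _] := gs.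
apply: (th_lt_of_potential a0 th0 b0 (up _ (lexx 0))).
have := ground_energy_ge0 gs (lexx 0).
by rewrite p0 expr0n /= mul0r add0r.
Qed.

Lemma ground_level u p s : ground u p -> 0 < s < u 0 ->
  exists2 t, 0 < t & u t = s.
Proof.
move=> [[cu _ _ _ _] up uv] /andP[s0 su].
have [rho rho0 Hrho] := uv _ s0.
have us : u rho < s.
  by have := Hrho _ (lexx rho); rewrite gtr0_norm // up // ltW.
have [c [/andP[c0 _] uc _]] : exists c, [/\ 0 < c <= rho, s - u c = 0 &
    forall t, 0 <= t < c -> s - u t < 0].
  apply: (first_zero (f := fun t => s - u t)); first exact: ltW.
  - by move=> x /andP[x0 _]; have := cu x x0 => c1; cont.
  - by rewrite subr_lt0.
  - by rewrite subr_ge0 ltW.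
by exists c => //; lra.
Qed.

Section Comparison.
Variables u1 p1 u2 p2 : R -> R.
Hypotheses (gs1 : ground u1 p1) (gs2 : ground u2 p2) (u12 : u1 0 < u2 0).

Let s1 : radial_sol N f u1 p1. Proof. by case: gs1. Qed.
Let s2 : radial_sol N f u2 p2. Proof. by case: gs2. Qed.
Let up1 r : 0 <= r -> 0 < u1 r. Proof. by case: gs1 => _ + _; exact. Qed.
Let up2 r : 0 <= r -> 0 < u2 r. Proof. by case: gs2 => _ + _; exact. Qed.
Let neg1 r : 0 < r -> p1 r < 0. Proof. exact: (ground_slope_lt0 a0 th0 b0 gs1). Qed.
Let neg2 r : 0 < r -> p2 r < 0. Proof. exact: (ground_slope_lt0 a0 th0 b0 gs2). Qed.
Let dec1 x y : 0 <= x < y -> u1 y < u1 x.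
Proof. exact: (ground_decreasing a0 th0 b0 gs1). Qed.
Let dec2 x y : 0 <= x < y -> u2 y < u2 x.
Proof. exact: (ground_decreasing a0 th0 b0 gs2). Qed.

Let inverse : exists J : R -> R, forall s, 0 < s < u2 0 -> 0 < J s /\ u2 (J s) = s.
Proof.
have /choice[J HJ] s : exists t, 0 < s < u2 0 -> 0 < t /\ u2 t = s.
  have [sr|nsr] := boolP (0 < s < u2 0); last by exists 0.
  by have [t t0 ut] := ground_level gs2 sr; exists t.
by exists J.
Qed.

Let J := projT1 (cid inverse).
Let HJ s : 0 < s < u2 0 -> 0 < J s /\ u2 (J s) = s.
Proof. exact: (projT2 (cid inverse)). Qed.

Let JK t : 0 < t -> J (u2 t) = t.
Proof.
move=> t0; have ut : 0 < u2 t < u2 0 by rewrite up2 ?(ltW t0) //= dec2 // lexx.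
have [J0 E] := HJ ut; case: (ltgtP (J (u2 t)) t) => // lt.
  by have := dec2 (x := J (u2 t)) (y := t); rewrite (ltW J0) lt E ltxx => /(_ isT).
by have := dec2 (x := t) (y := J (u2 t)); rewrite (ltW t0) lt E ltxx => /(_ isT).
Qed.

Let dJ s : 0 < s < u2 0 -> is_derive s 1 J (p2 (J s))^-1.
Proof.
move=> sr; have [J0 E] := HJ sr; have [cu _ _ du _] := s2.
rewrite -[X in is_derive X]E.
apply: (is_derive_inverse (f := u2)).
- near=> y; apply: JK; near: y; exact: lt_nbhsr.
- near=> y; apply/continuous_atP/cu/ltW; near: y; exact: lt_nbhsr.
- exact: du.
- by rewrite lt_eqF // neg2.
Unshelve. all: by end_near. Qed.

(** The change of time by which both solutions are compared at equal height. *)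
Let S r := J (u1 r).
Let q r := p2 (S r).

Let u1r r : 0 <= r -> 0 < u1 r < u2 0.
Proof.
move=> r0; rewrite up1 //=; apply: le_lt_trans u12.
by have /andP[] := ground_range gs1 r0.
Qed.

Let S0 r : 0 <= r -> 0 < S r. Proof. by case/u1r/HJ. Qed.
Let u2S r : 0 <= r -> u2 (S r) = u1 r. Proof. by case/u1r/HJ. Qed.
Let q0 r : 0 <= r -> q r < 0. Proof. by move=> r0; apply/neg2/S0. Qed.

Let cS r : 0 <= r -> continuous_at S r.
Proof.
move=> r0; have [cu _ _ _ _] := s1.
exact: continuous_at_comp (cu _ r0) (derivative_continuous (dJ (u1r r0))).
Qed.

Let dS r : 0 < r -> is_derive r 1 S ((q r)^-1 * p1 r).
Proof.
move=> r0; have [_ _ _ du _] := s1.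
exact: derivative_comp (du _ r0) (dJ (u1r (ltW r0))).
Qed.

Let cq r : 0 <= r -> continuous_at q r.
Proof.
move=> r0; have [_ cp _ _ _] := s2.
by apply: continuous_at_comp (cS r0) (cp _ _); exact/ltW/S0.
Qed.

Let dq r : 0 < r -> is_derive r 1 q
  ((- (N%:R * q r / S r) - f (u1 r)) * ((q r)^-1 * p1 r)).
Proof.
move=> r0; have [_ _ _ _ dp] := s2.
have := derivative_comp (dS r0) (dp _ (S0 (ltW r0))).
by rewrite u2S // ltW.
Qed.

Let Delta r := p1 r ^+ 2 - q r ^+ 2.

Let cDelta r : 0 <= r -> continuous_at Delta r.
Proof.
move=> r0; have [_ cp _ _ _] := s1.
by have c1 := cp _ r0; have c2 := cq r0; rewrite /Delta; cont.
Qed.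

Let dDelta r : 0 < r -> is_derive r 1 Delta
  (2 * N%:R * p1 r * (q r / S r - p1 r / r)).
Proof.
move=> r0; have [_ _ _ _ dp] := s1.
have d1 := dp _ r0; have d2 := dq r0.
have qn : q r != 0 by rewrite lt_eqF // q0 // ltW.
have Sn : S r != 0 by rewrite gt_eqF // S0 // ltW.
have rn : r != 0 by rewrite gt_eqF.
by rewrite /Delta; deriv; rewrite /=; field; rewrite qn Sn rn.
Qed.

Let flux1 r := - (r ^+ N * p1 r).
Let flux2 r := - (S r ^+ N * q r).
Let ratio r := flux2 r / flux1 r.

Let flux1_gt0 r : 0 < r -> 0 < flux1 r.
Proof. by move=> r0; rewrite oppr_gt0 pmulr_rlt0 ?exprn_gt0 // neg1. Qed.

Let dflux1 r : 0 < r -> is_derive r 1 flux1 (r ^+ N * f (u1 r)).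
Proof.
move=> r0; apply: (derivative_eq (derivativeN (flux_derivative s1 r0))).
by rewrite opprK.
Qed.

Let dflux2 r : 0 < r ->
  is_derive r 1 flux2 (S r ^+ N * f (u1 r) * ((q r)^-1 * p1 r)).
Proof.
move=> r0; have Sr := S0 (ltW r0).
have d1 := derivative_comp (dS r0) (flux_derivative s2 Sr).
apply: (derivative_eq (derivativeN d1)).
by rewrite u2S ?(ltW r0) // mulNr opprK.
Qed.

(** In the logarithmic derivative of the flux ratio the geometric terms
    cancel: only [f] and the difference of the squared slopes remain. *)
Let dratio r : 0 < r -> is_derive r 1 ratio
  (f (u1 r) * Delta r * (S r ^+ N * r ^+ N / (- q r * flux1 r ^+ 2))).
Proof.
move=> r0; have fl := flux1_gt0 r0; have fn : flux1 r != 0 by rewrite gt_eqF.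
have qn : q r != 0 by rewrite lt_eqF // q0 // ltW.
apply: (derivative_eq (derivative_div fn (dflux2 r0) (dflux1 r0))).
rewrite /Delta; move: fn; rewrite /flux1 /flux2 => fn.
have pn : p1 r != 0 by rewrite lt_eqF // neg1.
have rn : r ^+ N != 0 by rewrite expf_neq0 // gt_eqF.
by field; rewrite pn qn rn.
Qed.

Let ratio_weight r : 0 < r -> 0 < S r ^+ N * r ^+ N / (- q r * flux1 r ^+ 2).
Proof.
move=> r0; have r0' := ltW r0.
have qp : 0 < - q r by rewrite oppr_gt0 q0.
by rewrite divr_gt0 ?mulr_gt0 ?exprn_gt0 ?S0 ?flux1_gt0.
Qed.

Let cratio r : 0 < r -> continuous_at ratio r.
Proof. by move=> r0; exact: derivative_continuous (dratio r0). Qed.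

Let ratio_lt x y : 0 < x < y ->
  (forall r, x < r < y -> f (u1 r) * Delta r < 0) -> ratio y < ratio x.
Proof.
move=> /andP[x0 xy] H.
apply: (derivative_lt0_gt (df := fun r =>
  f (u1 r) * Delta r * (S r ^+ N * r ^+ N / (- q r * flux1 r ^+ 2))) xy).
- by move=> r /andP[xr _]; apply: cratio; lra.
- by move=> r /andP[xr _]; apply: dratio; lra.
- move=> r xry; rewrite pmulr_llt0 ?H //; apply: ratio_weight.
  by case/andP: xry; lra.
Qed.

Let ratio_gt x y : 0 < x < y ->
  (forall r, x < r < y -> 0 < f (u1 r) * Delta r) -> ratio x < ratio y.
Proof.
move=> /andP[x0 xy] H.
apply: (derivative_gt0_lt (df := fun r =>
  f (u1 r) * Delta r * (S r ^+ N * r ^+ N / (- q r * flux1 r ^+ 2))) xy).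
- by move=> r /andP[xr _]; apply: cratio; lra.
- by move=> r /andP[xr _]; apply: dratio; lra.
- move=> r xry; rewrite mulr_gt0 ?H //; apply: ratio_weight.
  by case/andP: xry; lra.
Qed.

Let tau k r := flux2 r - k * flux1 r.

Let tauE k r : 0 < r -> tau k r = flux1 r * (ratio r - k).
Proof.
move=> r0; rewrite /tau /ratio; field.
by rewrite gt_eqF // flux1_gt0.
Qed.

Let dtau k r : 0 < r -> is_derive r 1 (tau k)
  (f (u1 r) * (S r ^+ N * ((q r)^-1 * p1 r) - k * r ^+ N)).
Proof.
move=> r0; have d1 := dflux1 r0; have d2 := dflux2 r0.
by rewrite /tau; deriv; rewrite /=; ring.
Qed.

Let Q k r := P u2 p2 (S r) - k * P u1 p1 r.

Let QE k r : 0 <= r -> Q k r =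
  S r ^+ N.+1 * (q r ^+ 2 / 2 + F (u1 r))
  - k * (r ^+ N.+1 * (p1 r ^+ 2 / 2 + F (u1 r)))
  - N.+1%:R * (pratio a th b (u1 r) * tau k r).
Proof. by move=> r0; rewrite /Q /pfun u2S // /tau /flux1 /flux2 /q !exprS; ring. Qed.

Let dQ k r : 0 < r -> u1 r != th ->
  is_derive r 1 (Q k) (- p1 r * pweight a th b N (u1 r) * tau k r).
Proof.
move=> r0 uth; have r0' := ltW r0.
have f1 : f (u1 r) != 0 by apply: nonlin_neq0 => //; exact: up1.
have f2 : f (u2 (S r)) != 0 by rewrite u2S.
have d1 := pfun_derivative s1 r0 erefl f1.
have d2 := derivative_comp (dS r0) (pfun_derivative s2 (S0 r0') erefl f2).
rewrite /Q; deriv; rewrite u2S // -/(q r) /tau /flux1 /flux2.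
by field; rewrite lt_eqF // q0.
Qed.

Let cQ k r : 0 <= r -> u1 r != th -> continuous_at (Q k) r.
Proof.
move=> r0 uth.
have f1 : f (u1 r) != 0 by apply: nonlin_neq0 => //; exact: up1.
have f2 : f (u2 (S r)) != 0 by rewrite u2S.
have c1 := pfun_continuous s1 r0 f1.
have c2 := continuous_at_comp (cS r0) (pfun_continuous s2 (ltW (S0 r0)) f2).
by rewrite /Q; cont.
Qed.

(** At height [th] the multiplier [pratio] has a simple pole.  If [tau k]
    vanishes there, it does so to second order, since its derivative contains
    the factor [f (u1 r)], and the singularity of [Q k] is removable; the
    value is the correct one because [pratio a th b th = 0] by the convention
    [0^-1 = 0]. *)
Let cQ_th k r : 0 < r -> u1 r = th -> tau k r = 0 -> continuous_at (Q k) r.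
Proof.
move=> r0 uth tk; have [cu cp _ du _] := s1.
have [h [hE /ContinuousAt ch hr]] := (is_derive1_caratheodory _ _ _).1 (dtau k r0).
have [g [gE /ContinuousAt cg gr]] := (is_derive1_caratheodory _ _ _).1 (du _ r0).
have hr0 : h r = 0 by rewrite hr uth nonlin_th mul0r.
have gr0 : g r != 0 by rewrite gr lt_eqF // neg1.
pose D t := a * u1 t ^+ 2 * (u1 t + b) * g t.
pose H t := F (u1 t) * h t * (D t)^-1.
have c0 : continuous_at u1 r by apply: cu; exact: ltW.
have c1 : continuous_at p1 r by apply: cp; exact: ltW.
have c2 := cS (ltW r0); have c3 := cq (ltW r0).
have c4 := continuous_at_comp c0 (potential_continuous a th b (u1 r)).
have Dr : D r != 0.
  have := up1 (ltW r0) => ur.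
  by rewrite /D mulf_neq0 // gt_eqF // !mulr_gt0 ?exprn_gt0 ?addr_gt0.
have cD : continuous_at D r by rewrite /D; cont.
have cH : continuous_at H r.
  rewrite /H; apply: continuous_atM; first by cont.
  exact: continuous_atV.
apply: (@continuous_at_near _ (fun t =>
  S t ^+ N.+1 * (q t ^+ 2 / 2 + F (u1 t))
  - k * (t ^+ N.+1 * (p1 t ^+ 2 / 2 + F (u1 t))) - N.+1%:R * H t)); last by cont.
near=> t; have t0 : 0 < t by near: t; exact: lt_nbhsr.
rewrite QE ?(ltW t0) //; congr (_ - _ * _).
have Et : tau k t = h t * (t - r) by rewrite -hE tk subr0.
have [->|tr] := eqVneq t r.
  by rewrite tk mulr0 /H hr0 mulr0 mul0r.
have ut := up1 (ltW t0).
have utn : u1 t - th != 0.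
  rewrite subr_eq0 -uth; move: tr; rewrite neq_lt => /orP[lt|lt].
    by rewrite gt_eqF // dec1 // ltW.
  by rewrite lt_eqF // dec1 // ltW.
have E : u1 t - th = g t * (t - r) by rewrite -gE uth.
have trn : t - r != 0 by apply: contraNneq utn => E0; rewrite E E0 mulr0.
have gn : g t != 0 by apply: contraNneq utn => E0; rewrite E E0 mul0r.
rewrite /H /D /pratio /nonlin E Et; field.
by rewrite gn trn !gt_eqF //= ?addr_gt0.
Unshelve. all: by end_near. Qed.

Let Q_vanishing k : vanishing (Q k).
Proof.
move=> e e0.
have e2 : 0 < e / 2 by rewrite divr_gt0.
have ek : 0 < e / (2 * (`|k| + 1)) by rewrite divr_gt0 ?mulr_gt0 // ltr_wpDl.
have [x1 x10 H1] := pfun_vanishing a0 th0 b0 gs1 N0 ek.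
have [x2 x20 H2] := pfun_vanishing a0 th0 b0 gs2 N0 e2.
have [_ _ uv] := gs1.
have [x3 x30 H3] := uv _ (up2 (ltW x20)).
exists (Num.max x1 x3); first by rewrite lt_max x10.
move=> r; rewrite ge_max => /andP[x1r x3r].
have r0 : 0 <= r by lra.
have Sx : x2 <= S r.
  rewrite leNgt; apply/negP => lt.
  have := dec2 (x := S r) (y := x2); rewrite (ltW (S0 r0)) lt u2S // => /(_ isT).
  by have := H3 _ x3r; rewrite gtr0_norm ?up1 // => h1 h2; have := lt_trans h1 h2; rewrite ltxx.
have h2 := H2 _ Sx.
have h1 : `|k * P u1 p1 r| <= e / 2.
  have := H1 _ x1r; rewrite ltr_pdivlMr ?mulr_gt0 ?ltr_wpDl // normrM => h.
  have := normr_ge0 (P u1 p1 r); move: h; move: `|P _ _ _| `|k| => y z; nra.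
by have := ler_normB (P u2 p2 (S r)) (k * P u1 p1 r); rewrite /Q; lra.
Qed.

Let Q0_gt0 k : 0 < Q k 0.
Proof.
have [_ _ p10 _ _] := s1; have [_ _ p20 _ _] := s2.
have P0 (u p : R -> R) : p 0 = 0 -> P u p 0 = 0.
  by move=> p0; rewrite /pfun p0 mulr0 mul0r expr0n /= mul0r addr0.
rewrite /Q (P0 u1) // mulr0 subr0.
suff : P u2 p2 0 < P u2 p2 (S 0) by rewrite (P0 u2 p2).
have above x : 0 <= x <= S 0 -> th < u2 x.
  move=> /andP[x0 xS]; apply: lt_le_trans (ground_th_lt gs1) _.
  by rewrite -(u2S (lexx 0)) (ground_nonincreasing a0 th0 b0 gs2) // x0.
have fn x : 0 <= x <= S 0 -> f (u2 x) != 0.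
  by move=> /above h; rewrite gt_eqF // nonlin_gt0.
apply: (derivative_gt0_lt (f := P u2 p2) (df := fun r =>
  r ^+ N * p2 r ^+ 2 * pweight a th b N (u2 r)) (S0 (lexx 0))).
- by move=> x xS; apply: pfun_continuous s2 _ (fn x xS); case/andP: xS.
- move=> x /andP[x0 xS]; apply: (pfun_derivative s2 x0 erefl (fn x _)).
  by rewrite (ltW x0) (ltW xS).
- move=> x /andP[x0 xS]; rewrite mulr_gt0 //.
    by rewrite mulr_gt0 ?(exprn_gt0 N x0) // exprn_even_gt0 //= lt_eqF // neg2.
  have tx := above x ltac:(by rewrite (ltW x0) (ltW xS)).
  have := pweight_lower a0 th0 b0 hN (up2 (ltW x0)) ltac:(by rewrite gt_eqF).
  lra.
Qed.

Let weight_gt0 r : 0 < r -> u1 r != th ->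
  0 < - p1 r * pweight a th b N (u1 r).
Proof.
move=> r0 uth; rewrite mulr_gt0 ?oppr_gt0 ?neg1 //.
by have := pweight_lower a0 th0 b0 hN (up1 (ltW r0)) uth; lra.
Qed.

Let Q_lt k x y : 0 <= x < y ->
  (forall r, x <= r <= y -> continuous_at (Q k) r) ->
  (forall r, x < r < y -> u1 r != th /\ 0 < tau k r) -> Q k x < Q k y.
Proof.
move=> /andP[x0 xy] cont_Q H.
apply: (derivative_gt0_lt (df := fun r =>
  - p1 r * pweight a th b N (u1 r) * tau k r) xy) => // r xry.
  by have [uth _] := H _ xry; apply: dQ => //; case/andP: xry; lra.
have [uth tp] := H _ xry; rewrite mulr_gt0 // weight_gt0 //.
by case/andP: xry; lra.
Qed.

Let Q_gt k x y : 0 <= x < y ->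
  (forall r, x <= r <= y -> continuous_at (Q k) r) ->
  (forall r, x < r < y -> u1 r != th /\ tau k r < 0) -> Q k y < Q k x.
Proof.
move=> /andP[x0 xy] cont_Q H.
apply: (derivative_lt0_gt (df := fun r =>
  - p1 r * pweight a th b N (u1 r) * tau k r) xy) => // r xry.
  by have [uth _] := H _ xry; apply: dQ => //; case/andP: xry; lra.
have [uth tp] := H _ xry; rewrite pmulr_rlt0 // weight_gt0 //.
by case/andP: xry; lra.
Qed.

(** With [k] the flux ratio at a point of equal slopes, the term with the
    multiplier disappears, and the common energy can be factored out. *)
Let Q_contact r : 0 < r -> Delta r = 0 ->
  [/\ q r = p1 r, ratio r = S r ^+ N / r ^+ N, tau (ratio r) r = 0 &
      Q (ratio r) r = S r ^+ N * (S r - r) * (p1 r ^+ 2 / 2 + F (u1 r))].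
Proof.
move=> r0 D0; have r0' := ltW r0.
have qp : q r = p1 r.
  move/eqP: D0; rewrite /Delta subr_eq0 eqf_sqr => /orP[/eqP->//|/eqP E].
  by have := q0 r0'; have := neg1 r0; lra.
have pn : p1 r != 0 by rewrite lt_eqF // neg1.
have rn : r != 0 by rewrite gt_eqF.
have rE : ratio r = S r ^+ N / r ^+ N.
  by rewrite /ratio /flux1 /flux2 qp; field; rewrite pn expf_neq0.
have t0 : tau (ratio r) r = 0 by rewrite tauE // subrr mulr0.
split => //; rewrite QE // t0 !mulr0 subr0 qp rE !exprS; field.
by rewrite expf_neq0.
Qed.

Let above_th r rth : u1 rth = th -> 0 <= r < rth -> th < u1 r.
Proof. by move=> <-; exact: dec1. Qed.

Let below_th r rth : u1 rth = th -> 0 <= rth < r -> u1 r < th.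
Proof. by move=> <-; exact: dec1. Qed.

(** If the second solution is the steeper one at every height, the flux ratio
    has its minimum at height [th].  For [k] this minimum, [Q k] increases from
    a positive value, but it tends to [0]. *)
Let no_contact : (forall r, 0 <= r -> Delta r < 0) -> False.
Proof.
move=> neg.
have [rth rth0 uth] := ground_level gs1
  (s := th) ltac:(by rewrite th0 (ground_th_lt gs1)).
pose k := ratio rth.
have tk : tau k rth = 0 by rewrite tauE // subrr mulr0.
have tauL r : 0 < r < rth -> u1 r != th /\ 0 < tau k r.
  move=> /andP[r0 rr]; split; first by rewrite gt_eqF // (above_th uth) // ltW.
  rewrite tauE // mulr_gt0 ?flux1_gt0 // subr_gt0.
  apply: ratio_lt => [|x /andP[rx xr]]; first by rewrite r0.
  rewrite pmulr_rlt0 ?neg //; first lra.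
  by apply: nonlin_gt0 => //; apply: (above_th uth); apply/andP; split; lra.
have tauR r : rth < r -> u1 r != th /\ 0 < tau k r.
  move=> rr; have r0 : 0 < r by lra.
  split; first by rewrite lt_eqF // (below_th uth) // ltW.
  rewrite tauE // mulr_gt0 ?flux1_gt0 // subr_gt0.
  apply: ratio_gt => [|x /andP[rx xr]]; first by rewrite rth0.
  have x0 : 0 <= x by lra.
  rewrite nmulr_rgt0 ?neg //; apply: nonlin_lt0 => //; rewrite up1 //=.
  by apply: (below_th uth); rewrite (ltW rth0).
have cQk r : 0 <= r -> continuous_at (Q k) r.
  move=> r0; have [E|ne] := eqVneq (u1 r) th; last exact: cQ.
  have -> : r = rth.
    case: (ltgtP r rth) => // lt.
      by have := above_th uth (r := r); rewrite r0 lt E ltxx => /(_ isT).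
    by have := below_th uth (r := r); rewrite (ltW rth0) lt E ltxx => /(_ isT).
  exact: cQ_th.
have h1 : Q k 0 < Q k rth.
  apply: Q_lt => [|r /andP[r0 _]|]; [by rewrite lexx|exact: cQk|exact: tauL].
have [rho rho0 H] := Q_vanishing k (Q0_gt0 k).
pose x := rth + rho.
have h2 : Q k rth < Q k x.
  apply: Q_lt => [|r /andP[r0 _]|r /andP[r0 _]].
  - by rewrite (ltW rth0) /x; lra.
  - by apply: cQk; lra.
  - exact: tauR.
have := H x ltac:(rewrite /x; lra); have := ler_norm (Q k x); lra.
Qed.

(** At the first point [rc] of equal slopes [Delta] reaches [0] from below; this
    means [S rc <= rc] and makes [Q k rc] nonpositive for [k] the flux ratio at
    [rc].  If the height there is at least [th], the ratio decreases up to
    [rc], and [Q k] would increase from a positive to a nonpositive value.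
    Below [th] the ratio decreases as long as [Delta > 0].  A further point of
    equal slopes would have [S y >= y], hence a ratio at least [1], whereas the
    ratio at [rc] is at most [1].  So [Delta > 0] from [rc] on, and [Q k]
    decreases from a nonpositive value, but it tends to [0]. *)
Let contact rc : 0 < rc -> Delta rc = 0 ->
  (forall r, 0 <= r < rc -> Delta r < 0) -> False.
Proof.
move=> rc0 D0 neg; have rc0' := ltW rc0.
have [qp rE tk QrE] := Q_contact rc0 D0.
have E0 := ground_energy_ge0 gs1 rc0'.
set k := ratio rc in tk QrE.
have NR : 0 < (N%:R : R) by rewrite ltr0n.
have coef_gt0 r : 0 < r -> 0 < 2 * N%:R * p1 r ^+ 2.
  move=> r0; have : 0 < p1 r ^+ 2 by rewrite exprn_even_gt0 //= lt_eqF // neg1.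
  by apply: mulr_gt0; rewrite mulr_gt0.
have slopeE r : 0 < r -> q r = p1 r ->
    2 * N%:R * p1 r * (q r / S r - p1 r / r)
    = 2 * N%:R * p1 r ^+ 2 * ((S r)^-1 - r^-1).
  by move=> r0 ->; ring.
have slope := derivative_first_zero rc0 D0 neg (dDelta rc0).
have Sr : S rc <= rc.
  move: slope; rewrite slopeE // (pmulr_rge0 _ (coef_gt0 _ rc0)).
  by rewrite subr_ge0 lef_pV2 ?posrE ?S0.
have Qc : Q k rc <= 0.
  rewrite QrE mulr_le0_ge0 // mulr_ge0_le0 ?subr_le0 //.
  by rewrite exprn_ge0 // ltW // S0.
have [thu|uth] := leP th (u1 rc).
  have ut r : 0 <= r < rc -> th < u1 r.
    by move=> rr; apply: le_lt_trans thu _; exact: dec1.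
  have cQk r : 0 <= r <= rc -> continuous_at (Q k) r.
    move=> /andP[r0]; rewrite le_eqVlt => /orP[/eqP->|lt].
      have [E|ne] := eqVneq (u1 rc) th; first exact: cQ_th.
      exact: cQ.
    by apply: cQ => //; rewrite gt_eqF // ut // r0.
  have : Q k 0 < Q k rc.
    apply: Q_lt => //; first by rewrite lexx.
    move=> r /andP[r0 rr]; split; first by rewrite gt_eqF // ut // ltW.
    rewrite tauE // mulr_gt0 ?flux1_gt0 // subr_gt0.
    apply: ratio_lt => [|x /andP[rx xr]]; first by rewrite r0.
    have xc : 0 <= x < rc by rewrite xr andbT; lra.
    by rewrite pmulr_rlt0 ?neg //; apply: nonlin_gt0 => //; exact: ut.
  by rewrite ltNge (le_trans Qc) // ltW // Q0_gt0.
have ub r : rc <= r -> 0 < u1 r < th.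
  move=> rr; rewrite up1 /=; last lra.
  by apply: le_lt_trans uth; apply: (ground_nonincreasing a0 th0 b0 gs1); rewrite rc0'.
have fneg r : rc <= r -> f (u1 r) < 0 by move=> /ub; exact: nonlin_lt0.
(* Otherwise the solutions would have the same data at [rc], hence the same
   initial height. *)
have Sne : S rc != rc.
  apply/eqP => SE.
  have M0 : 0 <= u2 0 by apply/ltW/up2.
  have [L L0 HL] := nonlin_lipschitz a0 th0 b0 M0.
  have : u1 0 = u2 0.
    apply: (gronwall_backward (rho := rc) s1 s2 L0) => //.
    - move=> r /andP[r0 _]; apply: HL.
        have /andP[-> h] := ground_range gs1 r0; apply: le_trans h _; exact: ltW.
      exact: ground_range gs2 r0.
    - by rewrite -[in RHS]SE u2S.
    - by rewrite -qp /q SE.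
  by move=> E; move: u12; rewrite E ltxx.
have Slt : S rc < rc by rewrite lt_neqAle Sne.
have slope0 : 0 < 2 * N%:R * p1 rc * (q rc / S rc - p1 rc / rc).
  rewrite slopeE // (pmulr_rgt0 _ (coef_gt0 _ rc0)).
  by rewrite subr_gt0 ltf_pV2 ?posrE ?S0.
have [d d0 Hd] := derivative_gt0_right D0 slope0 (dDelta rc0).
have pos r : rc < r -> 0 < Delta r.
  move=> rr; rewrite ltNge; apply/negP => Dr.
  pose x := rc + Num.min (d / 2) ((r - rc) / 2).
  have m0 : 0 < Num.min (d / 2) ((r - rc) / 2).
    by rewrite lt_min !divr_gt0 // subr_gt0.
  have m1 : Num.min (d / 2) ((r - rc) / 2) <= d / 2 by rewrite ge_min lexx.
  have m2 : Num.min (d / 2) ((r - rc) / 2) <= (r - rc) / 2 by rewrite ge_min lexx orbT.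
  have [y [/andP[xy yr] Dy Hy]] : exists y, [/\ x < y <= r, - Delta y = 0 &
      forall t, x <= t < y -> - Delta t < 0].
    apply: (first_zero (f := fun t => - Delta t)).
    - by rewrite /x; lra.
    - move=> t /andP[xt _]; apply: continuous_atN; apply: cDelta.
      by rewrite /x in xt; lra.
    - by rewrite oppr_lt0 Hd // /x; lra.
    - by rewrite oppr_ge0.
  have y0 : 0 < y by rewrite /x in xy; lra.
  have Dy0 : Delta y = 0 by lra.
  have [qpy rEy _ _] := Q_contact y0 Dy0.
  have := derivative_first_zero xy Dy Hy (derivativeN (dDelta y0)).
  rewrite slopeE // oppr_ge0 (pmulr_rle0 _ (coef_gt0 _ y0)).
  rewrite subr_le0 lef_pV2 ?posrE ?S0 ?(ltW y0) // => yS.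
  have : ratio y < ratio rc.
    apply: ratio_lt => [|t /andP[ct ty]].
      by rewrite rc0 /=; rewrite /x in xy; lra.
    rewrite nmulr_rlt0; last by apply: fneg; exact: ltW.
    have [tx|xt] := ltP t x; first by apply: Hd; rewrite ct /=; rewrite /x in tx; lra.
    by have := Hy t; rewrite xt ty oppr_lt0 => /(_ isT).
  rewrite rEy rE ltNge => /negP; apply.
  apply: (@le_trans _ _ 1).
    by rewrite ler_pdivrMr ?exprn_gt0 // mul1r lerXn2r ?nnegrE // ltW // S0.
  by rewrite ler_pdivlMr ?exprn_gt0 // mul1r lerXn2r ?nnegrE // ltW // S0 // ltW.
have Qdec x y : rc <= x < y -> Q k y < Q k x.
  move=> /andP[cx xy]; apply: Q_gt.
  - by rewrite xy andbT; lra.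
  - move=> r /andP[xr _]; have cr : rc <= r by lra.
    apply: cQ; first lra.
    by have /andP[_ h] := ub r cr; rewrite lt_eqF.
  - move=> r /andP[xr _]; have cr : rc < r by lra.
    split; first by have /andP[_ h] := ub r (ltW cr); rewrite lt_eqF.
    rewrite tauE; last lra.
    rewrite pmulr_rlt0 ?flux1_gt0 ?subr_lt0 //; last lra.
    apply: ratio_lt => [|t /andP[ct tr]]; first by rewrite rc0.
    by rewrite nmulr_rlt0 ?pos //; apply: fneg; exact: ltW.
have h1 := Qdec rc (rc + 1) ltac:(apply/andP; split; lra).
have [rho rho0 H] := Q_vanishing k (e := - Q k (rc + 1)) ltac:(lra).
have h2 := Qdec (rc + 1) (rc + 1 + rho) ltac:(apply/andP; split; lra).
have := H (rc + 1 + rho) ltac:(lra); have := ler_norm (- Q k (rc + 1 + rho)).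
by rewrite normrN; lra.
Qed.

Lemma ground_states_ordered_false : False.
Proof.
have D0 : Delta 0 < 0.
  have [_ _ p10 _ _] := s1.
  rewrite /Delta p10 expr0n /= sub0r oppr_lt0 exprn_even_gt0 //=.
  by rewrite lt_eqF // q0.
have [neg|] := pselect (forall r, 0 <= r -> Delta r < 0).
  exact: no_contact.
move=> /existsNP[r /not_implyP[r0 /negP]]; rewrite -leNgt => Dr.
have [c [/andP[c0 _] Dc neg]] := first_zero r0
  (fun x (h : 0 <= x <= r) => cDelta (proj1 (andP h))) D0 Dr.
exact: contact c0 Dc neg.
Qed.

End Comparison.

Lemma ground_state_unique u p v q : ground u p -> ground v q ->
  forall r, 0 <= r -> u r = v r.
Proof.
move=> gu gv; have [su up _] := gu; have [sv _ _] := gv.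
have uv0 : u 0 = v 0.
  case: (ltgtP (u 0) (v 0)) => // lt.
    by case: (ground_states_ordered_false gu gv lt).
  by case: (ground_states_ordered_false gv gu lt).
have [L L0 HL] := nonlin_lipschitz a0 th0 b0 (ltW (up _ (lexx 0))).
move=> r r0.
have lip t : 0 <= t <= r -> `|f (u t) - f (v t)| <= L * `|u t - v t|.
  move=> /andP[t0 _]; apply: HL; first exact: ground_range gu t0.
  by rewrite uv0; exact: ground_range gv t0.
have := gronwall_forward su sv L0 lip (r := r) ltac:(by rewrite r0 lexx).
have [_ _ p0 _ _] := su; have [_ _ q0 _ _] := sv.
rewrite uv0 p0 q0 !subrr expr0n /= addr0 mul0r => H.
apply/eqP; rewrite -subr_eq0 -sqrf_eq0 eq_le sqr_ge0 andbT.
by apply: le_trans H; rewrite lerDl sqr_ge0.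
Qed.

End Uniqueness.

(** * Solutions from large heights cross zero *)

Section Existence.
Context {R : realType}.
Variable N : nat.
Variables a th b : R.
Hypotheses (a0 : 0 < a) (th0 : 0 < th) (b0 : 0 < b).
Hypothesis hN : N = 1%N \/ N = 2%N.
Implicit Types (u p : R -> R) (r t x y e M alpha beta : R).
Local Ltac plra := pose proof a0; pose proof th0; pose proof b0; lra.

Local Notation f := (nonlin a th b).
Local Notation F := (potential a th b).
Local Notation P := (pfun a th b N).

(** The nonlinearity is frozen outside of [[0, M]], which makes it bounded and
    globally Lipschitz; solutions with values in that range are not
    affected. *)
Definition clamp M x := Num.min (Num.max x 0) M.
Definition truncated M x := f (clamp M x).

Lemma clamp_range M x : 0 <= M -> 0 <= clamp M x <= M.
Proof. by move=> M0; rewrite /clamp le_min ge_min lexx orbT le_max lexx orbT M0. Qed.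

Lemma clamp_id M x : 0 <= x <= M -> clamp M x = x.
Proof. by move=> /andP[x0 xM]; rewrite /clamp max_l // min_l. Qed.

Lemma clamp_lipschitz M x y : `|clamp M x - clamp M y| <= `|x - y|.
Proof.
have half (s t : R) : s <= t -> `|clamp M t - clamp M s| <= `|t - s|.
  move=> st; rewrite ger0_norm /clamp; last first.
    rewrite subr_ge0 le_min !ge_min lexx orbT andbT.
    by rewrite ge_max !le_max st lexx !orbT.
  rewrite [X in _ <= X]ger0_norm ?subr_ge0 //.
  have [h1|h1] := leP (Num.max s 0) M; have [h2|h2] := leP (Num.max t 0) M;
  have [h3|h3] := leP s 0; have [h4|h4] := leP t 0;
  rewrite ?(max_r h3) ?(max_l (ltW h3)) ?(max_r h4) ?(max_l (ltW h4)) in h1 h2 *;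
  lra.
have [st|ts] := leP x y; first by rewrite distrC [`|x - y|]distrC half.
by rewrite half // ltW.
Qed.

Lemma truncated_id M x : 0 <= x <= M -> truncated M x = f x.
Proof. by move=> xM; rewrite /truncated clamp_id. Qed.

Lemma truncated_regular M : 0 <= M -> exists L B, [/\ 0 <= L,
  forall x y, `|truncated M x - truncated M y| <= L * `|x - y| &
  forall x, `|truncated M x| <= B].
Proof.
move=> M0; have [L L0 HL] := nonlin_lipschitz a0 th0 b0 M0.
exists L, (L * M); split => // [x y|x].
  apply: le_trans (HL _ _ _ _) _; [exact: clamp_range..|].
  by rewrite ler_wpM2l // clamp_lipschitz.
have := HL _ _ (clamp_range x M0) (introT andP (conj (lexx 0) M0)).
rewrite nonlin0 !subr0 => h; apply: le_trans h _.
have /andP[c0 cM] := clamp_range x M0.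
by rewrite ler_wpM2l // ger0_norm.
Qed.

Lemma truncated_continuous M x : 0 <= M -> continuous_at (truncated M) x.
Proof.
move=> M0; have [L [B [L0 lip _]]] := truncated_regular M0.
apply/continuous_atP/cvgrPdist_lt => e e0; apply/nbhs_ballP.
exists (e / (L + 1)); first by rewrite /= divr_gt0 //; lra.
move=> y; rewrite /ball /= ltr_pdivlMr; last lra.
by move=> ye; apply: le_lt_trans (lip _ _) _; have := normr_ge0 (x - y); nra.
Qed.

Lemma truncated_gt0 M x : th < M -> th < x -> 0 < truncated M x.
Proof.
move=> thM thx; apply: nonlin_gt0 => //.
by rewrite /clamp lt_min thM lt_max thx.
Qed.

Lemma truncated_ge M x y : th <= y <= M -> y <= x -> f y <= truncated M x.
Proof.
move=> /andP[thy yM] yx; apply: nonlin_mono => //.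
by rewrite thy /clamp le_min yM le_max yx.
Qed.

Lemma truncated_lower M x : 0 <= M -> - (a * th ^+ 3 * (th + b)) <= truncated M x.
Proof.
by move=> M0; apply: nonlin_lower => //; have /andP[] := clamp_range x M0.
Qed.

Lemma truncated_potential M : 0 <= M -> exists G : R -> R, [/\ G 0 = 0,
  forall x, -1 < x -> is_derive x 1 G (truncated M x) &
  forall x, 0 <= x <= M -> G x = F x].
Proof.
move=> M0.
have ct : continuous (truncated M).
  by move=> x; apply/continuous_atP/truncated_continuous.
have [G G0 dG] := primitive ct; exists G; split => // x /andP[x0 xM].
have cW t : 0 <= t <= x -> continuous_at (fun t => G t - F t) t.
  move=> /andP[t0 _].
  have c1 := derivative_continuous (dG t ltac:(lra)).
  by have c2 := potential_continuous a th b t; cont.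
have dW t : 0 < t < x -> is_derive t 1 (fun t => G t - F t) 0.
  move=> /andP[t0 tx]; have d1 := dG t ltac:(lra).
  have d2 := potential_derivative a th b t.
  apply: (derivative_eq (derivativeB d1 d2)).
  by rewrite truncated_id ?subrr //; apply/andP; split; lra.
have h1 := derivative_ge0_le (df := fun=> 0) x0 cW dW (fun t _ => lexx 0).
have h2 := derivative_le0_ge (df := fun=> 0) x0 cW dW (fun t _ => lexx 0).
move: h1 h2; rewrite G0 potential0 subrr => h1 h2.
by apply/eqP; rewrite -subr_eq0 eq_le h2 h1.
Qed.

Section Crossing.
Variables (M : R) (u p : R -> R).
Let m := 2 * th + b + 1.
Hypothesis mM : 2 * m <= M.
Hypothesis s : radial_sol N (truncated M) u p.
Hypothesis u0 : u 0 = M.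
Hypothesis nonneg : forall r, 0 <= r -> 0 <= u r.

Let n : R := N.+1%:R.
Let n0 : 0 < n. Proof. by rewrite ltr0n. Qed.
Let m1 : 1 <= m. Proof. rewrite /m; plra. Qed.
Let thm : 2 * th <= m. Proof. rewrite /m; plra. Qed.
Let thm' : th < m. Proof. rewrite /m; plra. Qed.
Let bm : b <= m. Proof. rewrite /m; plra. Qed.
Let M0 : 0 <= M. Proof. by have := m1; have := mM; lra. Qed.
Let mM' : m < M. Proof. by have := m1; have := mM; lra. Qed.

Lemma reaches_level : exists2 rm, 0 < rm & u rm = m /\
  forall t, 0 <= t < rm -> m < u t.
Proof.
have [cu _ _ _ _] := s.
have [r r0 ur] : exists2 r, 0 <= r & u r <= m.
  apply: contrapT => no.
  have above r : 0 <= r -> m < u r.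
    by move=> r0; rewrite ltNge; apply/negP => h; apply: no; exists r.
  have fm : 0 < f m by apply: nonlin_gt0.
  have steep r : 1 < r -> p r <= - (f m / n).
    move=> r1; have r0 : 0 < r by lra.
    apply: le_trans (slope_le (c := f m) s r0 _) _.
      move=> t /andP[t0 _]; apply: truncated_ge; last by rewrite ltW // above // ltW.
      by rewrite ltW //= ltW.
    by rewrite lerN2 ler_pM2r ?invr_gt0 // ler_peMr // ltW.
  have [|x x0 ux] := escape s ler01 _ steep; first by rewrite divr_gt0.
  by have := nonneg x0; lra.
have [rm [/andP[rm0 _] Erm Hrm]] : exists c, [/\ 0 < c <= r, m - u c = 0 &
    forall t, 0 <= t < c -> m - u t < 0].
  apply: (first_zero (f := fun t => m - u t)) => //.
  - by move=> x /andP[x0 _]; have c1 := cu x x0; cont.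
  - by rewrite u0 subr_lt0.
  - by rewrite subr_ge0.
exists rm => //; split; first lra.
by move=> t /Hrm; lra.
Qed.

Variable rm : R.
Hypotheses (rm0 : 0 < rm) (urm : u rm = m).
Hypothesis above : forall t, 0 <= t < rm -> m < u t.

Let above_le t : 0 <= t <= rm -> m <= u t.
Proof.
move=> /andP[t0]; rewrite le_eqVlt => /orP[/eqP->|lt]; first by rewrite urm.
by rewrite ltW // above // t0.
Qed.

Lemma level_falling r : 0 < r <= rm -> p r < 0.
Proof.
move=> /andP[r0 rr].
apply: le_lt_trans (slope_le (c := f m) s r0 _) _.
  move=> t /andP[t0 tr]; apply: truncated_ge.
    by rewrite ltW //= ltW.
  by apply: above_le; apply/andP; split; lra.
have fm : 0 < f m by apply: nonlin_gt0.
by rewrite oppr_lt0 divr_gt0 // mulr_gt0.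
Qed.

Let dec x y : 0 <= x -> x <= y -> y <= rm -> u y <= u x.
Proof.
move=> x0 xy yr; have [cu _ _ du _] := s.
apply: (derivative_le0_ge xy (df := p)) => t /andP[xt ty].
- by apply: cu; lra.
- by apply: du; lra.
- by apply/ltW/level_falling; apply/andP; split; lra.
Qed.

Let range t : 0 <= t <= rm -> m <= u t <= M.
Proof. by move=> tr; rewrite above_le //= -u0; case/andP: tr => *; exact: dec. Qed.

Let source t : 0 <= t <= rm -> truncated M (u t) = f (u t).
Proof.
move=> /range /andP[h1 h2]; apply: truncated_id; rewrite h2 andbT.
by have := m1; lra.
Qed.

Let slope_level r : 0 < r <= rm -> p r <= - (f (u r) * r / n).
Proof.
move=> /andP[r0 rr]; apply: slope_le s r0 _ => t /andP[t0 tr].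
rewrite source; last by apply/andP; split; lra.
apply: nonlin_mono => //; rewrite dec ?(ltW t0) ?(ltW tr) // andbT.
by have := @above_le r ltac:(apply/andP; split; lra); have := thm'; lra.
Qed.

(** Above the level the slope is at most [- a / 2 * u ^+ 4 * r / n], so that
    [u ^- 3] grows at least quadratically, whatever the initial height. *)
Lemma level_time : rm ^+ 2 <= 4 * n / (3 * a).
Proof.
have [cu _ _ du _] := s.
have upos t : 0 <= t <= rm -> 0 < u t by move/above_le; have := m1; lra.
pose W t := (u t)^-1 ^+ 3 - 3 * a / (4 * n) * t ^+ 2.
have : W 0 <= W rm.
  apply: (derivative_ge0_le (ltW rm0) (df := fun t =>
    3 * (u t)^-1 ^+ 2 * (- p t / u t ^+ 2) - 3 * a / (2 * n) * t)).
  - move=> t /andP[t0 tr]; have ut := upos t ltac:(by rewrite t0).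
    have c1 := continuous_atV (lt0r_neq0 ut) (cu _ t0).
    by rewrite /W; cont.
  - move=> t /andP[t0 tr]; have ut := upos t ltac:(by rewrite !ltW).
    have d1 := derivativeV (lt0r_neq0 ut) (du _ t0).
    rewrite /W; deriv; rewrite /=; field.
    by rewrite !gt_eqF.
  - move=> t /andP[t0 tr]; have tr' : 0 <= t <= rm by rewrite !ltW.
    have ut := upos t tr'.
    have h2 := nonlin_quartic_lower a0 th0 b0 (le_trans thm (above_le tr')).
    have h1 := slope_level (r := t) ltac:(by rewrite t0 ltW).
    have -> : 3 * (u t)^-1 ^+ 2 * (- p t / u t ^+ 2) - 3 * a / (2 * n) * t
       = 3 / u t ^+ 4 * (- p t - a / 2 * u t ^+ 4 * t / n).
      by field; rewrite !gt_eqF.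
    rewrite mulr_ge0 ?divr_ge0 ?exprn_ge0 ?(ltW ut) // subr_ge0 lerNr.
    apply: le_trans h1 _; rewrite lerN2 ler_pM2r ?invr_gt0 //.
    by rewrite ler_pM2r.
rewrite /W urm expr0n /= mulr0 subr0 => h.
have h1 : 0 <= (u 0)^-1 ^+ 3.
  by rewrite exprn_ge0 // invr_ge0 ltW // upos // lexx ltW.
have h2 : m^-1 ^+ 3 <= 1.
  by rewrite exprn_ile1 ?invr_ge0 ?invf_le1 //; have := m1; lra.
have h3 : 3 * a / (4 * n) * rm ^+ 2 <= 1.
  by move: h h1 h2; move: (_ * rm ^+ 2) ((u 0)^-1 ^+ 3) (m^-1 ^+ 3) => x y z; lra.
rewrite ler_pdivlMr ?mulr_gt0 //.
have -> : rm ^+ 2 * (3 * a) = 4 * n * (3 * a / (4 * n) * rm ^+ 2).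
  by field; rewrite gt_eqF.
by rewrite -[X in _ <= X]mulr1 ler_pM2l // mulr_gt0.
Qed.

(** At the time [r1] at which the height is halved: the upper bound of [f]
    gives the lower bound of [r1], and the lower bound of [f] on
    [[M / 2, M]] a lower bound of the slope, hence of the growth of the
    functional. *)
Lemma functional_growth :
  exists r1, [/\ 0 < r1 <= rm, n / (2 * a * M ^+ 3) <= r1 ^+ 2 &
  (a * M ^+ 4 / (32 * n)) ^+ 2 / 40 / N.+3%:R * r1 ^+ N.+3 <= P u p r1].
Proof.
have [cu _ p0 du _] := s.
have Mp : 0 < M by have := m1; have := mM; lra.
have [r1 /andP[r10 r1m] ur1] : exists2 c, 0 <= c <= rm & - u c = - (M / 2).
  apply: (intermediate_value (f := fun t => - u t)) (ltW rm0) _ _.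
    by move=> t /andP[t0 _]; apply: continuous_atN; exact: cu.
  by rewrite u0 urm !lerN2; have := mM; lra.
have {}ur1 : u r1 = M / 2 by lra.
have r1p : 0 < r1.
  by rewrite lt_neqAle r10 andbT; apply: contra_eq_neq ur1 => <-; rewrite u0; lra.
have range1 t : 0 <= t <= r1 -> M / 2 <= u t <= M.
  move=> /andP[t0 tr]; rewrite -ur1 -u0 !dec //; lra.
have trm t : 0 <= t <= r1 -> 0 <= t <= rm.
  by move=> /andP[-> /le_trans]; apply.
exists r1; split; first by rewrite r1p.
  have : u 0 + a * M ^+ 4 / n * 0 ^+ 2 <= u r1 + a * M ^+ 4 / n * r1 ^+ 2.
    apply: (derivative_ge0_le (f := fun t => u t + a * M ^+ 4 / n * t ^+ 2)
      (df := fun t => p t + 2 * a * M ^+ 4 * t / n) r10).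
    - by move=> t /andP[t0 _]; have c1 := cu t t0; cont.
    - move=> t /andP[t0 _]; have d1 := du t t0; deriv; rewrite /=; field.
      by rewrite gt_eqF.
    - move=> t /andP[t0 tr]; rewrite -lerBlDr sub0r.
      apply: slope_ge s t0 _ => x /andP[x0 xt].
      have xr : 0 <= x <= r1 by apply/andP; split; lra.
      rewrite (source (trm _ xr)); have /andP[mu _] := range (trm _ xr).
      have /andP[_ uM] := range1 _ xr.
      have u0' : 0 <= u x by have := m1; lra.
      apply: le_trans (nonlin_quartic_upper a0 th0 b0 _ _) _.
        by have := thm'; lra.
        by have := bm; lra.
      by rewrite ler_pM2l ?mulr_gt0 // lerXn2r ?nnegrE.
  rewrite expr0n /= mulr0 addr0 u0 ur1 => h.
  have -> : n / (2 * a * M ^+ 3) = n / (a * M ^+ 4) * (M / 2).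
    by field; rewrite !gt_eqF.
  have -> : r1 ^+ 2 = n / (a * M ^+ 4) * (a * M ^+ 4 / n * r1 ^+ 2).
    by field; rewrite !gt_eqF.
  have c0 : 0 < n / (a * M ^+ 4) by rewrite divr_gt0 // mulr_gt0 // exprn_gt0.
  by rewrite (ler_pM2l c0); move: h; move: (_ * r1 ^+ 2) => Z; lra.
pose lam := (a * M ^+ 4 / (32 * n)) ^+ 2 / 40.
have fn t : 0 <= t <= r1 -> f (u t) != 0.
  move=> tr; have /andP[mu _] := range (trm _ tr).
  by rewrite gt_eqF // nonlin_gt0 //; have := thm'; lra.
pose W t := P u p t - lam / N.+3%:R * t ^+ N.+3.
have : W 0 <= W r1.
  apply: (derivative_ge0_le (df := fun t =>
    t ^+ N * p t ^+ 2 * pweight a th b N (u t) - lam * t ^+ N.+2) r10).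
  - move=> t tr; have t0 : 0 <= t by case/andP: tr.
    by have c1 := pfun_continuous s t0 (fn _ tr); rewrite /W; cont.
  - move=> t /andP[t0 tr]; have tr' : 0 <= t <= r1 by rewrite !ltW.
    have d1 := pfun_derivative s t0 (source (trm _ tr')) (fn _ tr').
    have Nn : N.+3%:R != 0 :> R by rewrite pnatr_eq0.
    rewrite /W; deriv; rewrite /=.
    by move: (N.+3%:R : R) Nn => c c0; field.
  - move=> t /andP[t0 tr]; have tr' : 0 <= t <= r1 by rewrite !ltW.
    have /andP[mu _] := range (trm _ tr').
    have /andP[uM _] := range1 _ tr'.
    have K := pweight_lower a0 th0 b0 hN (u := u t)
      ltac:(have := m1; lra) ltac:(by rewrite gt_eqF //; have := thm'; lra).
    have h2 := nonlin_quartic_lower a0 th0 b0 (le_trans thm mu).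
    have h1 := slope_level (r := t) ltac:(by rewrite t0 (le_trans (ltW tr))).
    have h3 : a * M ^+ 4 / (32 * n) * t <= - p t.
      rewrite lerNr; apply: le_trans h1 _.
      rewrite lerN2 mulrAC invfM mulrA.
      rewrite ler_pM2r ?invr_gt0 // mulrAC ler_pM2r //; apply: le_trans h2.
      have -> : a * M ^+ 4 / 32 = a / 2 * (M / 2) ^+ 4 by field.
      by rewrite ler_pM2l ?divr_gt0 // lerXn2r ?nnegrE //; have := m1; lra.
    have h4 : (a * M ^+ 4 / (32 * n) * t) ^+ 2 <= p t ^+ 2.
      rewrite -[p t ^+ 2]sqrrN lerXn2r ?nnegrE //.
        by rewrite mulr_ge0 ?(ltW t0) // divr_ge0 ?mulr_ge0 ?exprn_ge0 // ltW.
      by apply: le_trans h3; rewrite mulr_ge0 ?(ltW t0) // divr_ge0 ?mulr_ge0 ?exprn_ge0 // ltW.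
    have -> : lam * t ^+ N.+2 = t ^+ N * ((a * M ^+ 4 / (32 * n) * t) ^+ 2 * (1 / 40)).
      by rewrite /lam !exprS; field; rewrite gt_eqF.
    rewrite subr_ge0 -[X in _ <= X]mulrA ler_wpM2l ?exprn_ge0 ?(ltW t0) //.
    by apply: ler_pM => //; rewrite sqr_ge0.
have -> : W 0 = 0.
  by rewrite /W /pfun p0 !expr0n /= !mul0r !mulr0 mul0r addr0 subr0.
by rewrite /W subr_ge0.
Qed.

(** Above [2 * th] the ratio [F / f] is nonnegative and the flux negative, so
    that the energy part dominates the functional. *)
Lemma functional_level r1 : 0 < r1 <= rm ->
  P u p r1 <= rm ^+ N.+1 * (p rm ^+ 2 / 2 + F m).
Proof.
move=> /andP[r10 r1m].
have fn t : 0 <= t <= rm -> f (u t) != 0.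
  move=> /above_le mu.
  by rewrite gt_eqF // nonlin_gt0 //; have := thm'; lra.
have : P u p r1 <= P u p rm.
  apply: (derivative_ge0_le (df := fun t =>
    t ^+ N * p t ^+ 2 * pweight a th b N (u t)) r1m).
  - move=> t /andP[t1 t2].
    by apply: (pfun_continuous s _ (fn _ _)); [lra|apply/andP; split; lra].
  - move=> t /andP[t1 t2]; have tr : 0 <= t <= rm by apply/andP; split; lra.
    by apply: (pfun_derivative s _ (source tr) (fn _ tr)); lra.
  - move=> t /andP[t1 t2]; have tr : 0 <= t <= rm by apply/andP; split; lra.
    have mu := above_le tr.
    have K := pweight_lower a0 th0 b0 hN (u := u t)
      ltac:(have := m1; lra) ltac:(by rewrite gt_eqF //; have := thm'; lra).
    apply: mulr_ge0; last lra.
    by apply: mulr_ge0; [rewrite exprn_ge0 //; lra|exact: sqr_ge0].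
move=> h; apply: le_trans h _; rewrite /pfun urm gerDl.
rewrite mulr_le0_ge0 //; last first.
  by rewrite divr_ge0 ?potential_ge0 // ltW // nonlin_gt0.
by rewrite mulr_ge0_le0 ?mulr_ge0 ?exprn_ge0 ?(ltW rm0) // ltW // level_falling // rm0 lexx.
Qed.

(** On [[rm, 2 * rm]] a larger slope would lose at most half of its flux to
    the negative part of the nonlinearity and then carry [u] from [m] below
    zero.  The powers of [2] in the constants come from [t <= 2 * rm] and
    [N <= 2]. *)
Lemma no_steep_fall :
  rm * - p rm <= 8 * m + 8 * (a * th ^+ 3 * (th + b)) * rm ^+ 2.
Proof.
rewrite leNgt; apply/negP => steep; have [cu _ _ du _] := s.
have rmp := rm0.
set B := a * th ^+ 3 * (th + b) in steep.
have B0 : 0 <= B by rewrite /B !mulr_ge0 ?exprn_ge0 ?addr_ge0 // ltW.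
pose w := - p rm; rewrite -/w in steep.
have w0 : 0 < w by rewrite oppr_gt0 level_falling // rm0 lexx.
have wB : 8 * B * rm < w.
  rewrite -(ltr_pM2l rm0); apply: le_lt_trans steep.
  have -> : rm * (8 * B * rm) = 8 * B * rm ^+ 2 by ring.
  by rewrite lerDr; have := m1; lra.
have pow t : rm <= t <= 2 * rm -> t ^+ N <= 4 * rm ^+ N.
  move=> /andP[t1 t2]; apply: (@le_trans _ _ ((2 * rm) ^+ N)).
    by rewrite lerXn2r ?nnegrE //; lra.
  rewrite exprMn_comm; last exact: mulrC.
  rewrite ler_pM2r ?exprn_gt0 //; case: hN => ->; rewrite ?expr1 ?expr2; lra.
have slope t : rm < t < 2 * rm -> p t <= - (w / 8).
  move=> /andP[t1 t2]; have t0 : 0 < t by lra.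
  have h : t ^+ N * p t - 4 * rm ^+ N * B * t <= rm ^+ N * p rm - 4 * rm ^+ N * B * rm.
    apply: (derivative_le0_ge (f := fun t => t ^+ N * p t - 4 * rm ^+ N * B * t)
      (df := fun t => - (t ^+ N * truncated M (u t)) - 4 * rm ^+ N * B) (ltW t1)).
    - move=> x /andP[x1 _]; have c1 := flux_continuous s (r := x) ltac:(lra).
      by cont.
    - move=> x /andP[x1 _]; have d1 := flux_derivative s (r := x) ltac:(lra).
      by deriv; rewrite /=; ring.
    - move=> x /andP[x1 x2]; have fl := truncated_lower (u x) M0.
      rewrite -/B in fl; have px := pow x ltac:(apply/andP; split; lra).
      have x0 : 0 <= x ^+ N by rewrite exprn_ge0 //; lra.
      have h1 : x ^+ N * - truncated M (u x) <= x ^+ N * B.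
        by rewrite ler_wpM2l // lerNl.
      have h2 := ler_wpM2r B0 px.
      by move: h1; rewrite mulrN; lra.
  have h1 : 4 * rm ^+ N * B * (t - rm) <= rm ^+ N * (w / 2).
    apply: (@le_trans _ _ (4 * rm ^+ N * B * rm)).
      apply: ler_wpM2l; last lra.
      by rewrite mulr_ge0 // mulr_ge0 // exprn_ge0 // ltW.
    have -> : 4 * rm ^+ N * B * rm = rm ^+ N * (4 * B * rm) by ring.
    by rewrite ler_pM2l ?exprn_gt0 //; lra.
  have h2 := pow t ltac:(apply/andP; split; lra).
  rewrite -(ler_pM2l (exprn_gt0 N t0)).
  have h3 : t ^+ N * (w / 8) <= 4 * rm ^+ N * (w / 8).
    by apply: ler_wpM2r => //; lra.
  have h4 : rm ^+ N * p rm = - (rm ^+ N * w) by rewrite /w mulrN opprK.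
  rewrite mulrN; move: h h1 h3 h4; rewrite mulrBr mulrA.
  move: (4 * rm ^+ N * B * t) (4 * rm ^+ N * B * rm) (t ^+ N * p t) => x y z.
  by rewrite !mulrA; lra.
have : u (2 * rm) + w / 8 * (2 * rm) <= u rm + w / 8 * rm.
  apply: (derivative_le0_ge (f := fun t => u t + w / 8 * t)
    (df := fun t => p t + w / 8)); first lra.
  - by move=> t /andP[t1 _]; have c1 := cu t ltac:(lra); cont.
  - by move=> t /andP[t1 _]; have d1 := du t ltac:(lra); deriv; rewrite /=; ring.
  - by move=> t /slope; lra.
have := nonneg (r := 2 * rm) ltac:(lra).
have : 0 <= 8 * B * rm ^+ 2 by rewrite mulr_ge0 ?sqr_ge0 // mulr_ge0.
by rewrite urm; move: steep; lra.
Qed.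

End Crossing.

(** While [u] lies above the fixed level [m], the functional grows like a power
    of the initial height [M], while the time [rm] at which the level is
    reached stays bounded.  Hence the slope at [rm] is large, and the bounded
    negative part of the nonlinearity cannot stop the fall. *)
Lemma crossing : exists2 M, th < M & forall u p,
  radial_sol N (truncated M) u p -> u 0 = M -> exists2 r, 0 <= r & u r < 0.
Proof.
pose m := 2 * th + b + 1.
have m1 : 1 <= m by rewrite /m; plra.
pose n : R := N.+1%:R.
have n0 : 0 < n by rewrite ltr0n.
pose C := 4 * n / (3 * a).
have C0 : 0 < C by rewrite divr_gt0 // mulr_gt0.
pose X := 8 * m + 8 * (a * th ^+ 3 * (th + b)) * C.
have B0 : 0 <= a * th ^+ 3 * (th + b).
  by rewrite mulr_ge0 ?mulr_ge0 ?exprn_ge0 ?addr_ge0 // ltW.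
have X0 : 0 <= X.
  have : 0 <= 8 * (a * th ^+ 3 * (th + b)) * C.
    by apply: mulr_ge0; [rewrite mulr_ge0|exact: ltW].
  by rewrite /X; lra.
have Fm : 0 <= F m by apply: potential_ge0 => //; rewrite /m; plra.
pose Z := (1 + C) ^+ N.-1 * X ^+ 2 / 2 + (1 + C) ^+ N.+1 * F m.
have C1 : 0 <= 1 + C by lra.
have Z0 : 0 <= Z.
  apply: addr_ge0; last by rewrite mulr_ge0 // exprn_ge0.
  by rewrite divr_ge0 // mulr_ge0 ?sqr_ge0 // exprn_ge0.
pose K := ((a / (32 * n)) ^+ 2 / 40 / N.+3%:R) ^+ 2 * (n / (2 * a)) ^+ N.+3.
have K0 : 0 < K.
  have k1 : 0 < (a / (32 * n)) ^+ 2 / 40 / N.+3%:R.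
    by do 2![apply: divr_gt0 => //]; rewrite exprn_gt0 // divr_gt0 // mulr_gt0.
  have k2 : 0 < n / (2 * a) by rewrite divr_gt0 // mulr_gt0.
  by apply: mulr_gt0; exact: exprn_gt0.
pose M := 2 * m + (Z ^+ 2 + 1) / K.
have Mm : 2 * m <= M by rewrite lerDl divr_ge0 ?addr_ge0 ?sqr_ge0 // ltW.
have M1 : 1 <= M by lra.
exists M; first by move: Mm m1; rewrite /m; plra.
move=> u p s u0; apply: contrapT => no.
have nonneg r : 0 <= r -> 0 <= u r.
  by move=> r0; rewrite leNgt; apply/negP => h; apply: no; exists r.
have [rm rm0 [urm above]] := reaches_level Mm s u0 nonneg.
have time := level_time Mm s u0 rm0 urm above.
have steep := no_steep_fall Mm s nonneg rm0 urm above.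
have [r1 [r1m r1M grow]] := functional_growth Mm s u0 rm0 urm above.
have lev := functional_level Mm s u0 rm0 urm above r1m.
have [r10 _] := andP r1m.
rewrite -/C in time.
have rmC : rm <= 1 + C.
  by rewrite leNgt; apply/negP => h; nra.
have y0 : 0 <= rm * - p rm.
  have rmm : 0 < rm <= rm by rewrite rm0 lexx.
  have pneg := level_falling Mm s urm above rmm.
  by rewrite mulr_ge0 ?(ltW rm0) // oppr_ge0 ltW.
have yX : rm * - p rm <= X.
  by apply: le_trans steep _; rewrite /X lerD2l ler_wpM2l // mulr_ge0.
have PZ : P u p r1 <= Z.
  apply: le_trans lev _; rewrite mulrDr; apply: lerD; last first.
    by apply: ler_wpM2r => //; rewrite lerXn2r ?nnegrE // ltW.
  have -> : rm ^+ N.+1 * (p rm ^+ 2 / 2) = rm ^+ N.-1 * (rm * - p rm) ^+ 2 / 2.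
    by case: hN => ->; rewrite /= ?expr0 ?expr1; ring.
  apply: ler_wpM2r => //; apply: ler_pM.
  - by rewrite exprn_ge0 // ltW.
  - exact: sqr_ge0.
  - by rewrite lerXn2r ?nnegrE // ltW.
  - by rewrite lerXn2r ?nnegrE.
pose k := (a / (32 * n)) ^+ 2 / 40 / N.+3%:R.
have kE : (a * M ^+ 4 / (32 * n)) ^+ 2 / 40 / N.+3%:R = k * M ^+ 8.
  have Nn : N.+3%:R != 0 :> R by rewrite pnatr_eq0.
  by rewrite /k; move: (N.+3%:R : R) Nn => c c0; field; rewrite c0 gt_eqF.
have k0 : 0 < k.
  by do 2![apply: divr_gt0 => //]; rewrite exprn_gt0 // divr_gt0 // mulr_gt0.
have M0 : 0 < M by lra.
have sq : (k * M ^+ 8) ^+ 2 * (r1 ^+ 2) ^+ N.+3 <= Z ^+ 2.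
  have -> : (k * M ^+ 8) ^+ 2 * (r1 ^+ 2) ^+ N.+3 = (k * M ^+ 8 * r1 ^+ N.+3) ^+ 2.
    by rewrite exprAC; ring.
  have h0 : 0 <= k * M ^+ 8 * r1 ^+ N.+3.
    apply: mulr_ge0; last by rewrite exprn_ge0 // ltW.
    by rewrite mulr_ge0 ?exprn_ge0 // ltW.
  rewrite lerXn2r ?nnegrE //; apply: le_trans PZ.
  by rewrite -kE.
have low : (n / (2 * a * M ^+ 3)) ^+ N.+3 <= (r1 ^+ 2) ^+ N.+3.
  rewrite lerXn2r ?nnegrE ?sqr_ge0 // divr_ge0 ?(ltW n0) //.
  by rewrite mulr_ge0 ?exprn_ge0 ?mulr_ge0 // ltW.
(* Subcriticality of the power [4] in dimension at most [3]:
   [8 * 2 - 3 * N.+3 >= 1]. *)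
have KM : K * M <= Z ^+ 2.
  apply: le_trans sq; apply: (@le_trans _ _
    ((k * M ^+ 8) ^+ 2 * (n / (2 * a * M ^+ 3)) ^+ N.+3)); last first.
    by rewrite ler_wpM2l ?sqr_ge0.
  have -> : (k * M ^+ 8) ^+ 2 * (n / (2 * a * M ^+ 3)) ^+ N.+3
      = K * (M ^+ 16 / (M ^+ 3) ^+ N.+3).
    have -> : n / (2 * a * M ^+ 3) = n / (2 * a) / M ^+ 3.
      by field; rewrite !gt_eqF.
    rewrite /K -/k expr_div_n.
    by move: (_ ^+ N.+3) (_ ^+ N.+3)^-1 => x y; ring.
  rewrite ler_pM2l // ler_pdivlMr ?exprn_gt0 // -exprM -exprS.
  by rewrite ler_weXn2l //; case: hN => ->.
have : K * M = K * (2 * m) + (Z ^+ 2 + 1) by rewrite /M; field; rewrite gt_eqF.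
have : 0 <= K * (2 * m) by rewrite mulr_ge0 ?(ltW K0) //; lra.
by lra.
Qed.

End Existence.

(** * Shooting *)

Section Shooting.
Context {R : realType}.
Variable N : nat.
Variables a th b : R.
Hypotheses (a0 : 0 < a) (th0 : 0 < th) (b0 : 0 < b).
Hypothesis hN : N = 1%N \/ N = 2%N.
Implicit Types (u p : R -> R) (r t x y e M alpha beta : R).

Local Notation f := (nonlin a th b).
Local Notation F := (potential a th b).
Local Notation truncated := (truncated a th b).
Local Notation ground := (ground_state N a th b).

(** Let [l > 0] be the limit of [u].  If [F l < 0], nonnegativity of the energy
    keeps the slope away from zero.  If [F l >= 0], then [f l > 0], and the
    equation does so.  Either way [u] would leave the positive half-line. *)
Lemma limit_zero u p : radial_sol N f u p -> (forall r, 0 <= r -> 0 < u r) ->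
  (forall r, 0 <= r -> 0 <= p r ^+ 2 / 2 + F (u r)) ->
  (forall r, 0 < r -> p r < 0) -> vanishing u.
Proof.
move=> s up E0 pneg; have [cu cp p0 du dp] := s.
have dec x y : 0 <= x -> x <= y -> u y <= u x.
  move=> x0 xy; apply: (derivative_le0_ge xy (df := p)) => t /andP[xt ty].
  - by apply: cu; lra.
  - by apply: du; lra.
  - by apply/ltW/pneg; lra.
pose S := [set u r | r in [set r | 0 <= r]].
have hS : has_inf S.
  split; first by exists (u 0); exists 0 => /=.
  by exists 0 => _ [r /= r0 <-]; apply/ltW/up.
set l := inf S.
have lu r : 0 <= r -> l <= u r.
  by move=> r0; apply: inf_lbound; [case: hS|exists r].
have close e : 0 < e -> exists2 r0, 0 < r0 & forall r, r0 <= r -> u r < l + e.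
  move=> e0; have [_ [r /= r0 <-] ur] := inf_adherent e0 hS.
  exists (r + 1); first lra.
  by move=> t rt; apply: le_lt_trans ur; apply: dec; lra.
have l0 : 0 <= l.
  apply: lb_le_inf; first by case: hS.
  by move=> _ [r /= r0 <-]; apply/ltW/up.
have nescape r0 eta : 0 <= r0 -> 0 < eta -> ~ (forall r, r0 < r -> p r <= - eta).
  move=> r00 eta0 H; have [r rp ur] := escape s r00 eta0 H.
  by have := up r rp; lra.
have [l00|lpos] := eqVneq l 0.
  move=> e e0; have [r0 r00 H] := close e e0; exists r0 => // r rr.
  rewrite gtr0_norm ?up //; last lra.
  by have := H r rr; rewrite l00 add0r.
have lp : 0 < l by rewrite lt_neqAle eq_sym lpos.
exfalso.
have [Fl|Fl] := leP 0 (F l).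
  have fl : 0 < f l by apply/nonlin_gt0/(th_lt_of_potential a0 th0 b0).
  have [d d0 Hd] := near_gt (nonlin_continuous a th b l) (c := f l / 2) ltac:(lra).
  have [r0 r00 H] := close d d0.
  have fu t : r0 <= t -> f l / 2 < f (u t).
    move=> rt; apply: Hd; have := lu t ltac:(lra); have := H t rt.
    by move=> h1 h2; rewrite ger0_norm; lra.
  have Nn : N.+1%:R != 0 :> R by rewrite pnatr_eq0.
  apply: (nescape (2 * r0) (f l / 2 * r0 / N.+1%:R)).
  - lra.
  - by rewrite divr_gt0 // mulr_gt0 //; lra.
  move=> r rr; pose c := f l / 2.
  have c0 : 0 < c by rewrite /c; lra.
  pose W t := t ^+ N * p t + c / N.+1%:R * t ^+ N.+1.
  have : W r <= W r0.
    apply: (derivative_le0_ge (df := fun t => t ^+ N * (c - f (u t)))).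
    - lra.
    - move=> t /andP[t0 _]; have c1 := flux_continuous s (r := t) ltac:(lra).
      by rewrite /W; cont.
    - move=> t /andP[t0 _]; have d1 := flux_derivative s (r := t) ltac:(lra).
      by rewrite /W; deriv; rewrite /=; field.
    - move=> t /andP[t0 tr]; rewrite mulr_ge0_le0 ?exprn_ge0 //; first lra.
      by rewrite subr_le0 /c ltW // fu // ltW.
  have rp : 0 < r by lra.
  have cN : 0 < c / N.+1%:R by rewrite divr_gt0.
  have pr0 : r0 ^+ N * p r0 < 0 by rewrite pmulr_rlt0 ?pneg ?exprn_gt0.
  have pow : r ^+ N * r0 <= r ^+ N.+1 - r0 ^+ N.+1.
    have h : r0 ^+ N <= r ^+ N by rewrite lerXn2r ?nnegrE //; lra.
    have h1 : r0 * r0 ^+ N <= r0 * r ^+ N by rewrite ler_pM2l.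
    have h2 : 0 <= r ^+ N * (r - 2 * r0) by rewrite mulr_ge0 ?exprn_ge0 //; lra.
    by move: h1 h2; rewrite !exprS mulrBr; move: (r ^+ N) (r0 ^+ N) => y z; lra.
  rewrite /W => WW; rewrite -(ler_pM2l (exprn_gt0 N rp)).
  have h : c / N.+1%:R * (r ^+ N * r0) <=
      c / N.+1%:R * (r ^+ N.+1 - r0 ^+ N.+1) by rewrite ler_pM2l.
  have -> : r ^+ N * - (f l / 2 * r0 / N.+1%:R) = - (c / N.+1%:R * (r ^+ N * r0)).
    by rewrite /c; field.
  rewrite mulrBr in h; move: WW h pr0.
  move: (c / N.+1%:R * r ^+ N.+1) (c / N.+1%:R * r0 ^+ N.+1) => y z.
  by move: (c / N.+1%:R * (r ^+ N * r0)) (r ^+ N * p r) (r0 ^+ N * p r0) => A B C; lra.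
have [d d0 Hd] := near_lt (potential_continuous a th b l) (c := F l / 2) ltac:(lra).
have [r0 r00 H] := close d d0.
pose eta := Num.min 1 (- F l / 2).
have eta0 : 0 < eta by rewrite lt_min ltr01 /=; lra.
have eta1 : eta <= 1 by rewrite ge_min lexx.
have eta2 : eta <= - F l / 2 by rewrite ge_min lexx orbT.
apply: (nescape r0 eta) => //; first exact: ltW.
move=> r rr; rewrite leNgt; apply/negP => pr.
have r0' : 0 <= r by lra.
have Fu : F (u r) < F l / 2.
  apply: Hd; have := lu r r0'; have := H r (ltW rr).
  by move=> h1 h2; rewrite ger0_norm; lra.
have := E0 r r0'; have pn := pneg r ltac:(lra).
have : p r ^+ 2 <= eta * 1.
  by rewrite -[p r ^+ 2]sqrrN expr2; apply: ler_pM; lra.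
lra.
Qed.

Section Family.
Variables (M : R) (U V : R -> R -> R) (G : R -> R).
Hypothesis M0 : 0 < M.
Hypothesis sol : forall alpha, radial_sol N (truncated M) (U alpha) (V alpha).
Hypothesis U0 : forall alpha, U alpha 0 = alpha.
Hypothesis G0 : G 0 = 0.
Hypothesis dG : forall x, -1 < x -> is_derive x 1 G (truncated M x).
Hypothesis GF : forall x, 0 <= x <= M -> G x = F x.

Let E alpha r := V alpha r ^+ 2 / 2 + G (U alpha r).

Let depends : exists2 K, 0 <= K & forall alpha beta r t, 0 <= t <= r ->
  `|U alpha t - U beta t| <= `|alpha - beta| * expR (K * r) /\
  `|V alpha t - V beta t| <= `|alpha - beta| * expR (K * r).
Proof.
have [L [B [L0 lip _]]] := truncated_regular a0 th0 b0 (ltW M0).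
exists (L + 1); first by rewrite addr_ge0.
move=> alpha beta r t /andP[t0 tr].
have := gronwall_forward (sol alpha) (sol beta) L0 (fun x _ => lip _ _)
  (rho := r) (r := t) ltac:(by rewrite t0).
have [_ _ p0 _ _] := sol alpha; have [_ _ q0 _ _] := sol beta.
rewrite !U0 p0 q0 subrr expr0n /= addr0 => H.
have bound : (alpha - beta) ^+ 2 * expR ((L + 1) * t) <=
    (`|alpha - beta| * expR ((L + 1) * r)) ^+ 2.
  rewrite exprMn real_normK ?num_real // ler_wpM2l ?sqr_ge0 //.
  rewrite -expRM_natl ler_expR.
  have : (L + 1) * t <= (L + 1) * r by rewrite ler_wpM2l // addr_ge0.
  by have : 0 <= (L + 1) * r; [rewrite mulr_ge0 ?addr_ge0 //; lra|lra].
have le_of_sq (x y : R) : 0 <= y -> x ^+ 2 <= y ^+ 2 -> `|x| <= y.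
  move=> y0; rewrite -[x ^+ 2]real_normK ?num_real //.
  by rewrite ler_pXn2r ?nnegrE.
have pos : 0 <= `|alpha - beta| * expR ((L + 1) * r) by rewrite mulr_ge0 ?expR_ge0.
by split; apply: le_of_sq => //; apply: le_trans bound; apply: le_trans H;
  rewrite ?lerDl ?lerDr sqr_ge0.
Qed.

Let cdep (W : R -> R -> R) r alpha : (forall beta, exists2 c, 0 < c &
    forall alpha, `|W alpha r - W beta r| <= `|alpha - beta| * c) ->
  continuous_at (fun alpha => W alpha r) alpha.
Proof.
move=> /(_ alpha)[c c0 H]; apply/continuous_atP/cvgrPdist_lt => e e0.
apply/nbhs_ballP; exists (e / c); first by rewrite /= divr_gt0.
move=> beta; rewrite /ball /= ltr_pdivlMr // => h.
rewrite distrC; apply: le_lt_trans (H beta) _.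
by rewrite distrC.
Qed.

Let cU r alpha : 0 <= r -> continuous_at (fun alpha => U alpha r) alpha.
Proof.
move=> r0; have [K K0 H] := depends; apply: cdep => beta.
exists (expR (K * r)); first exact: expR_gt0.
by move=> x; have [] := H x beta r r ltac:(by rewrite r0 lexx).
Qed.

Let cV r alpha : 0 <= r -> continuous_at (fun alpha => V alpha r) alpha.
Proof.
move=> r0; have [K K0 H] := depends; apply: cdep => beta.
exists (expR (K * r)); first exact: expR_gt0.
by move=> x; have [] := H x beta r r ltac:(by rewrite r0 lexx).
Qed.

Let crosses alpha := exists2 r, 0 <= r & U alpha r < 0.
Let trapped alpha := exists2 r, 0 <= r &
  E alpha r < 0 /\ forall t, 0 <= t <= r -> 0 < U alpha t.

Let crosses_open alpha : crosses alpha ->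
  exists2 d, 0 < d & forall beta, `|beta - alpha| < d -> crosses beta.
Proof.
move=> [r r0 Ur]; have [d d0 H] := near_lt (cU alpha r0) Ur.
by exists d => // beta /H; exists r.
Qed.

Let trapped_open alpha : trapped alpha ->
  exists2 d, 0 < d & forall beta, `|beta - alpha| < d -> trapped beta.
Proof.
move=> [r r0 [Er Up]].
have Ur : 0 < U alpha r by apply: Up; rewrite r0 lexx.
have cE : continuous_at (fun alpha => E alpha r) alpha.
  have c1 := cU alpha r0; have c2 := cV alpha r0.
  have c3 := continuous_at_comp c1
    (derivative_continuous (dG (x := U alpha r) ltac:(lra))).
  by rewrite /E; cont.
have [d d0 Hd] := near_lt cE Er.
have [cUr _ _ _ _] := sol alpha.
have [c cr Hc] : exists2 c, 0 <= c <= r &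
    forall t, 0 <= t <= r -> U alpha c <= U alpha t.
  have [|c] := @EVT_min R (U alpha) 0 r r0.
    apply: continuous_in_subspaceT => x; rewrite inE /= in_itv /= => /andP[x0 _].
    by case: (cUr x x0).
  by rewrite in_itv /= => cr H; exists c.
have [K K0 H] := depends.
pose X := expR (K * r); have X0 : 0 < X by exact: expR_gt0.
have Uc := Up c cr.
exists (Num.min d (U alpha c / X)); first by rewrite lt_min d0 divr_gt0.
move=> beta; rewrite lt_min => /andP[h1]; rewrite ltr_pdivlMr // => h2.
exists r => //; split; first exact: Hd.
move=> t tr; have [h3 _] := H alpha beta r t tr.
have := Hc t tr; have := ler_norm (U alpha t - U beta t).
by rewrite distrC -/X in h3; move: h3 h2; rewrite distrC [`|alpha - _|]distrC; lra.
Qed.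

(** At a zero of the solution its energy is nonnegative, and energy is never
    regained. *)
Let disjoint alpha : trapped alpha -> crosses alpha -> False.
Proof.
move=> [r r0 [Er Up]] [x x0 Ux].
have rx : r < x.
  by rewrite ltNge; apply/negP => xr; have := Up x; rewrite x0 xr => /(_ isT); lra.
have [cUr _ _ _ _] := sol alpha.
have [c [/andP[rc _] Uc Hc]] : exists c, [/\ r < c <= x, - U alpha c = 0 &
    forall t, r <= t < c -> - U alpha t < 0].
  apply: (first_zero (f := fun t => - U alpha t)).
  - exact: ltW.
  - by move=> t /andP[t0 _]; apply/continuous_atN/cUr; lra.
  - by rewrite oppr_lt0 Up // r0 lexx.
  - by rewrite oppr_ge0 ltW.
have : E alpha c <= E alpha r.
  apply: (energy_le (sol alpha)); first by rewrite r0 ltW.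
  move=> t /andP[rt]; rewrite le_eqVlt => /orP[/eqP ->|tc]; apply: dG; first lra.
  by have := Hc t ltac:(by rewrite rt); lra.
have Uc0 : U alpha c = 0 by lra.
have := sqr_ge0 (V alpha c); move: Er.
by rewrite /E Uc0 G0; lra.
Qed.

(** The threshold between falling into the potential well and crossing zero
    belongs to neither set, both being open. *)
Let threshold alpha0 : 0 < alpha0 <= M -> trapped alpha0 -> crosses M ->
  exists alpha, [/\ 0 < alpha <= M, ~ trapped alpha & ~ crosses alpha].
Proof.
move=> /andP[p0 pM] trap cross.
pose S := [set alpha | alpha <= M /\ trapped alpha].
have hS : has_sup S.
  by split; [exists alpha0|exists M => x []].
have up x : S x -> x <= sup S by apply: sup_upper_bound.
have a0S : alpha0 <= sup S by apply: up.
have SM : sup S <= M by apply: ge_sup; [case: hS|move=> x []].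
exists (sup S); split.
- by rewrite SM andbT; lra.
- move=> trapS; have [d d0 H] := trapped_open trapS.
  have SltM : sup S < M.
    rewrite lt_neqAle SM andbT; apply/eqP => SE.
    by apply: disjoint cross; rewrite -SE.
  pose x := Num.min (sup S + d / 2) M.
  have Sx : sup S < x by rewrite lt_min SltM andbT; lra.
  have xd : x <= sup S + d / 2 by rewrite ge_min lexx.
  have : x <= sup S.
    apply: up; split; first by rewrite ge_min lexx orbT.
    by apply: H; rewrite gtr0_norm; lra.
  by rewrite leNgt Sx.
- move=> crossS; have [d d0 H] := crosses_open crossS.
  have [x [xM xtrap] xd] := sup_adherent d0 hS.
  apply: (disjoint xtrap); apply: H.
  by have xs := up x (conj xM xtrap); rewrite ler0_norm; lra.
Qed.

(** A solution that touches zero without crossing it would have zero data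
    there, hence vanish identically. *)
Let threshold_ground alpha : th < M -> 0 < alpha <= M ->
  ~ trapped alpha -> ~ crosses alpha ->
  ground (U alpha) (V alpha).
Proof.
move=> thM /andP[alpha0 alphaM] ntrap ncross.
set u := U alpha; set p := V alpha.
have s : radial_sol N (truncated M) u p := sol alpha.
have [cu cp p0 du dp] := s.
have u0 : u 0 = alpha := U0 alpha.
have nonneg r : 0 <= r -> 0 <= u r.
  by move=> r0; rewrite leNgt; apply/negP => h; apply: ncross; exists r.
have pos r : 0 <= r -> 0 < u r.
  move=> r0; rewrite ltNge; apply/negP => ur.
  have [c [/andP[c0 _] uc Hc]] : exists c, [/\ 0 < c <= r, - u c = 0 &
      forall t, 0 <= t < c -> - u t < 0].
    apply: (first_zero (f := fun t => - u t)) => //.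
    - by move=> t /andP[t0 _]; apply/continuous_atN/cu.
    - by rewrite u0 oppr_lt0.
    - by rewrite oppr_ge0.
  have pc := derivative_first_zero c0 uc Hc (derivativeN (du _ c0)).
  have pc0 : p c = 0.
    apply/eqP; rewrite eq_le -oppr_ge0 pc /= leNgt; apply/negP => h.
    have [d d0 Hd] := derivative_gt0_right (f := fun t => - u t) uc
      (ltac:(by rewrite oppr_gt0) : 0 < - p c) (derivativeN (du _ c0)).
    have := Hd (c + d / 2) ltac:(apply/andP; split; lra).
    by have := nonneg (c + d / 2) ltac:(lra); lra.
  have sz : radial_sol N (truncated M) (fun=> 0) (fun=> 0).
    split => //= t _; do ?exact: continuous_at_cst.
      exact: derivative_cst.
    apply: (derivative_eq (derivative_cst _ _)).
    by rewrite truncated_id ?lexx ?(ltW M0) // nonlin0 mulr0 mul0r subr0 oppr0.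
  have [L [B [L0 lip _]]] := truncated_regular a0 th0 b0 (ltW M0).
  have : u 0 = 0.
    apply: (gronwall_backward s sz L0 (fun x _ => lip _ _) c0) => //; lra.
  by rewrite u0; lra.
have Epos r : 0 <= r -> 0 <= p r ^+ 2 / 2 + G (u r).
  move=> r0; rewrite leNgt; apply/negP => h; apply: ntrap; exists r => //.
  by split=> // t /andP[t0 _]; exact: pos.
have pneg : forall r, 0 < r -> p r < 0.
  apply: (slope_lt0 s pos Epos).
    exact: truncated_continuous a0 th0 b0 _ _ (ltW M0).
  move=> v v0 Gv; apply: truncated_gt0 => //.
  have [vM|Mv] := leP v M; last exact: lt_trans Mv.
  apply: (th_lt_of_potential a0 th0 b0 v0); rewrite -GF // vM andbT; exact: ltW.
have uM r : 0 <= r -> 0 <= u r <= M.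
  move=> r0; rewrite nonneg //=; apply: le_trans alphaM; rewrite -u0.
  apply: (derivative_le0_ge r0 (df := p)) => t /andP[t0 _].
  - exact: cu.
  - exact: du.
  - exact/ltW/pneg.
have sf : radial_sol N f u p.
  split => // r r0; apply: (derivative_eq (dp _ r0)).
  by rewrite truncated_id // uM // ltW.
split => //; apply: (limit_zero sf pos _ pneg).
by move=> r r0; rewrite -GF ?uM //; exact: Epos.
Qed.

Lemma family_ground_state : th < M -> crosses M -> exists u p, ground u p.
Proof.
move=> thM cross.
have trap : trapped th.
  exists 0; rewrite ?lexx //; split; last first.
    by move=> t /andP[t1 t2]; rewrite (@le_anti _ _ t 0) ?t1 ?t2 // U0.
  have [_ _ p0 _ _] := sol th.
  rewrite /E p0 U0 expr0n /= mul0r add0r GF ?(ltW thM) ?(ltW th0) //.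
  by apply: potential_lt0 => //; rewrite th0 lexx.
have [|alpha [ar nt nc]] := threshold _ trap cross; first by rewrite th0 ltW.
by exists (U alpha), (V alpha); exact: threshold_ground.
Qed.

End Family.

Theorem ground_state_exists : exists u p, ground u p.
Proof.
have [M thM cross] := crossing a0 th0 b0 hN.
have M0 : 0 < M by exact: lt_trans thM.
have [L [B [L0 lip bnd]]] := truncated_regular a0 th0 b0 (ltW M0).
have [G [G0 dG GF]] := truncated_potential a0 th0 b0 (ltW M0).
have /choice[U HU] alpha : exists u, u 0 = alpha /\
    exists p, radial_sol N (truncated M) u p.
  by have [u u0 Hu] := radial_sol_exists N alpha L0 lip bnd; exists u.
have /choice[V HV] alpha : exists p, radial_sol N (truncated M) (U alpha) p.
  by have [_] := HU alpha.
have U0 alpha : U alpha 0 = alpha by have [] := HU alpha.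
apply: (family_ground_state M0 HV U0 G0 dG GF thM).
exact: cross (HV M) (U0 M).
Qed.

End Shooting.

(** * Radial functions of several variables *)

Lemma continuous_mul_bounded (R : realType) (T : topologicalType)
    (g c : T -> R) (x : T) : {for x, continuous g} -> g x = 0 ->
  (forall y, `|c y| <= 1) -> {for x, continuous (fun y => g y * c y)}.
Proof.
move=> cg g0 c1; apply/cvgrPdist_lt => e e0.
move: cg => /cvgrPdist_lt /(_ e e0); apply: filterS => y.
rewrite g0 mul0r !sub0r !normrN => h; rewrite normrM; apply: le_lt_trans h.
by rewrite -[X in _ <= X]mulr1 ler_wpM2l.
Qed.

Section RadialFunctions.
Context {R : realType}.
Variable N : nat.
Implicit Types (x y : 'rV[R]_N.+1) (i j : 'I_N.+1) (r s t : R).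

Local Notation basis i := (delta_mx ord0 i : 'rV[R]_N.+1).

Definition sqnorm x : R := \sum_(i < N.+1) x ord0 i ^+ 2.

Lemma sqnorm_ge0 x : 0 <= sqnorm x.
Proof. by apply: sumr_ge0 => i _; exact: sqr_ge0. Qed.

Lemma enorm_ge0 x : 0 <= enorm x.
Proof. exact: sqrtr_ge0. Qed.

Lemma enorm_sqr x : enorm x ^+ 2 = sqnorm x.
Proof. by rewrite /enorm sqr_sqrtr // sqnorm_ge0. Qed.

Lemma line_coord x i j s :
  (x + s *: basis i) ord0 j = x ord0 j + s * (j == i)%:R.
Proof. by rewrite !mxE eqxx. Qed.

Lemma sqnorm_line x i s :
  sqnorm (x + s *: basis i) = sqnorm x + 2 * s * x ord0 i + s ^+ 2.
Proof.
rewrite /sqnorm (bigD1 i) //= [in RHS](bigD1 i) //= line_coord eqxx mulr1.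
rewrite (eq_bigr (fun j => x ord0 j ^+ 2)).
  by rewrite sqrrD -[x ord0 i * s *+ 2]mulr_natr; ring.
by move=> j /negbTE ji; rewrite line_coord ji mulr0 addr0.
Qed.

Lemma enorm_axis i t : enorm (t *: basis i) = `|t|.
Proof.
rewrite -[t *: _]add0r /enorm -/(sqnorm _) sqnorm_line mxE mulr0 addr0.
rewrite /sqnorm big1 ?add0r ?sqrtr_sqr // => j _.
by rewrite mxE expr0n.
Qed.

Lemma enorm_eq0 x : enorm x = 0 -> x = 0.
Proof.
move=> e0; apply/rowP => i; rewrite mxE; apply/eqP; rewrite -sqrf_eq0.
have : sqnorm x == 0 by rewrite -enorm_sqr e0 expr0n.
by rewrite /sqnorm psumr_eq0 => [/allP/(_ i (mem_index_enum i))|j _]; rewrite ?sqr_ge0.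
Qed.

Lemma coord_le_enorm x i : `|x ord0 i| <= enorm x.
Proof.
rewrite -sqrtr_sqr /enorm ler_sqrt -/(sqnorm x) ?sqnorm_ge0 //.
by rewrite /sqnorm (bigD1 i) //= lerDl sumr_ge0 // => j _; exact: sqr_ge0.
Qed.

Lemma enorm_continuous : continuous (@enorm R N.+1).
Proof.
have cs : continuous sqnorm.
  apply: continuous_big => [|i _ y]; first exact: add_continuous.
  apply: (@continuous_comp _ _ _ (fun x : 'rV[R]_N.+1 => x ord0 i) (fun t => t ^+ 2)).
    exact: coord_continuous.
  exact: exprn_continuous.
move=> x; apply: (@continuous_comp _ _ _ sqnorm Num.sqrt); first exact: cs.
exact: sqrt_continuous.
Qed.

Lemma derivative_line (f : 'rV[R]_N.+1 -> R) x i t l :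
  is_derive (x + t *: basis i) (basis i) f l <->
  is_derive t 1 (fun s => f (x + s *: basis i)) l.
Proof.
have E : (fun h : R => h^-1 *: ((f \o shift (x + t *: basis i)) (h *: basis i)
        - f (x + t *: basis i))) =
    (fun h : R => h^-1 *: (((fun s => f (x + s *: basis i)) \o shift t)
       (h *: (1 : R)) - f (x + t *: basis i))).
  apply/funext => h /=; congr (_ *: (f _ - _)).
  by rewrite [h *: 1]mulr1 scalerDl addrCA.
split=> -[d D]; constructor.
- by rewrite /derivable -E.
- by rewrite /derive -E.
- by rewrite /derivable E.
- by rewrite /derive E.
Qed.


Section Profile.
Variable phi : 'rV[R]_N.+1 -> R.
Hypotheses (phiC2 : class_C 2 phi) (phi_radial : radial phi).

Let profile t := phi (t *: basis ord0).
Let slope t := pderive ord0 phi (t *: basis ord0).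

Lemma radial_profile x : phi x = profile (enorm x).
Proof. by apply: phi_radial; rewrite enorm_axis ger0_norm ?enorm_ge0. Qed.

Let d1 i x t : is_derive t 1 (fun s => phi (x + s *: basis i))
  (pderive i phi (x + t *: basis i)).
Proof.
apply/derivative_line; have [_ /(_ i)[dphi _]] := phiC2.
exact: DeriveDef.
Qed.

Let d2 i j x t : is_derive t 1 (fun s => pderive i phi (x + s *: basis j))
  (pderive j (pderive i phi) (x + t *: basis j)).
Proof.
apply/derivative_line; have [_ /(_ i)[_ [_ /(_ j)[dphi _]]]] := phiC2.
exact: DeriveDef.
Qed.

Let dprofile t : is_derive t 1 profile (slope t).
Proof.
have := d1 ord0 0 t; rewrite /profile /slope add0r.
by under [fun s => _]eq_fun do rewrite add0r.
Qed.

Let dslope t : is_derive t 1 slope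
  (pderive ord0 (pderive ord0 phi) (t *: basis ord0)).
Proof.
have := d2 ord0 ord0 0 t; rewrite /slope add0r.
by under [fun s => _]eq_fun do rewrite add0r.
Qed.

Let slope0 : slope 0 = 0.
Proof.
have even : (fun t => profile (- t)) = profile.
  by apply/funext => t; apply: phi_radial; rewrite !enorm_axis normrN.
have dm : is_derive (0 : R) 1 (fun t => profile (- t)) (slope (- 0) * - 1).
  exact: derivative_comp (derivativeN (derivative_id 0)) (dprofile _).
rewrite even oppr0 in dm; have := derivative_unique dm (dprofile 0); lra.
Qed.

(** Orthogonally to the radius, [phi] is the profile of
    [sqrt (r ^+ 2 + t ^+ 2)], whose second derivative at [t = 0] is
    [slope r / r]. *)
Let second_orthogonal i r : 0 < r -> i != ord0 ->
  pderive i (pderive i phi) (r *: basis ord0) = slope r / r.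
Proof.
move=> r0 i0; set x := r *: basis ord0.
pose rho t := Num.sqrt (r ^+ 2 + t ^+ 2).
have xE : sqnorm x = r ^+ 2 by rewrite -enorm_sqr enorm_axis real_normK ?num_real.
have xi : x ord0 i = 0 by rewrite !mxE eqxx (negbTE i0) mulr0.
have arg0 t : 0 < r ^+ 2 + t ^+ 2 by rewrite ltr_pwDl ?exprn_gt0 ?sqr_ge0.
have rho0 t : 0 < rho t by rewrite sqrtr_gt0.
have lineE : (fun t => phi (x + t *: basis i)) = (fun t => profile (rho t)).
  apply/funext => t; rewrite radial_profile; congr profile.
  by rewrite /enorm -/(sqnorm _) sqnorm_line xE xi mulr0 addr0.
have drho t : is_derive t 1 rho (t / rho t).
  have da : is_derive t 1 (fun t => r ^+ 2 + t ^+ 2) (2 * t).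
    by deriv; rewrite /=; ring.
  apply: (derivative_eq (derivative_comp da (is_derive1_sqrt (arg0 t)))).
  by rewrite -/(rho t); field; rewrite gt_eqF.
have firstE : (fun t => pderive i phi (x + t *: basis i)) =
    (fun t => slope (rho t) * (t / rho t)).
  apply/funext => t; apply: (derivative_unique (d1 i x t)).
  rewrite lineE; exact: derivative_comp (drho t) (dprofile (rho t)).
have := d2 i i x 0; rewrite scale0r addr0 firstE => second.
have rho00 : rho 0 = r.
  by rewrite /rho expr0n addr0 sqrtr_sqr gtr0_norm.
have dr := drho 0.
have ds := derivative_comp dr (dslope (rho 0)).
have dv := derivative_div (lt0r_neq0 (rho0 0)) (derivative_id 0) dr.
apply: (derivative_unique second).
apply: (derivative_eq (derivativeM ds dv)).
by rewrite rho00; field; rewrite gt_eqF.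
Qed.

Let laplacian_axis r : 0 < r -> laplacian phi (r *: basis ord0) =
  pderive ord0 (pderive ord0 phi) (r *: basis ord0) + N%:R * slope r / r.
Proof.
move=> r0; rewrite /laplacian big_ord_recl; congr (_ + _).
rewrite (eq_bigr (fun=> slope r / r)); last first.
  by move=> i _; apply: second_orthogonal.
by rewrite sumr_const card_ord -[LHS]mulr_natl mulrA.
Qed.

Lemma profile_ground_state a th b :
  (forall x, 0 < phi x) ->
  phi x @[x --> @enorm_pinfty R N.+1] --> (0 : R) ->
  (forall x, laplacian phi x + nonlin a th b (phi x) = 0) ->
  exists p, ground_state N a th b profile p.
Proof.
move=> phi0 phi_lim eqn; exists slope; split.
- split=> [r _|r _||r _|r r0].
  + exact: derivative_continuous (dprofile r).
  + exact: derivative_continuous (dslope r).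
  + exact: slope0.
  + exact: dprofile.
  + apply: (derivative_eq (dslope r)).
    have := eqn (r *: basis ord0); rewrite laplacian_axis // -/(profile r).
    by move: (nonlin _ _ _ _) (N%:R * _ / _) => y z; lra.
- by move=> r _; exact: phi0.
- move=> e e0; have /cvgrPdist_lt /(_ e e0) := phi_lim.
  move=> [M _ HM]; exists (Num.max M 0 + 1).
    by rewrite ltr_wpDl // le_max lexx orbT.
  move=> r rM; have := HM (r *: basis ord0).
  rewrite /= sub0r normrN; apply; rewrite enorm_axis.
  have h1 : M <= Num.max M 0 by rewrite le_max lexx.
  have h2 : 0 <= Num.max M 0 by rewrite le_max lexx orbT.
  by rewrite ger0_norm; lra.
Qed.

End Profile.

Section Construction.
Variables (a th b : R) (u p : R -> R).
Hypotheses (a0 : 0 < a) (th0 : 0 < th) (b0 : 0 < b).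
Hypothesis gs : ground_state N a th b u p.

Local Notation f := (nonlin a th b).
Let n : R := N.+1%:R.
Let phi x := u (enorm x).
(** [q] is the multiplier in [grad phi = q * x], continued to the origin, and
    [w r / r] is the derivative of [q]. *)
Let q0 := - (f (u 0) / n).
Let q r := if r == 0 then q0 else p `|r| / `|r|.
Let w r := - (n * q r) - f (u `|r|).

Let n0 : 0 < n. Proof. by rewrite ltr0n. Qed.

Let qE r : 0 < r -> q r = p r / r.
Proof. by move=> r0; rewrite /q gt_eqF // gtr0_norm. Qed.

Let s : radial_sol N f u p. Proof. by case: gs. Qed.

Let cfu r : 0 <= r -> continuous_at (fun t => f (u t)) r.
Proof.
move=> r0; have [cu _ _ _ _] := s.
exact: continuous_at_comp (cu r r0) (nonlin_continuous a th b _).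
Qed.

Let cq r : continuous_at q r.
Proof.
have [_ cp _ _ _] := s.
have [->|rn] := eqVneq r 0; last first.
  apply: (@continuous_at_near _ (fun t => p `|t| * (`|t|)^-1)).
    have [d d0 Hd] := near_gt (continuous_at_norm r) (c := 0)
      ltac:(by rewrite normr_gt0).
    apply/nbhs_ballP; exists d => // t; rewrite /ball /= distrC => /Hd.
    by rewrite normr_gt0 /q => /negbTE ->.
  apply: continuous_atM.
    by apply: continuous_at_comp (continuous_at_norm r) (cp _ _).
  by apply: continuous_atV (continuous_at_norm r); rewrite normr_eq0.
apply/continuous_atP/cvgrPdist_lt => e e0; apply/nbhs_ballP.
have [] := cfu (lexx 0) => /cvgrPdist_lt /(_ (n * (e / 2))).
case; first by rewrite mulr_gt0 // divr_gt0.
move=> d d0 Hd; exists d => // x; rewrite /ball /= sub0r normrN => xd.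
rewrite /q eqxx; have [_|xn] := eqVneq x 0; first by rewrite subrr normr0.
have x0 : 0 < `|x| by rewrite normr_gt0.
move: `|x| x0 xd => {}r r0 rd.
have bound t : 0 < t < r -> `|f (u 0) - f (u t)| < n * (e / 2).
  by move=> /andP[t0 tr]; apply: Hd; rewrite /= sub0r normrN gtr0_norm //; lra.
have h1 : p r <= - ((f (u 0) - n * (e / 2)) * r / n).
  apply: slope_le s r0 _ => t /bound; rewrite ltr_norml => /andP[h1 h2]; lra.
have h2 : - ((f (u 0) + n * (e / 2)) * r / n) <= p r.
  apply: slope_ge s r0 _ => t /bound; rewrite ltr_norml => /andP[h2 h3]; lra.
have e1 : - ((f (u 0) - n * (e / 2)) * r / n) = (q0 + e / 2) * r.
  by rewrite /q0; field; rewrite gt_eqF.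
have e2 : - ((f (u 0) + n * (e / 2)) * r / n) = (q0 - e / 2) * r.
  by rewrite /q0; field; rewrite gt_eqF.
rewrite e1 -ler_pdivrMr // in h1; rewrite e2 -ler_pdivlMr // in h2.
by rewrite ltr_norml; apply/andP; split; lra.
Qed.

Let cw r : continuous_at w r.
Proof.
have c1 := cq r.
have c2 := continuous_at_comp (continuous_at_norm r) (cfu (normr_ge0 r)).
by rewrite /w; cont.
Qed.

Let w0 : w 0 = 0.
Proof. by rewrite /w /q eqxx normr0 /q0; field; rewrite gt_eqF. Qed.

Let dq r : 0 < r -> is_derive r 1 q (w r / r).
Proof.
move=> r0; have [_ _ _ _ dp] := s.
have rn : r != 0 by rewrite gt_eqF.
apply: (derivative_near (f := fun t => p t / t)).
  near=> t; rewrite qE //; near: t; exact: lt_nbhsr.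
apply: (derivative_eq (derivative_div (g := fun t => t) rn (dp r r0) (derivative_id r))).
by rewrite /w qE // gtr0_norm // /n -natr1; field.
Unshelve. all: by end_near. Qed.

Let enorm_gt0 x : x != 0 -> 0 < enorm x.
Proof.
move=> x0; rewrite lt_neqAle enorm_ge0 andbT eq_sym.
by apply: contraNneq x0 => /enorm_eq0 ->.
Qed.

Let denorm x i : x != 0 ->
  is_derive (0 : R) 1 (fun s => enorm (x + s *: basis i)) (x ord0 i / enorm x).
Proof.
move=> x0.
have E : (fun s => enorm (x + s *: basis i)) =
    (fun s => Num.sqrt (sqnorm x + 2 * s * x ord0 i + s ^+ 2)).
  by apply/funext => t; rewrite /enorm -/(sqnorm _) sqnorm_line.
have dargs : is_derive (0 : R) 1
    (fun s => sqnorm x + 2 * s * x ord0 i + s ^+ 2) (2 * x ord0 i).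
  by deriv; rewrite /=; ring.
have arg0 : 0 < sqnorm x + 2 * 0 * x ord0 i + 0 ^+ 2.
  by rewrite mulr0 mul0r expr0n !addr0 -enorm_sqr exprn_gt0 // enorm_gt0.
rewrite E; apply: (derivative_eq (derivative_comp dargs (is_derive1_sqrt arg0))).
rewrite mulr0 mul0r expr0n !addr0 -/(enorm x).
by field; rewrite gt_eqF // enorm_gt0.
Qed.

Let line0 x i : x + (0 : R) *: basis i = x.
Proof. by rewrite scale0r addr0. Qed.

Let axisE i t : (0 : 'rV[R]_N.+1) + t *: basis i = t *: basis i.
Proof. by rewrite add0r. Qed.

Let dphi_neq0 x i : x != 0 ->
  is_derive x (basis i) phi (q (enorm x) * x ord0 i).
Proof.
move=> x0; rewrite -[X in is_derive X](line0 x i); apply/derivative_line.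
have e0 := enorm_gt0 x0; have [_ _ _ du _] := s.
have dn := denorm i x0.
have du0 : is_derive (enorm (x + (0 : R) *: basis i)) 1 u (p (enorm x)).
  by rewrite line0; exact: du.
apply: (derivative_eq (derivative_comp dn du0)).
by rewrite qE //; field; rewrite gt_eqF.
Qed.

Let basis_neq0 i t : t != 0 -> t *: basis i != 0.
Proof.
by move=> t0; apply: contraNneq t0 => E; rewrite -normr_eq0 -(enorm_axis i) E
  -(scale0r (basis i)) enorm_axis normr0.
Qed.

(** At the origin the derivative is the limit of the derivatives along the
    coordinate axis. *)
Let dphi x i : is_derive x (basis i) phi (q (enorm x) * x ord0 i).
Proof.
have [->|x0] := eqVneq x 0; last exact: dphi_neq0.
pose k t := q `|t| * t.
suff H : is_derive (0 + (0 : R) *: basis i) (basis i) phi (k 0).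
  by rewrite line0 in H; apply: (is_derive_eq H); rewrite mxE /k !mulr0.
apply/derivative_line.
have [cu _ _ _ _] := s.
apply: (derivative_extend (k := k)).
- move=> t t0; apply/derivative_line; rewrite axisE.
  apply: (is_derive_eq (dphi_neq0 i (basis_neq0 i t0))).
  by rewrite enorm_axis !mxE !eqxx mulr1.
- have -> : (fun s => phi (0 + s *: basis i)) = (fun s => u `|s|).
    by apply/funext => t; rewrite axisE /phi enorm_axis.
  by apply: continuous_at_comp (continuous_at_norm 0) (cu _ _).
- apply: continuous_atM (continuous_at_id _).
  exact: continuous_at_comp (continuous_at_norm 0) (cq _).
Qed.

Let pderive1 i : pderive i phi = fun x => q (enorm x) * x ord0 i.
Proof. by apply/funext => x; rewrite /pderive; have [_ ->] := dphi x i. Qed.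

(** The second summand is to be read as [0] at the origin, in accordance with
    [w 0 = 0]. *)
Let hess i j x := q (enorm x) * (i == j)%:R
  + w (enorm x) * (x ord0 i * x ord0 j / enorm x ^+ 2).

Let dpderive x i j : is_derive x (basis j) (pderive i phi) (hess i j x).
Proof.
rewrite pderive1.
suff H : is_derive (x + (0 : R) *: basis j) (basis j)
    (fun x => q (enorm x) * x ord0 i) (hess i j x).
  by rewrite line0 in H.
apply/derivative_line; have [->|x0] := eqVneq x 0.
  apply/is_derive1_caratheodory.
  exists (fun t => q `|t| * (i == j)%:R); split.
  - by move=> t; rewrite !axisE !enorm_axis !mxE !eqxx /= mul0r mulr0 !subr0; ring.
  - suff [] : continuous_at (fun t => q `|t| * (i == j)%:R) 0 by [].
    apply: continuous_atM (continuous_at_cst _ _).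
    exact: continuous_at_comp (continuous_at_norm 0) (cq _).
  - rewrite /hess mxE !mul0r mulr0 addr0 normr0.
    by rewrite -(scale0r (basis i)) enorm_axis normr0.
have e0 := enorm_gt0 x0; have dn := denorm j x0.
have dq0 : is_derive (enorm (x + (0 : R) *: basis j)) 1 q (w (enorm x) / enorm x).
  by rewrite line0; exact: dq.
have dc : is_derive (0 : R) 1 (fun s => (x + s *: basis j) ord0 i) (i == j)%:R.
  rewrite (_ : (fun s => _) = fun s => x ord0 i + s * (i == j)%:R); last first.
    by apply/funext => t; rewrite line_coord.
  by deriv; rewrite /=; ring.
apply: (derivative_eq (derivativeM (derivative_comp dn dq0) dc)).
by rewrite line0 /hess; field; rewrite gt_eqF.
Qed.

Let pderive2 i j : pderive j (pderive i phi) = hess i j.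
Proof. by apply/funext => x; rewrite /pderive; have [_ ->] := dpderive x i j. Qed.

Let cenorm (g : R -> R) : (forall r, 0 <= r -> continuous_at g r) ->
  continuous (fun x : 'rV[R]_N.+1 => g (enorm x)).
Proof.
move=> cg x; apply: continuous_comp; first exact: enorm_continuous.
by case: (cg _ (enorm_ge0 x)).
Qed.

Let cphi : continuous phi.
Proof. by have [cu _ _ _ _] := s; exact: cenorm. Qed.

Let ccoord i : continuous (fun x : 'rV[R]_N.+1 => x ord0 i).
Proof. by move=> x; exact: coord_continuous. Qed.

Let cpderive i : continuous (pderive i phi).
Proof.
rewrite pderive1 => x; apply: (@continuousM _ _ (fun x => q (enorm x))).
  by apply: (cenorm (g := q)) => r _; exact: cq.
exact: ccoord.
Qed.

Let angle x i j : `|x ord0 i * x ord0 j / enorm x ^+ 2| <= 1.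
Proof.
have [->|x0] := eqVneq x 0; first by rewrite !mxE !mul0r normr0.
have e0 := enorm_gt0 x0.
rewrite normrM normfV (ger0_norm (sqr_ge0 _)) ler_pdivrMr ?exprn_gt0 // mul1r.
by rewrite normrM expr2; apply: ler_pM => //; exact: coord_le_enorm.
Qed.

Let chess i j : continuous (hess i j).
Proof.
have c1 : continuous (fun x : 'rV[R]_N.+1 => q (enorm x)).
  by apply: (cenorm (g := q)) => r _; exact: cq.
have c2 : continuous (fun x : 'rV[R]_N.+1 => w (enorm x)).
  by apply: (cenorm (g := w)) => r _; exact: cw.
move=> x; apply: (@continuousD _ _ _ (fun x => q (enorm x) * (i == j)%:R)).
  by apply: (@continuousM _ _ (fun x => q (enorm x))); [exact: c1|exact: cst_continuous].
have [->|x0] := eqVneq x 0.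
  apply: (@continuous_mul_bounded _ _ (fun x => w (enorm x))) => [||y].
  - exact: c2.
  - by rewrite -(scale0r (basis i)) enorm_axis normr0 w0.
  - exact: angle.
apply: (@continuousM _ _ (fun x => w (enorm x))); first exact: c2.
apply: (@continuousM _ _ (fun x : 'rV[R]_N.+1 => x ord0 i * x ord0 j)).
  by apply: (@continuousM _ _ (fun x : 'rV[R]_N.+1 => x ord0 i)); exact: ccoord.
apply: (@continuousV _ _ (fun x : 'rV[R]_N.+1 => enorm x ^+ 2)).
  by rewrite expf_neq0 // gt_eqF // enorm_gt0.
apply: (@continuous_comp _ _ _ (@enorm R N.+1) (fun t => t ^+ 2)).
  exact: enorm_continuous.
exact: exprn_continuous.
Qed.

Lemma ground_solution_class_C2 : class_C 2 phi.
Proof.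
split=> [|i]; first exact: cphi.
split=> [x|]; first by have [] := dphi x i.
split=> [|j]; first exact: cpderive.
split=> [x|]; first by have [] := dpderive x i j.
by rewrite pderive2 /=; exact: chess.
Qed.

Lemma ground_solution_equation x : laplacian phi x + f (phi x) = 0.
Proof.
rewrite /laplacian (eq_bigr (fun i => q (enorm x)
    + w (enorm x) * (x ord0 i ^+ 2 / enorm x ^+ 2))); last first.
  by move=> i _; rewrite pderive2 /hess eqxx mulr1 expr2.
rewrite big_split /= sumr_const card_ord -big_distrr -big_distrl /=.
rewrite -/(sqnorm x) -enorm_sqr -[q (enorm x) *+ _]mulr_natl -/n.
have we : w (enorm x) = - (n * q (enorm x)) - f (phi x).
  by rewrite /w ger0_norm ?enorm_ge0.
have [->|x0] := eqVneq x 0.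
  have e0 : enorm (0 : 'rV[R]_N.+1) = 0.
    by rewrite -(scale0r (basis ord0)) enorm_axis normr0.
  rewrite /phi e0 w0 mul0r addr0; move: w0; rewrite /w normr0; lra.
rewrite divff ?mulr1 ?we; first ring.
by rewrite expf_neq0 // gt_eqF // enorm_gt0.
Qed.

Lemma ground_solution_vanishing :
  phi x @[x --> @enorm_pinfty R N.+1] --> (0 : R).
Proof.
have [_ _ uv] := gs; apply/cvgrPdist_lt => e e0.
have [rho rho0 H] := uv e e0; exists rho => // x /= xr.
by rewrite sub0r normrN; apply: H; exact: ltW.
Qed.

End Construction.

End RadialFunctions.

(** * Existence and uniqueness *)

Lemma nonlin_factor (R : realType) (a1 a2 a3 : R) : a1 < 0 -> 0 < a3 ->
  exists th b, [/\ 0 < th, 0 < b & forall v, 0 < v ->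
    nonlin a3 th b v = a1 * (`|v| * v) + a2 * (`|v| ^+ 2 * v)
      + a3 * (`|v| ^+ 3 * v)].
Proof.
move=> a10 a30; pose D := a2 ^+ 2 - 4 * a1 * a3.
have aa : a1 * a3 < 0 by rewrite pmulr_llt0.
have D0 : a2 ^+ 2 < D by rewrite /D -mulrA; lra.
have Dp : 0 <= D by apply: le_trans (ltW D0); exact: sqr_ge0.
have sD : Num.sqrt D ^+ 2 = D by rewrite sqr_sqrtr.
have lt : `|a2| < Num.sqrt D by rewrite -sqrtr_sqr ltr_sqrt // (le_lt_trans (sqr_ge0 a2)).
have := ler_norm a2; have := ler_norm (- a2); rewrite normrN => h1 h2.
exists ((- a2 + Num.sqrt D) / (2 * a3)), ((a2 + Num.sqrt D) / (2 * a3)); split.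
- by rewrite divr_gt0 ?mulr_gt0 //; lra.
- by rewrite divr_gt0 ?mulr_gt0 //; lra.
move=> v v0; rewrite gtr0_norm // /nonlin.
have E : Num.sqrt D * Num.sqrt D = a2 ^+ 2 - 4 * a1 * a3 by rewrite -expr2 sD.
have -> : a3 * v ^+ 2 * (v - (- a2 + Num.sqrt D) / (2 * a3)) *
    (v + (a2 + Num.sqrt D) / (2 * a3)) =
  a3 * v ^+ 2 * (v ^+ 2 + a2 / a3 * v +
    (a2 ^+ 2 - Num.sqrt D * Num.sqrt D) / (4 * a3 ^+ 2)).
  by field; rewrite gt_eqF.
by rewrite E; field; rewrite gt_eqF.
Qed.

Unset Implicit Arguments.

Theorem proposition1p2 (R : realType) (n : nat) (a1 a2 a3 : R)
    (hn : n = 2%N \/ n = 3%N)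
    (ha1 : a1 < 0) (ha2 : a2 < 0 \/ 0 < a2) (ha3 : 0 < a3) :
  exists! phi : 'rV[R]_n -> R,
    [/\ class_C 2 phi,
        radial phi,
        (forall x, 0 < phi x),
        phi x @[x --> @enorm_pinfty R n] --> (0 : R) &
        forall x, laplacian phi x
                  + a1 * (`|phi x| * phi x)
                  + a2 * (`|phi x| ^+ 2 * phi x)
                  + a3 * (`|phi x| ^+ 3 * phi x) = 0].
Proof.
have [N nE hN] : exists2 N, n = N.+1 & N = 1%N \/ N = 2%N.
  by case: hn => ->; [exists 1%N; last left|exists 2%N; last right].
rewrite {}nE {hn}.
have [th [b [th0 b0 fE]]] := nonlin_factor a2 ha1 ha3.
have [u [p gs]] := ground_state_exists ha3 th0 b0 hN.
exists (fun x => u (enorm x)); split.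
  split.
  - exact: ground_solution_class_C2 gs.
  - by move=> x y ->.
  - by move=> x; have [_ up _] := gs; exact/up/enorm_ge0.
  - exact: ground_solution_vanishing gs.
  - move=> x; have := ground_solution_equation gs x.
    rewrite fE; first by rewrite !addrA.
    by have [_ up _] := gs; exact/up/enorm_ge0.
move=> phi [phiC2 phi_radial phi0 phi_lim eqn].
have [|q gq] := profile_ground_state (a := a3) (th := th) (b := b)
  phiC2 phi_radial phi0 phi_lim.
  by move=> x; rewrite fE // !addrA.
apply/funext => x; rewrite (radial_profile phi_radial).
exact: (ground_state_unique ha3 th0 b0 hN gs gq (enorm_ge0 x)).
Qed.
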